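(* Let $(M,g)$ and $(N,h)$ be Riemannian manifolds and let $\phi : M \to N$ be a biharmonic map. Then the rough Laplacian of the biharmonic stress-energy tensor $S_2$ of $\phi$ is the symmetric $(0,2)$-tensor \begin{align*} (\Delta^{R} S_2)(X,Y) = {}& \Big( 2\langle \Delta \tau(\phi), \tau(\phi)\rangle - 2 |\nabla \tau(\phi)|^2 -2 \sum_{i,j} \langle R(X_i,X_j)d\phi(X_i), \nabla_{X_j}\tau(\phi)\rangle \\ & \ -2 \langle d\phi(\mathrm{Ricci}^{M}(\cdot)),\nabla_{\cdot}\tau(\phi)\rangle -2\langle \nabla d\phi , \nabla^{2} \tau(\phi) \rangle + 2 \langle d\phi(\cdot) , \nabla_{\cdot}(\Delta \tau(\phi))\rangle \Big) g(X,Y)\\ & + 2 \langle \nabla_{X}\tau(\phi) , \nabla_{Y}\tau(\phi)\rangle + \sum_i \langle R(X_i,X)d\phi(X_i) , \nabla_{Y}\tau(\phi)\rangle +\sum_i \langle R(X_i,Y)d\phi(X_i), \nabla_{X} \tau(\phi)\rangle \\ &+ \langle d\phi(\mathrm{Ricci}^{M}(X)), \nabla_{Y}\tau(\phi)\rangle + \langle d\phi(\mathrm{Ricci}^{M}(Y)), \nabla_{X}\tau(\phi)\rangle \\ & + 2\sum_i \langle \nabla d\phi(X_i,X),(\nabla^2 \tau(\phi))(X_i,Y)\rangle + 2\sum_i \langle \nabla d\phi(X_i,Y),(\nabla^2 \tau(\phi))(X_i,X)\rangle \\ & -\langle d\phi(X),\nabla_{Y}(\Delta \tau(\phi))\rangle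 - \langle d\phi(Y),\nabla_{X}(\Delta \tau(\phi))\rangle + \sum_i \langle d\phi(X), R(X_i , Y)\nabla_{X_i}\tau(\phi)\rangle \\ &+\sum_i \langle d\phi(Y), R(X_i , X)\nabla_{X_i}\tau(\phi)\rangle + \sum_i \langle d\phi(X), \nabla_{X_i} \big(R(X_i ,Y)\tau(\phi)\big)\rangle \\ &+\sum_i \langle d\phi(Y), \nabla_{X_i} \big(R(X_i ,X)\tau(\phi)\big)\rangle + \langle d\phi(X), \nabla_{\mathrm{Ricci}^{M}(Y)}\tau(\phi)\rangle + \langle d\phi(Y), \nabla_{\mathrm{Ricci}^{M}(X)}\tau(\phi)\rangle , \end{align*} where $\{X_i\}$ is a geodesic frame around the point $p\in M$ and all expressions are evaluated at $p$.
   Context: All objects are smooth. The curvature convention is $R(X,Y)=[\nabla_X,\nabla_Y]-\nabla_{[X,Y]}$ for every connection. $R^N$ is the curvature tensor of $N$, and $R$ without superscript is the curvature of the pull-back bundle $\phi^{-1}TN$ with its pull-back connection (also denoted $\nabla$, or $\nabla^\phi$), so $R(X,Y)\sigma = R^N(d\phi(X),d\phi(Y))\sigma$ for sections $\sigma$ of $\phi^{-1}TN$. $\mathrm{Ricci}^M$ is the Ricci tensor of $M$ viewed as an endomorphism of $TM$, $\mathrm{Ricci}^M(X)=\sum_i R^M(X,X_i)X_i$. For a smooth map $\phi:(M,g)\to(N,h)$, $\nabla d\phi$ is its second fundamental form, $(\nabla d\phi)(X,Y)=\nabla_X(d\phi(Y))-d\phi(\nabla_XY)$, and $\tau(\phi)=\mathrm{trace}\,\nabla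 d\phi$ is the tension field. The map $\phi$ is biharmonic if $\tau_2(\phi)=\mathrm{trace}(\nabla^\phi)^2\tau(\phi)-\mathrm{trace}\,R^N(d\phi(\cdot),\tau(\phi))d\phi(\cdot)=0$. For a section $\sigma$ of $\phi^{-1}TN$, $(\nabla^2\sigma)(X,Y)=\nabla_X\nabla_Y\sigma-\nabla_{\nabla_XY}\sigma$ and $\Delta\sigma=-\mathrm{trace}\,\nabla^2\sigma$. The rough Laplacian on tensors is $\Delta^R S=-\mathrm{trace}\,\nabla^2 S$. The biharmonic stress-energy tensor is $$S_2(X,Y)=\Big\{\tfrac{|\tau(\phi)|^2}{2}+\langle d\phi,\nabla\tau(\phi)\rangle\Big\}g(X,Y)-\langle d\phi(X),\nabla_Y\tau(\phi)\rangle-\langle d\phi(Y),\nabla_X\tau(\phi)\rangle ,$$ with $\langle d\phi,\nabla\tau(\phi)\rangle=\sum_i\langle d\phi(X_i),\nabla_{X_i}\tau(\phi)\rangle$ for an orthonormal frame $\{X_i\}$. Expressions with dots are traced over an orthonormal frame: $\langle d\phi(\mathrm{Ricci}^M(\cdot)),\nabla_\cdot\tau(\phi)\rangle=\sum_i\langle d\phi(\mathrm{Ricci}^M(X_i)),\nabla_{X_i}\tau(\phi)\rangle$ and $\langle d\phi(\cdot),\nabla_\cdot(\Delta\tau(\phi))\rangle=\sum_i\langle d\phi(X_i),\nabla_{X_i}(\Delta\tau(\phi))\rangle$. Also $\langle\nabla d\phi,\nabla^2\tau(\phi)\rangle=\sum_{i,j}\langle\nabla d\phi(X_i,X_j),(\nabla^2\tau(\phi))(X_i,X_j)\rangle$.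 A geodesic frame $\{X_i\}$ around $p$ is a local orthonormal frame obtained by parallel transport along radial geodesics of an orthonormal basis of $T_pM$; in particular $\nabla X_i=0$ at $p$. The vectors $X,Y$ are taken to be members of this frame (or constant-coefficient linear combinations of them), which fixes the meaning of $\nabla_{X_i}(R(X_i,Y)\tau(\phi))$, the covariant derivative of the section $R(X_i,Y)\tau(\phi)$. *)

(* Defs.v *)
From mathcomp Require Import all_boot all_order all_algebra.
From mathcomp Require Import all_classical all_reals all_analysis.
Set Implicit Arguments.
Unset Strict Implicit.
Unset Printing Implicit Defensive.
Import Order.TTheory GRing.Theory Num.Theory.
Import numFieldNormedType.Exports.
Local Open Scope classical_set_scope.
Local Open Scope ring_scope.

(* C^oo on an open set: every iterated directional derivative is (Frechet)
   differentiable at every point of the set. *)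
Definition smooth_on {R : realType} {V W : normedModType R}
    (U : set V) (f : V -> W) : Prop :=
  forall (s : seq V) (x : V), U x ->
    differentiable (foldr (fun (v : V) (h : V -> W) (y : V) => 'D_v h y) f s) x.

(* The selected chart [chart_at q] around each point q identifies T_q M with
   R^n; a tangent vector at q is thus a row vector, its components in
   [chart_at q].  [cmap] and [cinv] are meaningful only on the chart domain and
   on its image. *)
Record manifold (R : realType) (n : nat) := Manifold {
  point :> topologicalType;
  chart : Type;
  cdom : chart -> set point;
  cmap : chart -> point -> 'rV[R]_n;
  cinv : chart -> 'rV[R]_n -> point;
  chart_at : point -> chart;
  point_hausdorff : hausdorff_space point;
  point_second_countable : @second_countable point;
  cdom_open : forall c, open (cdom c);
  cimage_open : forall c, open (cmap c @` cdom c);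
  cmapK : forall c q, cdom c q -> cinv c (cmap c q) = q;
  cmap_continuous : forall c q, cdom c q -> {for q, continuous (cmap c)};
  cinv_continuous : forall c x, (cmap c @` cdom c) x ->
    {for x, continuous (cinv c)};
  transition_smooth : forall c c',
    smooth_on (cmap c @` (cdom c `&` cdom c')) (cmap c' \o cinv c);
  chart_at_dom : forall q, cdom (chart_at q) q }.

Definition coords {R : realType} {n} {M : manifold R n} (q : M) : 'rV[R]_n :=
  cmap (chart_at q) q.

(* Components in the chart c of a tangent vector at q. *)
Definition tcoord {R : realType} {n} {M : manifold R n} (c : chart M) (q : M)
    (v : 'rV[R]_n) : 'rV[R]_n :=
  'D_v (cmap c \o cinv (chart_at q)) (coords q).

(* The vector field on [cdom c] whose components in the chart c are the
   constants a. *)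
Definition coord_field {R : realType} {n} {M : manifold R n} (c : chart M)
    (a : 'rV[R]_n) (q : M) : 'rV[R]_n :=
  'D_a (cmap (chart_at q) \o cinv c) (cmap c q).

(* Functions, maps, and sections are total; the ones that are only defined
   locally are smooth on a given open set and arbitrary outside of it. *)
Definition smooth_fun {R : realType} {n} {M : manifold R n}
    {W : normedModType R} (U : set M) (f : M -> W) : Prop :=
  forall c, smooth_on (cmap c @` (U `&` cdom c)) (f \o cinv c).

Definition smooth_map {R : realType} {m n} {M : manifold R m}
    {N : manifold R n} (phi : M -> N) : Prop :=
  continuous phi /\
  forall c d, smooth_on (cmap c @` (cdom c `&` phi @^-1` cdom d))
                        (cmap d \o phi \o cinv c).

Definition dfun {R : realType} {n} {M : manifold R n} {W : normedModType R}
    (f : M -> W) (q : M) (v : 'rV[R]_n) : W :=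
  'D_v (f \o cinv (chart_at q)) (coords q).

Definition dmap {R : realType} {m n} {M : manifold R m} {N : manifold R n}
    (phi : M -> N) (q : M) (v : 'rV[R]_m) : 'rV[R]_n :=
  dfun (cmap (chart_at (phi q)) \o phi) q v.

(* A section of phi^{-1}TN is a function sigma with sigma q in T_(phi q) N;
   for phi = id, it is a vector field. *)
Definition smooth_section {R : realType} {m n} {M : manifold R m}
    {N : manifold R n} (phi : M -> N) (U : set M) (sigma : M -> 'rV[R]_n) :
    Prop :=
  forall c d,
    smooth_on (cmap c @` (U `&` (cdom c `&` phi @^-1` cdom d)))
      ((fun q => tcoord d (phi q) (sigma q)) \o cinv c).

Definition smooth_field {R : realType} {n} {M : manifold R n} :
    set M -> (M -> 'rV[R]_n) -> Prop :=
  smooth_section (@idfun M).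

Definition pushf {R : realType} {m n} {M : manifold R m} {N : manifold R n}
    (phi : M -> N) (X : M -> 'rV[R]_m) (q : M) : 'rV[R]_n :=
  dmap phi q (X q).

(* [X, Y]^k = X^j d_j Y^k - Y^j d_j X^k, computed in the chart at q *)
Definition lie {R : realType} {n} {M : manifold R n}
    (X Y : M -> 'rV[R]_n) (q : M) : 'rV[R]_n :=
  dfun (fun r => tcoord (chart_at q) r (Y r)) q (X q) -
  dfun (fun r => tcoord (chart_at q) r (X r)) q (Y q).

(* g q is the Gram matrix of the metric on T_q M in the chart at q. *)
Definition inner {R : realType} {n} {M : manifold R n} (g : M -> 'M[R]_n)
    (q : M) (u v : 'rV[R]_n) : R :=
  (u *m g q *m v^T) ord0 ord0.

Record riemannian {R : realType} {n} {M : manifold R n} (g : M -> 'M[R]_n) :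
    Prop := Riemannian {
  metric_sym : forall q u v, inner g q u v = inner g q v u;
  metric_pos : forall q u, u != 0 -> 0 < inner g q u u;
  metric_smooth : forall (U : set M) (X Y : M -> 'rV[R]_n), open U ->
    smooth_field U X -> smooth_field U Y ->
    smooth_fun U (fun q => inner g q (X q) (Y q)) }.

(* Connections on phi^{-1}TN, as operators on local sections;
   [conn_local] says that over U only the restrictions to U matter. *)
Record connection {R : realType} {m n} {M : manifold R m} {N : manifold R n}
    (phi : M -> N)
    (D : (M -> 'rV[R]_m) -> (M -> 'rV[R]_n) -> M -> 'rV[R]_n) : Prop :=
  Connection {
  conn_local : forall (U : set M) X X' sigma sigma', open U ->
    {in U, X =1 X'} -> {in U, sigma =1 sigma'} ->
    smooth_field U X -> smooth_section phi U sigma ->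
    {in U, D X sigma =1 D X' sigma'};
  conn_smooth : forall (U : set M) X sigma, open U ->
    smooth_field U X -> smooth_section phi U sigma ->
    smooth_section phi U (D X sigma);
  conn_linear : forall (U : set M) (f : M -> R) X Y sigma, open U ->
    smooth_fun U f -> smooth_field U X -> smooth_field U Y ->
    smooth_section phi U sigma ->
    {in U, forall q, D (fun r => f r *: X r + Y r) sigma q =
                     f q *: D X sigma q + D Y sigma q};
  conn_leibniz : forall (U : set M) (f : M -> R) X sigma rho, open U ->
    smooth_fun U f -> smooth_field U X ->
    smooth_section phi U sigma -> smooth_section phi U rho ->
    {in U, forall q, D X (fun r => f r *: sigma r + rho r) q =
                     dfun f q (X q) *: sigma q + f q *: D X sigma q +
                     D X rho q} }.

Record levi_civita {R : realType} {n} {M : manifold R n} (g : M -> 'M[R]_n)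
    (D : (M -> 'rV[R]_n) -> (M -> 'rV[R]_n) -> M -> 'rV[R]_n) : Prop :=
  LeviCivita {
  lc_connection : connection (@idfun M) D;
  lc_torsion_free : forall (U : set M) X Y, open U ->
    smooth_field U X -> smooth_field U Y ->
    {in U, forall q, D X Y q - D Y X q = lie X Y q};
  lc_metric : forall (U : set M) X Y Z, open U ->
    smooth_field U X -> smooth_field U Y -> smooth_field U Z ->
    {in U, forall q, dfun (fun r => inner g r (Y r) (Z r)) q (X q) =
                     inner g q (D X Y q) (Z q) + inner g q (Y q) (D X Z q)} }.

(* nabla^phi_X (Z o phi) = nabla^N_(dphi X) Z.  The vector dphi_q (X q) is
   extended around phi q to a field with constant coordinates, as nabla^N takes
   fields. *)
Record pullback_connection {R : realType} {m n} {M : manifold R m}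
    {N : manifold R n} (phi : M -> N)
    (DN : (N -> 'rV[R]_n) -> (N -> 'rV[R]_n) -> N -> 'rV[R]_n)
    (D : (M -> 'rV[R]_m) -> (M -> 'rV[R]_n) -> M -> 'rV[R]_n) : Prop :=
  PullbackConnection {
  pb_connection : connection phi D;
  pb_pullback : forall (U : set M) (V : set N) X Z, open U -> open V ->
    smooth_field U X -> smooth_field V Z ->
    {in U `&` phi @^-1` V, forall q,
       D X (Z \o phi) q =
       DN (coord_field (chart_at (phi q)) (pushf phi X q)) Z (phi q)} }.

Definition curvature {R : realType} {m n} {M : manifold R m}
    (D : (M -> 'rV[R]_m) -> (M -> 'rV[R]_n) -> M -> 'rV[R]_n)
    (X Y : M -> 'rV[R]_m) (sigma : M -> 'rV[R]_n) (q : M) : 'rV[R]_n :=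
  D X (D Y sigma) q - D Y (D X sigma) q - D (lie X Y) sigma q.

(* The curvature tensor on tangent vectors at q, extended to fields with
   constant coordinates in the chart at q. *)
Definition curvature_tensor {R : realType} {n} {N : manifold R n}
    (D : (N -> 'rV[R]_n) -> (N -> 'rV[R]_n) -> N -> 'rV[R]_n)
    (q : N) (u v w : 'rV[R]_n) : 'rV[R]_n :=
  let E := coord_field (chart_at q) in curvature D (E u) (E v) (E w) q.

(* Trace at q of a C^oo(M)-bilinear expression in two vector fields:
   sum of g^{ij} B(d_i, d_j) over the coordinate fields of the chart at q. *)
Definition mtrace {R : realType} {n} {M : manifold R n} (g : M -> 'M[R]_n)
    {V : lmodType R} (B : (M -> 'rV[R]_n) -> (M -> 'rV[R]_n) -> M -> V)
    (q : M) : V :=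
  \sum_(i < n) \sum_(j < n) invmx (g q) i j *:
    B (coord_field (chart_at q) (delta_mx ord0 i))
      (coord_field (chart_at q) (delta_mx ord0 j)) q.

Definition ricci {R : realType} {n} {M : manifold R n} (g : M -> 'M[R]_n)
    (D : (M -> 'rV[R]_n) -> (M -> 'rV[R]_n) -> M -> 'rV[R]_n)
    (X : M -> 'rV[R]_n) : M -> 'rV[R]_n :=
  mtrace g (fun Y Z => curvature D X Y Z).

(* nabla_Z S, for a (0,2)-tensor S viewed as a C^oo(M)-bilinear operation on
   vector fields *)
Definition cov_tensor {R : realType} {n} {M : manifold R n}
    (D : (M -> 'rV[R]_n) -> (M -> 'rV[R]_n) -> M -> 'rV[R]_n)
    (S : (M -> 'rV[R]_n) -> (M -> 'rV[R]_n) -> M -> R)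
    (Z X Y : M -> 'rV[R]_n) (q : M) : R :=
  dfun (S X Y) q (Z q) - S (D Z X) Y q - S X (D Z Y) q.

Definition rough_laplacian {R : realType} {n} {M : manifold R n}
    (g : M -> 'M[R]_n)
    (D : (M -> 'rV[R]_n) -> (M -> 'rV[R]_n) -> M -> 'rV[R]_n)
    (S : (M -> 'rV[R]_n) -> (M -> 'rV[R]_n) -> M -> R)
    (X Y : M -> 'rV[R]_n) (q : M) : R :=
  - mtrace g (V := R^o)
      (fun W Z r => cov_tensor D (cov_tensor D S Z) W X Y r -
                    cov_tensor D S (D W Z) X Y r) q.

(* In what follows, DM and DN are the Levi-Civita
   connections of (M, g) and (N, h), and D is the induced connection of
   phi^{-1}TN. *)

Definition second_fundamental_form {R : realType} {m n} {M : manifold R m}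
    {N : manifold R n} (phi : M -> N)
    (DM : (M -> 'rV[R]_m) -> (M -> 'rV[R]_m) -> M -> 'rV[R]_m)
    (D : (M -> 'rV[R]_m) -> (M -> 'rV[R]_n) -> M -> 'rV[R]_n)
    (X Y : M -> 'rV[R]_m) (q : M) : 'rV[R]_n :=
  D X (pushf phi Y) q - pushf phi (DM X Y) q.

Definition tension {R : realType} {m n} {M : manifold R m} {N : manifold R n}
    (g : M -> 'M[R]_m) (phi : M -> N)
    (DM : (M -> 'rV[R]_m) -> (M -> 'rV[R]_m) -> M -> 'rV[R]_m)
    (D : (M -> 'rV[R]_m) -> (M -> 'rV[R]_n) -> M -> 'rV[R]_n) :
    M -> 'rV[R]_n :=
  mtrace g (second_fundamental_form phi DM D).

Definition hessian {R : realType} {m n} {M : manifold R m}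
    (DM : (M -> 'rV[R]_m) -> (M -> 'rV[R]_m) -> M -> 'rV[R]_m)
    (D : (M -> 'rV[R]_m) -> (M -> 'rV[R]_n) -> M -> 'rV[R]_n)
    (sigma : M -> 'rV[R]_n) (X Y : M -> 'rV[R]_m) (q : M) : 'rV[R]_n :=
  D X (D Y sigma) q - D (DM X Y) sigma q.

Definition laplacian {R : realType} {m n} {M : manifold R m}
    (g : M -> 'M[R]_m)
    (DM : (M -> 'rV[R]_m) -> (M -> 'rV[R]_m) -> M -> 'rV[R]_m)
    (D : (M -> 'rV[R]_m) -> (M -> 'rV[R]_n) -> M -> 'rV[R]_n)
    (sigma : M -> 'rV[R]_n) (q : M) : 'rV[R]_n :=
  - mtrace g (hessian DM D sigma) q.

Definition bitension {R : realType} {m n} {M : manifold R m}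
    {N : manifold R n} (g : M -> 'M[R]_m) (phi : M -> N)
    (DM : (M -> 'rV[R]_m) -> (M -> 'rV[R]_m) -> M -> 'rV[R]_m)
    (DN : (N -> 'rV[R]_n) -> (N -> 'rV[R]_n) -> N -> 'rV[R]_n)
    (D : (M -> 'rV[R]_m) -> (M -> 'rV[R]_n) -> M -> 'rV[R]_n)
    (q : M) : 'rV[R]_n :=
  let tau := tension g phi DM D in
  mtrace g (hessian DM D tau) q -
  mtrace g (fun X Y r => curvature_tensor DN (phi r)
                           (pushf phi X r) (tau r) (pushf phi Y r)) q.

Definition biharmonic {R : realType} {m n} {M : manifold R m}
    {N : manifold R n} (g : M -> 'M[R]_m) (phi : M -> N)
    (DM : (M -> 'rV[R]_m) -> (M -> 'rV[R]_m) -> M -> 'rV[R]_m)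
    (DN : (N -> 'rV[R]_n) -> (N -> 'rV[R]_n) -> N -> 'rV[R]_n)
    (D : (M -> 'rV[R]_m) -> (M -> 'rV[R]_n) -> M -> 'rV[R]_n) : Prop :=
  smooth_map phi /\ forall q, bitension g phi DM DN D q = 0.

Definition stress_bienergy {R : realType} {m n} {M : manifold R m}
    {N : manifold R n} (g : M -> 'M[R]_m) (h : N -> 'M[R]_n) (phi : M -> N)
    (DM : (M -> 'rV[R]_m) -> (M -> 'rV[R]_m) -> M -> 'rV[R]_m)
    (D : (M -> 'rV[R]_m) -> (M -> 'rV[R]_n) -> M -> 'rV[R]_n)
    (X Y : M -> 'rV[R]_m) (q : M) : R :=
  let tau := tension g phi DM D in
  let T := fun (V W : M -> 'rV[R]_m) (r : M) =>
    inner h (phi r) (pushf phi V r) (D W tau r) in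
  (inner h (phi q) (tau q) (tau q) / 2 + mtrace g (V := R^o) T q) *
    inner g q (X q) (Y q) - T X Y q - T Y X q.

Definition velocity {R : realType} {n} {M : manifold R n} (gamma : R -> M)
    (t : R) : 'rV[R]_n :=
  derive1 (cmap (chart_at (gamma t)) \o gamma) t.

(* Covariant derivative at t of a field V along gamma:
   (V^k)' + Gamma^k_ij gamma'^i V^j in the chart at gamma t, the Christoffel
   term being the covariant derivative of a constant-coordinate field along a
   constant-coordinate field. *)
Definition cov_curve {R : realType} {n} {M : manifold R n}
    (D : (M -> 'rV[R]_n) -> (M -> 'rV[R]_n) -> M -> 'rV[R]_n)
    (gamma : R -> M) (V : R -> 'rV[R]_n) (t : R) : 'rV[R]_n :=
  let c := chart_at (gamma t) in
  derive1 (fun s => tcoord c (gamma s) (V s)) t +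
  D (coord_field c (velocity gamma t)) (coord_field c (V t)) (gamma t).

(* A local orthonormal frame X_1, ..., X_n on a normal neighbourhood U of p,
   parallel along the geodesics issued from p.  In the identification of T_p M
   with R^n given by the basis (X_i(p)), E is the exponential map at p, a
   diffeomorphism from a star-shaped neighbourhood W of 0 onto U, with
   inverse L. *)
Definition geodesic_frame {R : realType} {n} {M : manifold R n}
    (g : M -> 'M[R]_n)
    (D : (M -> 'rV[R]_n) -> (M -> 'rV[R]_n) -> M -> 'rV[R]_n)
    (p : M) (U : set M) (X : 'I_n -> M -> 'rV[R]_n) : Prop :=
  [/\ open U /\ U p,
      forall i, smooth_field U (X i),
      {in U, forall q i j, inner g q (X i q) (X j q) = (i == j)%:R} &
      exists (W : set 'rV[R]_n) (E : 'rV[R]_n -> M) (L : M -> 'rV[R]_n),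
        [/\ [/\ open W, W 0 &
                forall v t, W v -> 0 <= t <= 1 -> W (t *: v)],
            [/\ forall v, W v -> U (E v) /\ L (E v) = v,
                forall q, U q -> W (L q) /\ E (L q) = q,
                forall v, W v -> {for v, continuous E},
                forall c, smooth_on (W `&` E @^-1` cdom c) (cmap c \o E) &
                smooth_fun U L],
            E 0 = p &
            forall v, let gamma := fun t : R => E (t *: v) in
              velocity gamma 0 = \sum_i v ord0 i *: X i p /\
              forall t, W (t *: v) ->
                cov_curve D gamma (velocity gamma) t = 0 /\
                forall i, cov_curve D gamma (X i \o gamma) t = 0]].

Definition frame_comb {R : realType} {n} {M : manifold R n}
    (X : 'I_n -> M -> 'rV[R]_n) (a : 'I_n -> R) (q : M) : 'rV[R]_n :=
  \sum_i a i *: X i q.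

(* Main.v *)
Require Import Defs.
From HB Require Import structures.
From mathcomp Require Import all_boot all_order all_algebra.
From mathcomp Require Import all_classical all_reals all_analysis.
From mathcomp Require Import ring lra.
Import Order.TTheory GRing.Theory Num.Theory.
Import numFieldNormedType.Exports.
Local Open Scope classical_set_scope.
Local Open Scope ring_scope.
Set Implicit Arguments.
Unset Strict Implicit.
Unset Printing Implicit Defensive.

(** Why the formula holds.  Write d for dphi, D for the pull-back connection,
    T(X,Y) = <dphi(X), D_Y tau>, and let (F_k) be the frame.  Traces of tensorial
    expressions may be computed in (F_k) instead of coordinates
    ([mtrace_frame]), and (F_k) is parallel at p ([geodesic_frame_parallel]),
    since it is parallel along the rays through p in all directions F_i(p).
    Hence, for X, Y with constant coefficients in the frame, the value at p of the
    second covariant derivative of a bilinear form S reduces to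
    F_k F_k (S(X,Y)) - S(N_k N_k X, Y) - S(X, N_k N_k Y), where N_k is the
    Levi-Civita derivative along F_k ([cov2_at], [rough_laplacian_at]).

    S_2 is f g - T - T^t with f = |tau|^2/2 + trace T.  The part f g contributes
    -(sum_k F_k F_k f) g(X,Y), because g is parallel.  For T the Leibniz rule
    [pullback_metric2] leaves sum_k <D_k dphi(X), D_k D_Y tau>, taken twice, and
    the second derivatives of the two 1-forms dphi and Y |-> D_Y tau, traced.
    Both are given by one Weitzenbock formula ([weitzenbock]) for a 1-form alpha
    with values in the pull-back bundle: commuting derivatives twice expresses
    the trace of its second derivative by its divergence, its exterior derivative,
    the curvature of D and the Ricci tensor.  For dphi the exterior derivative
    vanishes ([pushf_torsion_free]) and the divergence is tau; for D tau the exterior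
    derivative is R(.,.)tau and the divergence is - Delta tau.  This yields
    [trace_nabla2E], hence all the terms of the formula outside the coefficient
    of g, for an arbitrary map.

    The coefficient of g is minus the sum over k of F_k F_k f, that is
    <Delta tau, tau> - |D tau|^2 minus the trace of the expression found for T
    ([bienergy_density_laplacian]).  There, three sums are rewritten
    ([trace_trace_nabla2]): one by the skewness of R, one by the symmetry of Ricci
    ([ricci_trace]), and sum <dphi(F_j), D_k (R(F_k,F_j) tau)> by biharmonicity
    ([divergence_curvature_tension]): the pair symmetry of R^N turns the
    equation tau_2 = 0 into
    sum_j <dphi(F_j), R(F_k,F_j) tau> = - <Delta tau, dphi(F_k)> near p, whose
    divergence is - <dphi, D(Delta tau)> - <Delta tau, tau>.

    The rest supplies the calculus that these computations take for
    granted, from iterated directional derivatives in R^n: stability of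
    smoothness, the Schwarz theorem, independence of charts, the bracket as a
    commutator of derivations, tensoriality, and the pull-back connection
    (torsion-free, metric, with curvature R^N(dphi, dphi)), established in the
    coordinate frames of N. *)

(** * Iterated directional derivatives *)

Section DiffLocal.
Context {R : realType} {V W : normedModType R}.

(** The differential is defined by choice, so that locality has to be obtained
    from its uniqueness. *)
Lemma near_eq_diff (f g : V -> W) (x : V) : (\near x, f x = g x) ->
  differentiable f x -> differentiable g x /\ 'd g x = 'd f x :> (V -> W).
Proof.
move=> fg df.
have gE : g \o shift x = cst (g x) + 'd f x +o_ 0 id.
  apply/eqaddoP => e e0.
  have /eqaddoP/(_ e e0) := diff_locally df.
  rewrite -(nbhs_singleton fg).
  apply: filterS2 => /=; last first.
    by move: fg; rewrite (near_shift 0); exact.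
  move=> y; rewrite /= subr0 => fgy.
  by rewrite /GRing.add /GRing.opp/= fgy.
have dE := diff_unique (diff_continuous df) gE.
split; last exact: dE.
by apply/diff_locallyP; rewrite dE; split; [exact: diff_continuous|exact: gE].
Qed.

End DiffLocal.

Section ScaleBilinear.
Context {R : realType} {W : normedModType R}.

(** Scaling as a named constant, to which a bilinear structure can be
    attached. *)
Definition scale_fun (k : R^o) (w : W) : W := k *: w.

Lemma scale_is_bilinear :
  bilinear_for (GRing.Scale.Law.clone _ _ *:%R _)
    (GRing.Scale.Law.clone _ _ *:%R _) scale_fun.
Proof.
split=> [w|k] a x y /=; rewrite /scale_fun; first by rewrite scalerDl scalerA.
by rewrite scalerDr !scalerA mulrC.
Qed.

HB.instance Definition _ := bilinear_isBilinear.Build R R^o W W _ _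
  scale_fun scale_is_bilinear.

Lemma diff_scale {V : normedModType R} (k : V -> R) (f : V -> W) x :
  differentiable k x -> differentiable f x ->
  differentiable (fun y => k y *: f y) x /\
  forall v, 'D_v (fun y => k y *: f y) x = 'D_v k x *: f x + k x *: 'D_v f x.
Proof.
move=> dk df.
pose B : {bilinear R^o -> W -> W} := scale_fun.
have Bc : continuous (fun p => B p.1 p.2) by exact: scale_continuous.
have dp : differentiable (fun y => (k y : R^o, f y)) x by exact: differentiable_pair.
have dB := differentiable_bilin (k x : R^o, f x) Bc.
have dkf : differentiable (fun y => k y *: f y) x.
  exact: (differentiable_comp dp dB).
split=> // v; rewrite !deriveE//.
rewrite -[fun y => _]/((fun p => B p.1 p.2) \o (fun y => (k y : R^o, f y))).
rewrite diff_comp//= diff_bilin//= diff_pair//= addrC.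
by [].
Qed.

End ScaleBilinear.

Section DerivLinear.
Context {R : realType} {V W : normedModType R}.

Lemma derive_linear (f : V -> W) x a u v : differentiable f x ->
  'D_(a *: u + v) f x = a *: 'D_u f x + 'D_v f x.
Proof. by move=> df; rewrite !deriveE// linearP. Qed.

Lemma derive_suml (I : finType) (f : V -> W) x (a : I -> R) (u : I -> V) :
  differentiable f x ->
  'D_(\sum_i a i *: u i) f x = \sum_i a i *: 'D_(u i) f x.
Proof.
move=> df; rewrite !deriveE// linear_sum; apply: eq_bigr => i _.
by rewrite linearZ/= deriveE.
Qed.

Lemma derive_comp {V' : normedModType R} (f : V' -> V) (g : V -> W) x v :
  differentiable f x -> differentiable g (f x) ->
  'D_v (g \o f) x = 'D_('D_v f x) g (f x).
Proof.
move=> df dg; rewrite (deriveE _ (differentiable_comp df dg)).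
by rewrite (diff_comp df dg) (deriveE _ df) (deriveE _ dg).
Qed.

End DerivLinear.

Lemma derive_row {R : realType} {n} {W : normedModType R} (f : 'rV[R]_n -> W)
    x v : differentiable f x ->
  'D_v f x = \sum_j v ord0 j *: 'D_(delta_mx ord0 j) f x.
Proof. by move=> df; rewrite {1}(row_sum_delta v) derive_suml. Qed.

Section Ck.
Context {R : realType} {V W : normedModType R}.
Implicit Types (U : set V) (f g : V -> W).

(** Recursion on the order of differentiation, with the first derivative taken
    innermost: this form is the one that supports induction for products and
    composites. *)
Fixpoint Ck k U f : Prop :=
  if k is k'.+1 then
    (forall x, U x -> differentiable f x) /\ forall v, Ck k' U ('D_v f)
  else forall x, U x -> differentiable f x.

Lemma smooth_onP U f : smooth_on U f <-> forall k, Ck k U f.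
Proof.
split=> [Hf k|Hf s].
  elim: k f Hf => [|k IH] f Hf; first by move=> x Ux; exact: (Hf [::] x).
  split=> [x Ux|v]; first exact: (Hf [::] x).
  apply: IH => s x Ux; have := Hf (rcons s v) x Ux.
  by rewrite foldr_rcons.
elim/last_ind: s f Hf => [|s v IH] f Hf x Ux; first exact: (Hf 0).
rewrite foldr_rcons; apply: IH => // k.
by have [_] := Hf k.+1; exact.
Qed.

Lemma CkS k U f : Ck k.+1 U f -> Ck k U f.
Proof.
elim: k f => [|k IH] f; first by case.
by case=> H0 H; split=> // v; exact: IH.
Qed.

Lemma open_near U (P : V -> Prop) x : open U -> U x ->
  (forall y, U y -> P y) -> \near x, P x.
Proof. by move=> oU Ux H; near=> y; apply: H; near: y; exact: open_nbhs_nbhs.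
Unshelve. all: by end_near. Qed.

Lemma Ck_eq k U f g : open U -> (forall x, U x -> f x = g x) ->
  Ck k U f -> Ck k U g.
Proof.
move=> oU; elim: k f g => [|k IH] f g fg /=.
  move=> df x Ux; apply: (near_eq_diff _ (df x Ux)).1.
  exact: open_near fg.
case=> df H; split=> [x Ux|v].
  by apply: (near_eq_diff _ (df x Ux)).1; exact: open_near fg.
apply: IH (H v) => x Ux; apply: near_eq_derive; exact: open_near fg.
Qed.

Lemma Ck_cst k U (w : W) : Ck k U (fun=> w).
Proof.
elim: k w => [|k IH] w; first by move=> x _; exact: differentiable_cst.
split=> [x _|v]; first exact: differentiable_cst.
rewrite (_ : derive _ ^~ v = fun=> 0); first exact: IH.
by apply/funext => x; exact: derive_cst.
Qed.

Lemma CkD k U f g : open U -> Ck k U f -> Ck k U g ->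
  Ck k U (fun x => f x + g x).
Proof.
move=> oU; elim: k f g => [|k IH] f g /=.
  by move=> df dg x Ux; apply: differentiableD; [exact: df|exact: dg].
case=> df Hf [dg Hg]; split=> [x Ux|v].
  by apply: differentiableD; [exact: df|exact: dg].
apply: Ck_eq (IH _ _ (Hf v) (Hg v)) => // x Ux.
by rewrite deriveD//; apply: diff_derivable; [exact: df|exact: dg].
Qed.

Lemma Ck_sum k U (I : Type) (r : seq I) (F : I -> V -> W) : open U ->
  (forall i, Ck k U (F i)) -> Ck k U (fun x => \sum_(i <- r) F i x).
Proof.
move=> oU HF; elim: r => [|i r IH].
  under eq_fun do rewrite big_nil; exact: Ck_cst.
by under eq_fun do rewrite big_cons; exact: CkD.
Qed.

End Ck.

Lemma Ck_scale {R : realType} {V W : normedModType R} k (U : set V)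
    (a : V -> R) (f : V -> W) : open U -> Ck k U a -> Ck k U f ->
  Ck k U (fun x => a x *: f x).
Proof.
move=> oU; elim: k a f => [|k IH] a f /=.
  by move=> da df x Ux; apply: (diff_scale (da x Ux) (df x Ux)).1.
move=> Ca Cf; have [da Ha] := Ca; have [df Hf] := Cf; split=> [x Ux|v].
  by apply: (diff_scale (da x Ux) (df x Ux)).1.
apply: (Ck_eq (f := fun x => 'D_v a x *: f x + a x *: 'D_v f x)) => //.
  by move=> x Ux; rewrite (diff_scale (da x Ux) (df x Ux)).2.
by apply: CkD => //; apply: IH; rewrite ?Ha ?Hf//; apply: CkS.
Qed.

Lemma Ck_linear {R : realType} {V W W' : normedModType R} k (U : set V)
    (l : {linear W -> W'}) (f : V -> W) : open U -> continuous l ->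
  Ck k U f -> Ck k U (fun x => l (f x)).
Proof.
move=> oU lc; elim: k f => [|k IH] f.
  move=> df x Ux; apply: (differentiable_comp (df x Ux)).
  exact: linear_differentiable.
case=> df Hf; split=> [x Ux|v].
  by apply: (differentiable_comp (df x Ux)); exact: linear_differentiable.
apply: (Ck_eq (f := fun x => l ('D_v f x))) => //; last exact: (IH _ (Hf v)).
move=> x Ux; have dl (y : W) : differentiable l y by exact: linear_differentiable.
rewrite (derive_comp (g := l) v (df x Ux) (dl _)) (deriveE _ (dl _)).
by rewrite diff_lin.
Qed.

Section CkRow.
Context {R : realType}.

Lemma Ck_coord {V : normedModType R} {m n} k (U : set V)
    (f : V -> 'M[R]_(m, n)) i j :
  open U -> Ck k U f -> Ck k U (fun x => f x i j).
Proof.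
move=> oU Cf.
have @l : {linear 'M[R]_(m, n) -> R}.
  by exists (fun N : 'M[R]_(_, _) => N i j); do 2![eexists]; do ?[constructor];
     rewrite ?mxE// => ? *; rewrite ?mxE//; move=> ?; rewrite !mxE.
have lc : continuous l by exact/coord_continuous.
exact: (Ck_linear (l := l) oU lc Cf).
Qed.

(** Induction on k: the derivative of g o f in a direction is a combination of
    the partial derivatives of g, composed with f, with the components of the
    derivative of f as coefficients. *)
Lemma Ck_comp {V W : normedModType R} {n} k (U : set V) (U' : set 'rV[R]_n)
    (f : V -> 'rV[R]_n) (g : 'rV[R]_n -> W) : open U ->
  (forall x, U x -> U' (f x)) ->
  Ck k U f -> Ck k U' g -> Ck k U (g \o f).
Proof.
move=> oU UU; elim: k g => [|k IH] g.
  move=> df dg x Ux; apply: (differentiable_comp (df x Ux)).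
  by apply: dg; exact: UU.
move=> Cf Cg; have [df Hf] := Cf; have [dg Hg] := Cg; split=> [x Ux|v].
  by apply: (differentiable_comp (df x Ux)); apply: dg; exact: UU.
apply: (Ck_eq (f := fun x => \sum_j ('D_v f x) ord0 j *:
    ('D_(delta_mx ord0 j) g \o f) x)) => //.
  move=> x Ux; rewrite (derive_comp v (df x Ux) (dg _ (UU _ Ux))).
  by rewrite (derive_row _ (dg _ (UU _ Ux))).
apply: Ck_sum => // j; apply: Ck_scale => //; first exact: (Ck_coord _ _ oU (Hf v)).
by apply: (IH _ (CkS Cf)); exact: Hg.
Qed.

End CkRow.

Section SmoothOn.
Context {R : realType} {V : normedModType R}.
Implicit Types U : set V.

Lemma smooth_on_diff {W : normedModType R} U (f : V -> W) x :
  smooth_on U f -> U x -> differentiable f x.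
Proof. by move=> Hf Ux; exact: (Hf [::]). Qed.

Lemma smooth_on_derive {W : normedModType R} U (f : V -> W) v :
  smooth_on U f -> smooth_on U ('D_v f).
Proof. by move=> Hf s x Ux; have := Hf (rcons s v) x Ux; rewrite foldr_rcons. Qed.

Lemma smooth_on_eq {W : normedModType R} U (f g : V -> W) : open U ->
  (forall x, U x -> f x = g x) -> smooth_on U f -> smooth_on U g.
Proof. by move=> oU fg /smooth_onP Hf; apply/smooth_onP => k; exact: (Ck_eq oU fg). Qed.

Lemma smooth_on_cst {W : normedModType R} U (w : W) : smooth_on U (fun=> w).
Proof. by apply/smooth_onP => k; exact: Ck_cst. Qed.

Lemma smooth_onD {W : normedModType R} U (f g : V -> W) : open U ->
  smooth_on U f -> smooth_on U g -> smooth_on U (fun x => f x + g x).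
Proof.
by move=> oU /smooth_onP Hf /smooth_onP Hg; apply/smooth_onP => k; exact: CkD.
Qed.

Lemma smooth_on_scale {W : normedModType R} U (a : V -> R) (f : V -> W) :
  open U -> smooth_on U a -> smooth_on U f -> smooth_on U (fun x => a x *: f x).
Proof.
move=> oU /smooth_onP Ha /smooth_onP Hf; apply/smooth_onP => k.
exact: Ck_scale.
Qed.

Lemma smooth_on_coord {m n} U (f : V -> 'M[R]_(m, n)) i j : open U ->
  smooth_on U f -> smooth_on U (fun x => f x i j).
Proof.
by move=> oU /smooth_onP Hf; apply/smooth_onP => k; exact: (Ck_coord i j oU).
Qed.

Lemma smooth_on_comp {W : normedModType R} {n} U (U' : set 'rV[R]_n)
    (f : V -> 'rV[R]_n) (g : 'rV[R]_n -> W) : open U ->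
  (forall x, U x -> U' (f x)) ->
  smooth_on U f -> smooth_on U' g -> smooth_on U (g \o f).
Proof.
move=> oU UU /smooth_onP Hf /smooth_onP Hg; apply/smooth_onP => k.
exact: (Ck_comp oU UU).
Qed.

End SmoothOn.

(** * Symmetry of second derivatives *)

Section Schwarz.
Context {R : realType} {V : normedModType R}.

Lemma line_derive (f : V -> R) (a w : V) (t : R) : differentiable f (a + t *: w) ->
  is_derive t 1 (fun s : R => f (a + s *: w)) ('D_w f (a + t *: w)).
Proof.
move=> df.
pose l (s : R) : V := a + s *: w.
have [dl lE] : is_diff t l (fun s : R => s *: w).
  rewrite -[X in is_diff _ _ X](add0r (fun s : R => s *: w)).
  exact: (is_diffD (is_diff_cst a t) (is_diff_scalel t w)).
apply: DeriveDef.
  by apply: diff_derivable; exact: (differentiable_comp dl df).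
by rewrite (derive_comp (1 : R^o) dl df) (deriveE _ dl) lE scale1r.
Qed.

(** Symmetric in v and w; its quotient by s^2 tends to the second derivative
    in both orders. *)
Definition second_difference (f : V -> R) (x v w : V) (s : R) : R :=
  f (x + s *: v + s *: w) - f (x + s *: v) - f (x + s *: w) + f x.

(** The mean value theorem for t |-> f(x+sv+tw) - f(x+tw) expresses the
    second difference by two values of the derivative along w, which are compared
    through the differentiability of that derivative at x. *)
Lemma second_difference_approx (f : V -> R) U x v w (e : R) : open U -> U x ->
  (forall y, U y -> differentiable f y) -> differentiable ('D_w f) x -> 0 < e ->
  \forall s \near 0^'+,
    `|second_difference f x v w s - s ^+ 2 * 'D_v ('D_w f) x| <= e * s ^+ 2.
Proof.
move=> oU Ux df ddf e0.
pose L := 'd ('D_w f) x.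
(* |w| counts twice: the two values of the derivative that are compared lie at
   distance at most s(|v|+|w|) and s|w| from x. *)
pose e' := e / (`|v| + `|w| + `|w| + 1).
have e'0 : 0 < e' by rewrite divr_gt0// ltr_wpDl// !addr_ge0.
have /eqaddoP/(_ e' e'0) := diff_locally ddf.
rewrite /= => near_r.
have near_U : \forall y \near (0 : V), U (y + x).
  have : \near x, U x by exact: open_nbhs_nbhs.
  by rewrite (near_shift 0) /= subr0.
have [d /= d0 dP] := (nbhs_ballP _ _).1 (filterI near_r near_U).
pose r := d / (`|v| + `|w| + 1).
have r0 : 0 < r by rewrite divr_gt0// ltr_wpDl// !addr_ge0.
have rd : r * (`|v| + `|w| + 1) = d.
  by rewrite divfK// gt_eqF// ltr_wpDl// !addr_ge0.
have small (s t : R) : 0 <= s <= r -> 0 <= t <= r ->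
    U (s *: v + t *: w + x) /\
    `|'D_w f (s *: v + t *: w + x) - ('D_w f x + L (s *: v + t *: w))|
      <= e' * (s * `|v| + t * `|w|).
  move=> /andP[s0 sr] /andP[t0 tr].
  have nle : `|s *: v + t *: w| <= s * `|v| + t * `|w|.
    by rewrite (le_trans (ler_normD _ _))// !normrZ !ger0_norm.
  have sv : s * `|v| <= r * `|v| by rewrite ler_wpM2r.
  have tw : t * `|w| <= r * `|w| by rewrite ler_wpM2r.
  have /dP[/= H1 H2] : ball 0 d (s *: v + t *: w).
    rewrite -ball_normE/= sub0r normrN (le_lt_trans nle)//.
    rewrite -rd !mulrDr mulr1; lra.
  split; first by [].
  by apply: le_trans H1 _; rewrite ler_pM2l//= subr0.
near=> s.
have s0 : 0 < s by near: s; exact: nbhs_right_gt.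
have sr : s <= r by near: s; exact: nbhs_right_le.
have ss : 0 <= s <= r by rewrite (ltW s0).
have zz : (0 : R) <= 0 <= r by rewrite lexx ltW.
pose phi (t : R) := f (x + s *: v + t *: w) - f (x + t *: w).
pose dphi (t : R) := 'D_w f (x + s *: v + t *: w) - 'D_w f (x + t *: w).
have inU t : 0 <= t <= r -> U (x + s *: v + t *: w) /\ U (x + t *: w).
  move=> tr.
  have [H1 _] := small s t ss tr; have [H2 _] := small 0 t zz tr.
  split; first by rewrite -addrA addrC.
  by move: H2; rewrite scale0r add0r addrC.
have phiD (t : R) : 0 <= t <= r -> is_derive t 1 phi (dphi t).
  move=> /inU[U1 U2]; apply: is_deriveB; apply: line_derive; exact: df.
have [c csr phiE] : exists2 c, c \in `]0, s[%R & phi s - phi 0 = dphi c * (s - 0).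
  apply: MVT => // [t|].
    rewrite in_itv/= => /andP[t0 ts]; apply: phiD.
    by rewrite (ltW t0)/= (le_trans (ltW ts)).
  apply: derivable_within_continuous => t; rewrite in_itv/= => /andP[t0 ts].
  by apply: (@ex_derive _ _ _ _ _ _ _ (phiD t _)); rewrite t0/= (le_trans ts).
move: csr; rewrite in_itv/= => /andP[c0 cs].
have cr : 0 <= c <= r by rewrite (ltW c0)/= (le_trans (ltW cs)).
have [_ B1] := small s c ss cr; have [_ B2] := small 0 c zz cr.
have -> : second_difference f x v w s = dphi c * s.
  rewrite -[in RHS](subr0 s) -phiE /phi /second_difference !scale0r !addr0.
  by ring.
have LE : 'D_v ('D_w f) x = L v by rewrite deriveE.
rewrite {}LE /dphi; move: B1 B2; rewrite scale0r add0r mul0r add0r.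
have LD : L (s *: v + c *: w) = s * L v + c * L w :> R by rewrite /L linearP linearZ.
have LZ : L (c *: w) = c * L w :> R by rewrite /L linearZ.
rewrite LD LZ [s *: v + _ + x]addrC addrA [c *: w + x]addrC.
move: ('D_w f (x + s *: v + c *: w)) ('D_w f (x + c *: w)) ('D_w f x) => A B C B1 B2.
have -> : (A - B) * s - s ^+ 2 * L v = 
  s * ((A - (C + (s * L v + c * L w))) - (B - (C + c * L w))) by ring.
rewrite normrM (gtr0_norm s0) expr2 mulrCA ler_pM2l//.
apply: le_trans (ler_normB _ _) _; apply: le_trans (lerD B1 B2) _.
rewrite -mulrDr /e' mulrAC ler_pdivrMr ?ltr_wpDl ?addr_ge0//.
rewrite -mulrA ler_pM2l//.
have : c * `|w| <= s * `|w| by rewrite ler_wpM2r// ltW.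
rewrite !mulrDr mulr1; lra.
Unshelve. all: by end_near. Qed.

Lemma schwarz (f : V -> R) U x v w : open U -> smooth_on U f -> U x ->
  'D_v ('D_w f) x = 'D_w ('D_v f) x.
Proof.
move=> oU sf Ux.
have df y : U y -> differentiable f y by exact: smooth_on_diff.
have dd u : differentiable ('D_u f) x by apply: smooth_on_diff Ux; exact: smooth_on_derive.
apply/eqP; rewrite -subr_eq0 -normr_le0; apply/ler_addgt0Pr => e e0.
rewrite add0r.
have e2 : 0 < e / 2 by rewrite divr_gt0.
have Q1 := second_difference_approx v oU Ux df (dd w) e2.
have Q2 := second_difference_approx w oU Ux df (dd v) e2.
have [s [H1 [H2 s0]]] : exists s : R,
    `|second_difference f x v w s - s ^+ 2 * 'D_v ('D_w f) x| <= e / 2 * s ^+ 2 /\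
    `|second_difference f x w v s - s ^+ 2 * 'D_w ('D_v f) x| <= e / 2 * s ^+ 2 /\
    0 < s.
  have Q0 := @nbhs_right_gt R 0.
  have Q3 := filterI Q1 (filterI Q2 Q0).
  have PF : ProperFilter (0 : R)^'+ by exact: at_right_proper_filter.
  have [s [H1 [H2 H3]]] := @filter_ex R _ PF _ (Q3 _ _).
  by exists s; split; [exact: H1|split; [exact: H2|exact: H3]].
have sE : second_difference f x w v s = second_difference f x v w s.
  by rewrite /second_difference [x + s *: w + _]addrAC; ring.
rewrite {}sE in H2; move: H1 H2.
move: (second_difference _ _ _ _ _) ('D_v ('D_w f) x) ('D_w ('D_v f) x) => S A B.
move=> H1 H2; have s2 : 0 < s ^+ 2 by rewrite exprn_gt0.
rewrite -(ler_pM2l s2) -{1}(gtr0_norm s2) -normrM.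
have -> : s ^+ 2 * (A - B) = (S - s ^+ 2 * B) - (S - s ^+ 2 * A) by ring.
apply: le_trans (ler_normB _ _) _; apply: le_trans (lerD H2 H1) _.
by rewrite -mulrDl -splitr mulrC.
Qed.

End Schwarz.

(** * Changes of chart *)

Section Charts.
Context {R : realType} {n : nat} {M : manifold R n}.
Implicit Types (c : chart M) (q : M) (U : set M).

Lemma chart_image_open c U : open U -> open (cmap c @` (U `&` cdom c)).
Proof.
move=> oU; rewrite openE => _ [q [Uq cq] <-].
have H1 : \forall y \near cmap c q, (cmap c @` cdom c) y.
  by apply: open_nbhs_nbhs; split; [exact: cimage_open|exists q].
have H2 : \forall y \near cmap c q, U (cinv c y).
  have := @cinv_continuous _ _ M c (cmap c q); apply; first by exists q.
  by rewrite cmapK//; exact: open_nbhs_nbhs.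
apply: filterS2 H1 H2 => _ [r cr <-]; rewrite cmapK// => Ur.
by exists r.
Qed.

Lemma near_chart_image c U q (P : 'rV[R]_n -> Prop) : open U -> U q ->
  cdom c q -> (forall r, U r -> cdom c r -> P (cmap c r)) ->
  \forall x \near cmap c q, P x.
Proof.
move=> oU Uq cq H.
have : \forall y \near cmap c q, (cmap c @` (U `&` cdom c)) y.
  by apply: open_nbhs_nbhs; split; [exact: chart_image_open|exists q].
by apply: filterS => _ [r [Ur cr] <-]; exact: H.
Qed.

Lemma transition_diff c c' q : cdom c q -> cdom c' q ->
  differentiable (cmap c' \o cinv c) (cmap c q).
Proof.
move=> cq c'q; have S := @transition_smooth _ _ M c c'.
have H : (cmap c @` (cdom c `&` cdom c')) (cmap c q) by exists q.
exact: (smooth_on_diff S H).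
Qed.

(** In two charts a function is read through the transition map, which is
    differentiable. *)
Lemma diff_chart {W : normedModType R} (f : M -> W) c c' q :
  cdom c q -> cdom c' q -> differentiable (f \o cinv c) (cmap c q) ->
  differentiable (f \o cinv c') (cmap c' q) /\
  forall v, 'D_v (f \o cinv c') (cmap c' q) =
    'D_('D_v (cmap c \o cinv c') (cmap c' q)) (f \o cinv c) (cmap c q).
Proof.
move=> cq c'q df; pose t := cmap c \o cinv c'.
have dt : differentiable t (cmap c' q) by exact: transition_diff.
have tq : t (cmap c' q) = cmap c q by rewrite /t/= cmapK.
have df' : differentiable (f \o cinv c) (t (cmap c' q)) by rewrite tq.
have E : \forall x \near cmap c' q, ((f \o cinv c) \o t) x = (f \o cinv c') x.
  apply: (near_chart_image (cdom_open c)) => // r cr c'r.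
  by rewrite /t/= !cmapK.
have [dg gE] := near_eq_diff E (differentiable_comp dt df').
split; first exact: dg.
move=> v; rewrite -(near_eq_derive v E) (derive_comp v dt df').
by rewrite tq.
Qed.

Lemma tcoord_change c c' q v : cdom c q -> cdom c' q ->
  tcoord c' q v = 'D_(tcoord c q v) (cmap c' \o cinv c) (cmap c q).
Proof.
move=> cq c'q.
by apply: (diff_chart cq (chart_at_dom q) (transition_diff cq c'q)).2.
Qed.

Lemma derive_chart_id c q v : cdom c q -> 'D_v (cmap c \o cinv c) (cmap c q) = v.
Proof.
move=> cq; rewrite -[RHS](derive_id (cmap c q) v); apply: near_eq_derive.
apply: (near_chart_image (cdom_open c)) => // r _ cr.
by rewrite /= cmapK.
Qed.

Lemma tcoord_at q v : tcoord (chart_at q) q v = v.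
Proof. exact/derive_chart_id/chart_at_dom. Qed.

(** Tangent vectors at q are written in the chart selected at q, where
    constant coordinates are the vector itself. *)
Lemma coord_field_at q a : coord_field (chart_at q) a q = a.
Proof. exact/derive_chart_id/chart_at_dom. Qed.

Lemma tcoord_coord_field c c' q a : cdom c q -> cdom c' q ->
  tcoord c' q (coord_field c a q) = 'D_a (cmap c' \o cinv c) (cmap c q).
Proof.
move=> cq c'q; rewrite /tcoord /coord_field.
have d := transition_diff (chart_at_dom q) c'q.
by rewrite -((diff_chart (chart_at_dom q) cq d).2 a).
Qed.

Lemma coord_fieldK c q a : cdom c q -> tcoord c q (coord_field c a q) = a.
Proof. by move=> cq; rewrite tcoord_coord_field// derive_chart_id. Qed.

Lemma tcoordK c q v : cdom c q -> coord_field c (tcoord c q v) q = v.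
Proof.
move=> cq; rewrite -[RHS](tcoord_at q).
by rewrite (tcoord_change v cq (chart_at_dom q)).
Qed.

Lemma tcoord_linear c q a u v : cdom c q ->
  tcoord c q (a *: u + v) = a *: tcoord c q u + tcoord c q v.
Proof.
by move=> cq; apply: derive_linear; apply: transition_diff => //; exact: chart_at_dom.
Qed.

Lemma coord_field_linear c q a u v : cdom c q ->
  coord_field c (a *: u + v) q = a *: coord_field c u q + coord_field c v q.
Proof.
by move=> cq; apply: derive_linear; apply: transition_diff => //; exact: chart_at_dom.
Qed.

Lemma coord_field_suml (I : finType) c q (a : I -> R) u : cdom c q ->
  coord_field c (\sum_i a i *: u i) q = \sum_i a i *: coord_field c (u i) q.
Proof.
by move=> cq; apply: derive_suml; apply: transition_diff => //; exact: chart_at_dom.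
Qed.

End Charts.

(** * Smooth functions on a manifold *)

Section SmoothFun.
Context {R : realType} {n : nat} {M : manifold R n}.
Implicit Types (c : chart M) (q : M) (U : set M).

Lemma smooth_fun_local {W : normedModType R} U (f : M -> W) :
  (forall q, U q -> exists V, V q /\ smooth_fun V f) -> smooth_fun U f.
Proof.
move=> H c s _ [q [Uq cq] <-]; have [V [Vq sf]] := H q Uq.
by apply: sf; exists q.
Qed.

Lemma smooth_fun_sub {W : normedModType R} U U' (f : M -> W) :
  U' `<=` U -> smooth_fun U f -> smooth_fun U' f.
Proof.
by move=> UU sf; apply: smooth_fun_local => q /UU Uq; exists U.
Qed.

Lemma smooth_fun_diff {W : normedModType R} U (f : M -> W) c q :
  smooth_fun U f -> U q -> cdom c q ->
  differentiable (f \o cinv c) (cmap c q).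
Proof. by move=> sf Uq cq; apply: (smooth_on_diff (sf c)); exists q. Qed.

Lemma smooth_fun_eq {W : normedModType R} U (f g : M -> W) : open U ->
  (forall q, U q -> f q = g q) -> smooth_fun U f -> smooth_fun U g.
Proof.
move=> oU fg sf c; apply: smooth_on_eq (sf c); first exact: chart_image_open.
by move=> _ [q [Uq cq] <-]; rewrite /= cmapK// fg.
Qed.

Lemma smooth_fun_cst {W : normedModType R} U (w : W) :
  smooth_fun U (fun _ : M => w).
Proof. by move=> c; exact: smooth_on_cst. Qed.

Lemma smooth_funD {W : normedModType R} U (f g : M -> W) : open U ->
  smooth_fun U f -> smooth_fun U g -> smooth_fun U (fun q => f q + g q).
Proof.
by move=> oU sf sg c; apply: (smooth_onD (chart_image_open oU) (sf c) (sg c)).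
Qed.

Lemma smooth_fun_scale {W : normedModType R} U (a : M -> R) (f : M -> W) :
  open U -> smooth_fun U a -> smooth_fun U f ->
  smooth_fun U (fun q => a q *: f q).
Proof.
by move=> oU sa sf c; apply: (smooth_on_scale (chart_image_open oU) (sa c) (sf c)).
Qed.

Lemma smooth_fun_sum {W : normedModType R} U (I : Type) (r : seq I)
    (F : I -> M -> W) : open U -> (forall i, smooth_fun U (F i)) ->
  smooth_fun U (fun q => \sum_(i <- r) F i q).
Proof.
move=> oU HF; elim: r => [|i r IH].
  by under eq_fun do rewrite big_nil; exact: smooth_fun_cst.
by under eq_fun do rewrite big_cons; exact: smooth_funD.
Qed.

Lemma smooth_fun_coord {k l} U (f : M -> 'M[R]_(k, l)) i j : open U ->
  smooth_fun U f -> smooth_fun U (fun q => f q i j).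
Proof.
by move=> oU sf c; apply: (smooth_on_coord i j (chart_image_open oU) (sf c)).
Qed.

Lemma smooth_fun_comp {W : normedModType R} {k} U (U' : set 'rV[R]_k)
    (f : M -> 'rV[R]_k) (h : 'rV[R]_k -> W) : open U ->
  (forall q, U q -> U' (f q)) ->
  smooth_fun U f -> smooth_on U' h -> smooth_fun U (h \o f).
Proof.
move=> oU UU sf sh c.
apply: (smooth_on_comp (U' := U') (chart_image_open oU) _ (sf c) sh).
by move=> _ [q [Uq cq] <-]; rewrite /= cmapK//; exact: UU.
Qed.

Lemma smooth_cmap c : smooth_fun (cdom c) (cmap c).
Proof. by move=> c0; rewrite setIC; exact: transition_smooth. Qed.

Lemma dfun_chart {W : normedModType R} U (f : M -> W) c q v :
  smooth_fun U f -> U q -> cdom c q ->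
  dfun f q v = 'D_(tcoord c q v) (f \o cinv c) (cmap c q).
Proof.
move=> sf Uq cq.
exact: (diff_chart cq (chart_at_dom q) (smooth_fun_diff sf Uq cq)).2.
Qed.

Lemma dfun_eq {W : normedModType R} U (f g : M -> W) q v : open U -> U q ->
  (forall r, U r -> f r = g r) -> dfun f q v = dfun g q v.
Proof.
move=> oU Uq fg; apply: near_eq_derive.
apply: (near_chart_image oU) => //; first exact: chart_at_dom.
by move=> r Ur cr; rewrite /= cmapK// fg.
Qed.

Lemma dfun_cst {W : normedModType R} (w : W) q v : dfun (fun _ : M => w) q v = 0.
Proof. exact: derive_cst. Qed.

Lemma dfunD {W : normedModType R} U (f g : M -> W) q v : U q ->
  smooth_fun U f -> smooth_fun U g ->
  dfun (fun r => f r + g r) q v = dfun f q v + dfun g q v.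
Proof.
move=> Uq sf sg; apply: deriveD; apply: diff_derivable.
  exact: (smooth_fun_diff sf Uq (chart_at_dom q)).
exact: (smooth_fun_diff sg Uq (chart_at_dom q)).
Qed.

Lemma dfun_scale {W : normedModType R} U (a : M -> R) (f : M -> W) q v : U q ->
  smooth_fun U a -> smooth_fun U f ->
  dfun (fun r => a r *: f r) q v = dfun a q v *: f q + a q *: dfun f q v.
Proof.
move=> Uq sa sf.
have da := smooth_fun_diff sa Uq (chart_at_dom q).
have df := smooth_fun_diff sf Uq (chart_at_dom q).
rewrite /dfun ((diff_scale da df).2 v) /= /coords cmapK//.
exact: chart_at_dom.
Qed.

Lemma dfun_sum {W : normedModType R} U (I : Type) (r : seq I) (F : I -> M -> W) q v :
  open U -> U q -> (forall i, smooth_fun U (F i)) ->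
  dfun (fun x => \sum_(i <- r) F i x) q v = \sum_(i <- r) dfun (F i) q v.
Proof.
move=> oU Uq sF; elim: r => [|i r IH].
  by under eq_fun do rewrite big_nil; rewrite big_nil dfun_cst.
under eq_fun do rewrite big_cons; rewrite big_cons -IH.
exact: (dfunD v Uq (sF i) (smooth_fun_sum r oU sF)).
Qed.

Lemma dfun_linear {W : normedModType R} U (f : M -> W) q a u v : U q ->
  smooth_fun U f -> dfun f q (a *: u + v) = a *: dfun f q u + dfun f q v.
Proof.
move=> Uq sf; apply: derive_linear.
exact: (smooth_fun_diff sf Uq (chart_at_dom q)).
Qed.

Lemma dfun_coord {k l} U (f : M -> 'M[R]_(k, l)) i j q v : U q ->
  smooth_fun U f -> dfun (fun r => f r i j) q v = (dfun f q v) i j.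
Proof.
move=> Uq sf; rewrite /dfun.
have df : derivable (f \o cinv (chart_at q)) (coords q) v.
  exact/diff_derivable/(smooth_fun_diff sf Uq (chart_at_dom q)).
by rewrite [in RHS](derive_mx df) mxE.
Qed.

Lemma smooth_funB {W : normedModType R} U (f1 f2 : M -> W) : open U ->
  smooth_fun U f1 -> smooth_fun U f2 -> smooth_fun U (fun q => f1 q - f2 q).
Proof.
move=> oU s1 s2; apply: (smooth_fun_eq (f := fun q => f1 q + (-1) *: f2 q) oU).
  by move=> q _; rewrite scaleN1r.
exact: smooth_funD oU s1 (smooth_fun_scale oU (smooth_fun_cst (-1 : R)) s2).
Qed.

Lemma dfunB {W : normedModType R} U (f1 f2 : M -> W) q v : open U -> U q ->
  smooth_fun U f1 -> smooth_fun U f2 ->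
  dfun (fun r => f1 r - f2 r) q v = dfun f1 q v - dfun f2 q v.
Proof.
move=> oU Uq s1 s2; have s2' := smooth_fun_scale oU (smooth_fun_cst (-1 : R)) s2.
rewrite (dfun_eq (g := fun r => f1 r + (-1) *: f2 r) v oU Uq); last first.
  by move=> r _; rewrite scaleN1r.
rewrite (dfunD v Uq s1 s2') (dfun_scale v Uq (smooth_fun_cst (-1 : R)) s2).
by rewrite dfun_cst scale0r add0r scaleN1r.
Qed.

End SmoothFun.

(** * Sections along a smooth map *)

Section SmoothMap.
Context {R : realType} {m n : nat} {M : manifold R m} {N : manifold R n}.
Variable phi : M -> N.
Hypothesis phi_smooth : smooth_map phi.

Lemma open_preimage (V : set N) : open V -> open (phi @^-1` V).
Proof. by move=> oV; have /continuousP := phi_smooth.1; exact. Qed.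

Lemma smooth_chart_map (d : chart N) :
  smooth_fun (phi @^-1` cdom d) (cmap d \o phi).
Proof. by move=> c; rewrite setIC; exact: phi_smooth.2. Qed.

Lemma smooth_fun_pull {W : normedModType R} (V : set N) (f : N -> W) : open V ->
  smooth_fun V f -> smooth_fun (phi @^-1` V) (f \o phi).
Proof.
move=> oV sf; apply: smooth_fun_local => q Vq.
pose d := chart_at (phi q); pose V' := V `&` cdom d.
have oV' : open V' by apply: openI => //; exact: cdom_open.
exists (phi @^-1` V'); split; first by split=> //; exact: chart_at_dom.
apply: (@smooth_fun_eq _ _ _ _ _ ((f \o cinv d) \o (cmap d \o phi))).
- exact: open_preimage.
- by move=> r [_ dr]; rewrite /= cmapK.
- apply: (@smooth_fun_comp _ _ _ _ _ _ (cmap d @` (V `&` cdom d))) (sf d).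
  + exact: open_preimage.
  + by move=> r [Vr dr]; exists (phi r).
  + by apply: smooth_fun_sub (@smooth_chart_map d) => r [].
Qed.

(** The chain rule in the charts selected at q and phi(q); the composites agree
    only where phi stays in the second chart. *)
Lemma dfun_comp {W : normedModType R} (V : set N) (f : N -> W) q v : open V ->
  V (phi q) -> smooth_fun V f ->
  dfun (f \o phi) q v = dfun f (phi q) (dmap phi q v).
Proof.
move=> oV Vq sf; set c := chart_at q; set d := chart_at (phi q).
have dq : cdom d (phi q) by exact: chart_at_dom.
have cq : cdom c q by exact: chart_at_dom.
have E : forall r, (phi @^-1` (V `&` cdom d)) r ->
    ((f \o cinv d) \o (cmap d \o phi)) r = (f \o phi) r.
  by move=> r [_ dr]; rewrite /= cmapK.
have oU : open (phi @^-1` (V `&` cdom d)).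
  by apply: open_preimage; apply: openI => //; exact: cdom_open.
rewrite -(dfun_eq v oU _ E)//.
have dphi := smooth_fun_diff (@smooth_chart_map d) dq cq.
have df := smooth_fun_diff sf Vq dq.
have pE : cmap d (phi (cinv c (cmap c q))) = cmap d (phi q) by rewrite cmapK.
have df' : differentiable (f \o cinv d) (((cmap d \o phi) \o cinv c) (cmap c q)).
  by rewrite /= pE.
by rewrite /dfun /dmap -/c -/d (derive_comp v dphi df') /= /coords -/c -/d pE.
Qed.

Lemma tcoord_dmap (d : chart N) q v : cdom d (phi q) ->
  tcoord d (phi q) (dmap phi q v) = dfun (cmap d \o phi) q v.
Proof.
move=> dq; apply/esym.
exact: (dfun_comp v (cdom_open d) dq (@smooth_cmap _ _ _ d)).
Qed.

Implicit Types (U : set M) (sigma : M -> 'rV[R]_n).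

Lemma smooth_sectionP U sigma : smooth_section phi U sigma <->
  forall d, smooth_fun (U `&` phi @^-1` cdom d)
    (fun q => tcoord d (phi q) (sigma q)).
Proof.
split=> H.
  by move=> d c; have := H c d; rewrite (setIC (cdom c)) setIA.
by move=> c d; have := H d c; rewrite -setIA (setIC (phi @^-1` _)).
Qed.

Lemma smooth_section_coord U d sigma : smooth_section phi U sigma ->
  U `<=` phi @^-1` cdom d -> smooth_fun U (fun q => tcoord d (phi q) (sigma q)).
Proof.
move=> /smooth_sectionP H Ud.
by apply: smooth_fun_sub (H d) => q Uq; split => //; exact: Ud.
Qed.

Lemma smooth_section_local U sigma :
  (forall q, U q -> exists V, V q /\ smooth_section phi V sigma) ->
  smooth_section phi U sigma.
Proof.
move=> H; apply/smooth_sectionP => d; apply: smooth_fun_local => q [Uq dq].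
have [V [Vq /smooth_sectionP sV]] := H q Uq.
by exists (V `&` phi @^-1` cdom d); split.
Qed.

Lemma smooth_section_sub U U' sigma : U' `<=` U ->
  smooth_section phi U sigma -> smooth_section phi U' sigma.
Proof. by move=> UU H; apply: smooth_section_local => q /UU Uq; exists U. Qed.

Lemma openI_preimage U (d : chart N) : open U -> open (U `&` phi @^-1` cdom d).
Proof. by move=> oU; apply: openI => //; exact/open_preimage/cdom_open. Qed.

(** Another chart changes the components by the Jacobian of the transition
    map, a smooth matrix composed with phi. *)
Lemma smooth_section_chart U d sigma : open U -> U `<=` phi @^-1` cdom d ->
  smooth_fun U (fun q => tcoord d (phi q) (sigma q)) ->
  smooth_section phi U sigma.
Proof.
move=> oU Ud sf; apply/smooth_sectionP => d'.
have oU' := openI_preimage d' oU.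
apply: (@smooth_fun_eq _ _ _ _ _ (fun q =>
  \sum_j (tcoord d (phi q) (sigma q)) ord0 j *:
     (('D_(delta_mx ord0 j) (cmap d' \o cinv d)) \o (cmap d \o phi)) q)) => //.
  move=> q [Uq d'q]; rewrite (tcoord_change _ (Ud _ Uq) d'q).
  rewrite [RHS]derive_row//; exact: (transition_diff (Ud _ Uq) d'q).
apply: (smooth_fun_sum _ oU') => j; apply: (smooth_fun_scale oU').
  apply: (smooth_fun_coord _ _ oU').
  by apply: smooth_fun_sub sf => q [].
apply: (@smooth_fun_comp _ _ _ _ _ _ (cmap d @` (cdom d `&` cdom d'))) => //.
- by move=> q [/Ud dq d'q]; exists (phi q).
- by apply: smooth_fun_sub (@smooth_chart_map d) => q [/Ud].
- exact: smooth_on_derive (@transition_smooth _ _ N d d').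
Qed.

Lemma smooth_section_eq U sigma rho : open U ->
  (forall q, U q -> sigma q = rho q) ->
  smooth_section phi U sigma -> smooth_section phi U rho.
Proof.
move=> oU E /smooth_sectionP H; apply/smooth_sectionP => d.
apply: smooth_fun_eq (H d); first exact: openI_preimage.
by move=> q [Uq _]; rewrite E.
Qed.

Lemma smooth_section_linear U (a : M -> R) sigma rho : open U ->
  smooth_fun U a -> smooth_section phi U sigma -> smooth_section phi U rho ->
  smooth_section phi U (fun q => a q *: sigma q + rho q).
Proof.
move=> oU sa /smooth_sectionP H /smooth_sectionP H'; apply/smooth_sectionP => d.
have oU' := openI_preimage d oU.
apply: (@smooth_fun_eq _ _ _ _ _ (fun q =>
    a q *: tcoord d (phi q) (sigma q) + tcoord d (phi q) (rho q))) => //.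
  by move=> q [Uq dq]; rewrite tcoord_linear.
apply: smooth_funD => //; apply: smooth_fun_scale => //.
by apply: smooth_fun_sub sa => q [].
Qed.

Lemma tcoord0 {k} {P : manifold R k} (c : chart P) q : cdom c q ->
  tcoord c q 0 = 0.
Proof.
move=> cq; have := tcoord_linear (-1) 0 0 cq.
by rewrite scaler0 addr0 scaleN1r addNr.
Qed.

Lemma smooth_section0 U : open U -> smooth_section phi U (fun=> 0).
Proof.
move=> oU; apply/smooth_sectionP => d.
apply: (@smooth_fun_eq _ _ _ _ _ (fun=> 0)); first exact: openI_preimage.
  by move=> q [_ dq]; rewrite tcoord0.
exact: smooth_fun_cst.
Qed.

Lemma smooth_sectionD U sigma rho : open U ->
  smooth_section phi U sigma -> smooth_section phi U rho ->
  smooth_section phi U (fun q => sigma q + rho q).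
Proof.
move=> oU H H'; apply: (smooth_section_eq oU _
  (smooth_section_linear oU (smooth_fun_cst (1 : R)) H H')).
by move=> q _; rewrite scale1r.
Qed.

Lemma smooth_section_scale U (a : M -> R) sigma : open U ->
  smooth_fun U a -> smooth_section phi U sigma ->
  smooth_section phi U (fun q => a q *: sigma q).
Proof.
move=> oU sa H; apply: (smooth_section_eq oU _
  (smooth_section_linear oU sa H (smooth_section0 oU))).
by move=> q _; rewrite addr0.
Qed.

Lemma smooth_sectionN U sigma : open U ->
  smooth_section phi U sigma -> smooth_section phi U (fun q => - sigma q).
Proof.
move=> oU H; apply: (smooth_section_eq oU _
  (smooth_section_scale oU (smooth_fun_cst (-1 : R)) H)).
by move=> q _; rewrite scaleN1r.
Qed.

Lemma smooth_sectionB U sigma rho : open U ->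
  smooth_section phi U sigma -> smooth_section phi U rho ->
  smooth_section phi U (fun q => sigma q - rho q).
Proof. by move=> oU H /(smooth_sectionN oU); exact: smooth_sectionD. Qed.

Lemma smooth_section_sum U (I : Type) (r : seq I) (F : I -> M -> 'rV[R]_n) :
  open U -> (forall i, smooth_section phi U (F i)) ->
  smooth_section phi U (fun q => \sum_(i <- r) F i q).
Proof.
move=> oU HF; elim: r => [|i r IH].
  by under eq_fun do rewrite big_nil; exact: smooth_section0.
by under eq_fun do rewrite big_cons; exact: (smooth_sectionD oU (HF i) IH).
Qed.

Lemma smooth_coord_field_pull U d a : open U -> U `<=` phi @^-1` cdom d ->
  smooth_section phi U (coord_field d a \o phi).
Proof.
move=> oU Ud; apply: (smooth_section_chart oU Ud).
apply: (smooth_fun_eq oU _ (smooth_fun_cst a)) => q /Ud dq.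
by rewrite /= coord_fieldK.
Qed.

(** A coordinate frame of N composed with phi is a local frame of the
    pull-back bundle. *)
Lemma section_frame d q v : cdom d (phi q) ->
  v = \sum_j tcoord d (phi q) v ord0 j *:
      (coord_field d (delta_mx ord0 j) \o phi) q.
Proof.
by move=> dq; rewrite -coord_field_suml// -row_sum_delta tcoordK.
Qed.

End SmoothMap.

Opaque smooth_fun smooth_section smooth_on.

(** * Vector fields as derivations *)

Section Fields.
Context {R : realType} {n : nat} {M : manifold R n}.
Implicit Types (c : chart M) (q : M) (U : set M) (X Y : M -> 'rV[R]_n).

Lemma smooth_idfun : smooth_map (@idfun M).
Proof. by split=> [q|c d]; [exact: cvg_id|exact: transition_smooth]. Qed.

Lemma smooth_field_coord U c X : smooth_field U X ->
  smooth_fun (U `&` cdom c) (fun q => tcoord c q (X q)).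
Proof.
move=> sX; have sX' := smooth_section_sub (U' := U `&` cdom c) (@subIsetl _ _ _) sX.
exact: (smooth_section_coord (d := c) sX' (@subIsetr _ _ _)).
Qed.

Lemma smooth_coord_field U c a : open U -> U `<=` cdom c ->
  smooth_field U (coord_field c a).
Proof. exact: (@smooth_coord_field_pull _ _ _ _ _ _ smooth_idfun). Qed.

Lemma dfun_row {W : normedModType R} U (f : M -> W) X c q : open U ->
  smooth_fun U f -> U q -> cdom c q ->
  dfun f q (X q) = \sum_j (tcoord c q (X q)) ord0 j *:
    (('D_(delta_mx ord0 j) (f \o cinv c)) \o cmap c) q.
Proof.
move=> oU sf Uq cq; rewrite (dfun_chart _ sf Uq cq).
by rewrite [LHS]derive_row//; exact: (smooth_fun_diff sf Uq cq).
Qed.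

Lemma smooth_partial {W : normedModType R} U (f : M -> W) c v : open U ->
  smooth_fun U f ->
  smooth_fun (U `&` cdom c) (('D_v (f \o cinv c)) \o cmap c).
Proof.
move=> oU sf.
apply: (@smooth_fun_comp _ _ _ _ _ _ (cmap c @` (U `&` cdom c))).
- by apply: openI => //; exact: cdom_open.
- by move=> q Uq; exists q.
- by apply: smooth_fun_sub (@smooth_cmap _ _ _ c); exact: subIsetr.
- exact: smooth_on_derive (sf c).
Qed.

Lemma smooth_dfun {W : normedModType R} U (f : M -> W) X : open U ->
  smooth_fun U f -> smooth_field U X ->
  smooth_fun U (fun q => dfun f q (X q)).
Proof.
move=> oU sf sX; apply: smooth_fun_local => q Uq; pose c := chart_at q.
have oV : open (U `&` cdom c) by apply: openI => //; exact: cdom_open.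
exists (U `&` cdom c); split; first by split=> //; exact: chart_at_dom.
apply: (@smooth_fun_eq _ _ _ _ _ (fun q => \sum_j (tcoord c q (X q)) ord0 j *:
    (('D_(delta_mx ord0 j) (f \o cinv c)) \o cmap c) q)) => //.
  by move=> r [Ur cr]; rewrite (dfun_row X oU sf Ur cr).
apply: smooth_fun_sum => // j; apply: smooth_fun_scale => //.
  by apply: smooth_fun_coord => //; exact: smooth_field_coord.
exact: smooth_partial.
Qed.

Lemma dfun_comp_cmap {W : normedModType R} (h : 'rV[R]_n -> W) q v :
  dfun (h \o cmap (chart_at q)) q v = 'D_v h (coords q).
Proof.
have cq := chart_at_dom q.
apply: near_eq_derive; apply: (near_chart_image (cdom_open (chart_at q))) => //.
by move=> r cr _; rewrite /= cmapK.
Qed.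

(** The second term is the Hessian of f in coordinates, symmetric in X and Y:
    it disappears from commutators. *)
Lemma dfun_dfun U (f : M -> R) X Y q : open U -> U q -> smooth_fun U f ->
  smooth_field U Y -> let c := chart_at q in
  dfun (fun r => dfun f r (Y r)) q (X q) =
  dfun f q (dfun (fun r => tcoord c r (Y r)) q (X q)) +
  \sum_j \sum_k Y q ord0 j * (X q ord0 k *
    'D_(delta_mx ord0 k) ('D_(delta_mx ord0 j) (f \o cinv c)) (coords q)).
Proof.
move=> oU Uq sf sY c; have cq : cdom c q := chart_at_dom q.
have oV : open (U `&` cdom c) by apply: openI => //; exact: cdom_open.
have Vq : (U `&` cdom c) q by [].
have sYc := smooth_field_coord (c := c) sY.
have sYj j := smooth_fun_coord ord0 j oV sYc.
have sp j := smooth_partial (c := c) (delta_mx ord0 j) oU sf.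
rewrite (dfun_eq _ oV Vq (fun r (Vr : (U `&` cdom c) r) => dfun_row Y oU sf Vr.1 Vr.2)).
rewrite (dfun_sum _ _ oV Vq); last by move=> j; exact: smooth_fun_scale.
rewrite (dfun_row (fun=> dfun (fun r => tcoord c r (Y r)) q (X q)) oU sf Uq cq).
rewrite -big_split/=; apply: eq_bigr => j _.
rewrite (dfun_scale _ Vq (sYj j) (sp j)) tcoord_at.
rewrite (dfun_coord _ _ _ Vq sYc); congr (_ + _); first by rewrite tcoord_at.
rewrite dfun_comp_cmap -mulr_sumr; congr (_ * _).
apply: derive_row; apply: (smooth_on_diff (smooth_on_derive _ (sf c))).
by exists q.
Qed.

Lemma dfun_lie U (f : M -> R) X Y q : open U -> U q -> smooth_fun U f ->
  smooth_field U X -> smooth_field U Y ->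
  dfun f q (lie X Y q) = dfun (fun r => dfun f r (Y r)) q (X q) -
                         dfun (fun r => dfun f r (X r)) q (Y q).
Proof.
move=> oU Uq sf sX sY; rewrite (dfun_dfun X oU Uq sf sY) (dfun_dfun Y oU Uq sf sX).
rewrite opprD addrACA [X in _ = _ + X](_ : _ = 0); last first.
  apply/eqP; rewrite subr_eq0; apply/eqP.
  rewrite [RHS]exchange_big; apply: eq_bigr => j _; apply: eq_bigr => k _.
  have cq : cdom (chart_at q) q := chart_at_dom q.
  have xq : (cmap (chart_at q) @` (U `&` cdom (chart_at q))) (coords q) by exists q.
  by rewrite mulrCA (schwarz _ _ (chart_image_open oU) (sf _) xq).
have -> : lie X Y q =
    (-1) *: dfun (fun r => tcoord (chart_at q) r (X r)) q (Y q) +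
    dfun (fun r => tcoord (chart_at q) r (Y r)) q (X q).
  by rewrite scaleN1r addrC.
by rewrite (dfun_linear _ _ _ Uq sf) scaleN1r addr0 addrC.
Qed.

End Fields.

(** * Tensorial operators and their traces *)

Section Tensorial.
Context {R : realType} {n : nat} {M : manifold R n}.
Implicit Types (U : set M) (X Y Z : M -> 'rV[R]_n).

(** C^oo-linearity is asked over all smaller open sets, together with locality:
    fields are total functions that are constrained only where they are smooth.
    Both are needed to expand a field in a local coordinate frame. *)
Definition tensorial {V : lmodType R} U (A : (M -> 'rV[R]_n) -> M -> V) : Prop :=
  forall U', open U' -> U' `<=` U ->
  (forall X X', smooth_field U' X -> smooth_field U' X' ->
     (forall q, U' q -> X q = X' q) -> forall q, U' q -> A X q = A X' q) /\
  (forall (f : M -> R) X Y, smooth_fun U' f -> smooth_field U' X ->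
     smooth_field U' Y -> forall q, U' q ->
     A (fun r => f r *: X r + Y r) q = f q *: A X q + A Y q).

Definition tensorial2 {V : lmodType R} U
    (B : (M -> 'rV[R]_n) -> (M -> 'rV[R]_n) -> M -> V) : Prop :=
  forall U', open U' -> U' `<=` U -> forall Z, smooth_field U' Z ->
    tensorial U' (B Z) /\ tensorial U' (fun X => B X Z).

Section One.
Context {V : lmodType R} {U : set M} {A : (M -> 'rV[R]_n) -> M -> V}.
Hypothesis tA : tensorial U A.

Lemma tensorial_sub U' : U' `<=` U -> tensorial U' A.
Proof.
by move=> UU U1 oU1 U1U; apply: (tA oU1) => q /U1U /UU.
Qed.

Lemma tensorial_sum_field (I : Type) (r : seq I) (f : I -> M -> R)
    (X : I -> M -> 'rV[R]_n) U' q : open U' -> U' `<=` U -> U' q ->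
  (forall i, smooth_fun U' (f i)) -> (forall i, smooth_field U' (X i)) ->
  A (fun s => \sum_(i <- r) f i s *: X i s) q = \sum_(i <- r) f i q *: A (X i) q.
Proof.
move=> oU' UU Uq sf sX.
have [_ lin] := tA oU' UU.
elim: r => [|i r IH].
  under eq_fun do rewrite big_nil; rewrite big_nil.
  have s0 : smooth_field U' (fun=> 0) by exact: (smooth_section0 smooth_idfun oU').
  have := lin (fun=> -1) _ _ (smooth_fun_cst (-1 : R)) s0 s0 q Uq.
  under [in A _]eq_fun do rewrite scaler0 addr0.
  by rewrite scaleN1r addNr.
under eq_fun do rewrite big_cons; rewrite big_cons -IH; apply: lin => //.
apply: (smooth_section_sum smooth_idfun _ oU') => j.
exact: (smooth_section_scale smooth_idfun oU' (sf j) (sX j)).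
Qed.

(** Near q the field is a combination of coordinate fields with smooth
    coefficients; linearity extracts their values at q. *)
Lemma tensorial_coord U' X q : open U' -> U' `<=` U -> U' q -> smooth_field U' X ->
  A X q = \sum_j X q ord0 j *: A (coord_field (chart_at q) (delta_mx ord0 j)) q.
Proof.
move=> oU' UU Uq sX; pose c := chart_at q; pose V' := U' `&` cdom c.
have oV : open V' by apply: openI => //; exact: cdom_open.
have VU : V' `<=` U by move=> r [/UU].
have Vq : V' q by split=> //; exact: chart_at_dom.
have sXc := smooth_field_coord (c := c) sX.
have sXj j := smooth_fun_coord ord0 j oV sXc.
have sE j : smooth_field V' (coord_field c (delta_mx ord0 j)).
  by apply: (smooth_coord_field _ oV) => r [].
rewrite ((tA oV VU).1 X (fun r => \sum_j tcoord c r (X r) ord0 j *: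
    coord_field c (delta_mx ord0 j) r) _ _ _ q Vq).
- rewrite (tensorial_sum_field _ oV VU Vq sXj sE).
  by under eq_bigr do rewrite tcoord_at.
- by apply: (smooth_section_sub _ sX) => r [].
- apply: (smooth_section_sum smooth_idfun _ oV) => j.
  exact: (smooth_section_scale smooth_idfun oV (sXj j) (sE j)).
- move=> r [_ cr]; exact: (@section_frame _ _ _ _ _ (@idfun M) c r (X r) cr).
Qed.

Lemma tensorial_sum (I : finType) (a : I -> R) (X : I -> M -> 'rV[R]_n) Z U' q :
  open U' -> U' `<=` U -> U' q -> smooth_field U' Z ->
  (forall i, smooth_field U' (X i)) -> Z q = \sum_i a i *: X i q ->
  A Z q = \sum_i a i *: A (X i) q.
Proof.
move=> oU' UU Uq sZ sX E; rewrite (tensorial_coord oU' UU Uq sZ) E.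
under [RHS]eq_bigr do rewrite (tensorial_coord oU' UU Uq (sX _)) scaler_sumr.
rewrite [RHS]exchange_big; apply: eq_bigr => j _.
rewrite summxE scaler_suml; apply: eq_bigr => i _.
by rewrite mxE scalerA.
Qed.

(** A tensorial operator sees a field through its value at the point, so that
    only a relation at q is required. *)
Lemma tensorial_lin U' a X Y Z q : open U' -> U' `<=` U -> U' q ->
  smooth_field U' X -> smooth_field U' Y -> smooth_field U' Z ->
  Z q = a *: X q + Y q -> A Z q = a *: A X q + A Y q.
Proof.
move=> oU' UU Uq sX sY sZ E.
rewrite (tensorial_coord oU' UU Uq sZ) (tensorial_coord oU' UU Uq sX).
rewrite (tensorial_coord oU' UU Uq sY) scaler_sumr -big_split/=.
by apply: eq_bigr => j _; rewrite E !mxE scalerDl scalerA.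
Qed.

Lemma tensorialB_field U' X Y Z q : open U' -> U' `<=` U -> U' q ->
  smooth_field U' X -> smooth_field U' Y -> smooth_field U' Z ->
  Z q = X q - Y q -> A Z q = A X q - A Y q.
Proof.
move=> oU' UU Uq sX sY sZ E.
rewrite addrC -scaleN1r; apply: (tensorial_lin oU' UU Uq sY sX sZ).
by rewrite scaleN1r addrC.
Qed.

Lemma tensorial_eq U' X Y q : open U' -> U' `<=` U -> U' q ->
  smooth_field U' X -> smooth_field U' Y -> X q = Y q -> A X q = A Y q.
Proof.
move=> oU' UU Uq sX sY E.
by rewrite (tensorial_coord oU' UU Uq sX) (tensorial_coord oU' UU Uq sY) E.
Qed.

Lemma tensorial0 U' X q : open U' -> U' `<=` U -> U' q ->
  smooth_field U' X -> X q = 0 -> A X q = 0.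
Proof.
move=> oU' UU Uq sX E; rewrite (tensorial_coord oU' UU Uq sX) E.
by rewrite big1// => j _; rewrite mxE scale0r.
Qed.

End One.

Lemma tensorial_combine {V W : lmodType R} {V' : lmodType R} U A B (L : M -> V -> W -> V') :
  (forall q a u u' v v', L q (a *: u + u') (a *: v + v') = a *: L q u v + L q u' v') ->
  tensorial U A -> tensorial U B ->
  tensorial U (fun X q => L q (A X q) (B X q)).
Proof.
move=> HL tA tB U' oU' UU; have [eA lA] := tA _ oU' UU; have [eB lB] := tB _ oU' UU.
split=> [X X' sX sX' E q Uq|f X Y sf sX sY q Uq].
  by rewrite (eA X X') ?(eB X X').
by rewrite lA ?lB.
Qed.

Lemma tensorialD {V : lmodType R} U (A B : (M -> 'rV[R]_n) -> M -> V) :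
  tensorial U A -> tensorial U B -> tensorial U (fun X q => A X q + B X q).
Proof.
apply: (tensorial_combine (L := fun _ u v => u + v)) => _ a u u' v v'.
by rewrite scalerDr addrACA.
Qed.

Lemma tensorialN {V : lmodType R} U (A : (M -> 'rV[R]_n) -> M -> V) :
  tensorial U A -> tensorial U (fun X q => - A X q).
Proof.
move=> tA; apply: (tensorial_combine (L := fun _ (u v : V) => - u) _ tA tA).
by move=> _ a u u' v v'; rewrite opprD scalerN.
Qed.

Lemma tensorialB {V : lmodType R} U (A B : (M -> 'rV[R]_n) -> M -> V) :
  tensorial U A -> tensorial U B -> tensorial U (fun X q => A X q - B X q).
Proof. by move=> tA tB; apply: tensorialD => //; exact: tensorialN. Qed.

Lemma tensorial_map {V V' : lmodType R} U (A : (M -> 'rV[R]_n) -> M -> V)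
    (L : M -> V -> V') :
  (forall q a u u', L q (a *: u + u') = a *: L q u + L q u') ->
  tensorial U A -> tensorial U (fun X q => L q (A X q)).
Proof.
move=> HL tA; apply: (tensorial_combine (L := fun q (u v : V) => L q u) _ tA tA).
by move=> q a u u' _ _.
Qed.

Lemma tensorial_comp {V : lmodType R} U (A : (M -> 'rV[R]_n) -> M -> 'rV[R]_n)
    (B : (M -> 'rV[R]_n) -> M -> V) :
  (forall U' X, open U' -> U' `<=` U -> smooth_field U' X -> smooth_field U' (A X)) ->
  tensorial U A -> tensorial U B -> tensorial U (fun X => B (A X)).
Proof.
move=> sA tA tB U' oU' UU; have [eA lA] := tA _ oU' UU.
split=> [X X' sX sX' E q Uq|f X Y sf sX sY q Uq].
  apply: (tensorial_eq tB oU' UU Uq); [exact: sA|exact: sA|exact: eA].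
have sfX := smooth_section_linear smooth_idfun oU' sf sX sY.
apply: (tensorial_lin tB oU' UU Uq); [exact: sA|exact: sA|exact: sA|exact: lA].
Qed.

Lemma tensorial2_sub {V : lmodType R} U U' (B : (M -> 'rV[R]_n) -> (M -> 'rV[R]_n) -> M -> V) :
  U' `<=` U -> tensorial2 U B -> tensorial2 U' B.
Proof. by move=> UU tB U1 oU1 U1U; apply: (tB _ oU1) => q /U1U /UU. Qed.

Lemma tensorial_ext {V : lmodType R} U (A B : (M -> 'rV[R]_n) -> M -> V) :
  (forall X q, A X q = B X q) -> tensorial U A -> tensorial U B.
Proof.
by move=> AB; rewrite (_ : A = B)//; apply/funext => X; apply/funext => q.
Qed.

Section Frame.
Variables (g : M -> 'M[R]_n) (U : set M) (F : 'I_n -> M -> 'rV[R]_n).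
Hypothesis sF : forall i, smooth_field U (F i).
Hypothesis oU : open U.
Hypothesis oF : forall q, U q -> forall i j, inner g q (F i q) (F j q) = (i == j)%:R.

(** If the rows of P are an orthonormal basis, then P g P^T = 1, which makes
    g invertible with inverse P^T P. *)
Lemma frame_inverse q : U q -> let P := \matrix_(i, j) F i q ord0 j in
  P *m g q *m P^T = 1%:M /\ g q *m P^T *m P = 1%:M /\ P^T *m P = invmx (g q).
Proof.
move=> Uq P; have PG : P *m g q *m P^T = 1%:M.
  apply/matrixP => i j; rewrite [RHS]mxE -(oF Uq i j) /inner !mxE.
  apply: eq_bigr => k _; congr (_ * _); last by rewrite !mxE.
  by rewrite !mxE; apply: eq_bigr => l _; rewrite !mxE.
have GP : g q *m P^T *m P = 1%:M by apply: mulmx1C; rewrite mulmxA.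
split=> //; split=> //.
have Gu : g q \in unitmx.
  by rewrite -mulmxA in GP; case: (mulmx1_unit GP).
by rewrite -[LHS](mulKmx Gu) (mulmxA (g q)) GP mulmx1.
Qed.

(** Writing the frame in coordinates replaces B(F_k,F_k) by the entries of
    P^T P, that is, of the inverse of g. *)
Lemma mtrace_frame {V : lmodType R} (B : (M -> 'rV[R]_n) -> (M -> 'rV[R]_n) -> M -> V) q :
  tensorial2 U B -> U q -> mtrace g B q = \sum_k B (F k) (F k) q.
Proof.
move=> tB Uq; have [_ [_ PP]] := frame_inverse Uq.
rewrite /mtrace -PP; set c := chart_at q; pose V' := U `&` cdom c.
have oV : open V' by apply: openI => //; exact: cdom_open.
have VU : V' `<=` U by move=> r [].
have Vq : V' q by split=> //; exact: chart_at_dom.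
have sE j : smooth_field V' (coord_field c (delta_mx ord0 j)).
  by apply: (smooth_coord_field _ oV) => r [].
have sFV k : smooth_field V' (F k) by apply: (smooth_section_sub _ (sF k)).
under [RHS]eq_bigr => k _.
  rewrite (tensorial_coord (tB _ oU (@subset_refl _ _) _ (sF k)).1 oU (@subset_refl _ _) Uq (sF k)).
  under eq_bigr => j _.
    rewrite (tensorial_coord (tB _ oV VU _ (sE j)).2 oV (@subset_refl _ _) Vq (sFV k)) scaler_sumr.
    over.
  over.
rewrite exchange_big/=.
rewrite [RHS]exchange_big/=; apply: eq_bigr => j _.
rewrite [RHS]exchange_big/=; apply: eq_bigr => i _.
rewrite mxE scaler_suml; apply: eq_bigr => k _.
by rewrite !mxE scalerA mulrC.
Qed.

Lemma frame_expansion q v : U q -> v = \sum_k inner g q v (F k q) *: F k q.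
Proof.
move=> Uq; have [_ [GP _]] := frame_inverse Uq.
rewrite -[LHS]mulmx1 -GP !mulmxA.
rewrite mulmx_sum_row; apply: eq_bigr => k _; congr (_ *: _).
  by rewrite /inner !mxE; apply: eq_bigr => l _; rewrite !mxE.
by apply/rowP => j; rewrite !mxE.
Qed.

End Frame.
End Tensorial.

(** * Connections on local sections *)

Section Connections.
Context {R : realType} {m n : nat} {M : manifold R m} {N : manifold R n}.
Variables (phi : M -> N)
  (D : (M -> 'rV[R]_m) -> (M -> 'rV[R]_n) -> M -> 'rV[R]_n).
Hypotheses (phi_smooth : smooth_map phi) (hD : connection phi D).
Variables (U : set M).
Hypothesis oU : open U.
Implicit Types (X Y : M -> 'rV[R]_m) (sigma rho : M -> 'rV[R]_n) (q : M).

Lemma conn_eq X X' sigma sigma' q :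
  smooth_field U X -> smooth_section phi U sigma -> U q ->
  (forall r, U r -> X r = X' r) -> (forall r, U r -> sigma r = sigma' r) ->
  D X sigma q = D X' sigma' q.
Proof.
move=> sX ss Uq EX Es; apply: (conn_local hD oU) => //; last exact: mem_set.
  by move=> r /set_mem; exact: EX.
by move=> r /set_mem; exact: Es.
Qed.

Lemma conn_eqS X sigma sigma' q :
  smooth_field U X -> smooth_section phi U sigma -> U q ->
  (forall r, U r -> sigma r = sigma' r) ->
  D X sigma q = D X sigma' q.
Proof. by move=> sX ss Uq Es; exact: conn_eq. Qed.

Lemma conn_leib (f : M -> R) X sigma rho q : smooth_fun U f -> smooth_field U X ->
  smooth_section phi U sigma -> smooth_section phi U rho -> U q ->
  D X (fun r => f r *: sigma r + rho r) q =
  dfun f q (X q) *: sigma q + f q *: D X sigma q + D X rho q.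
Proof.
by move=> sf sX ss sr Uq; apply: (conn_leibniz hD oU sf sX ss sr); exact: mem_set.
Qed.

Lemma conn_section0 X q : smooth_field U X -> U q -> D X (fun=> 0) q = 0.
Proof.
move=> sX Uq; have s0 := smooth_section0 phi_smooth oU.
have := conn_leib (smooth_fun_cst (-1 : R)) sX s0 s0 Uq.
under [fun r => _ + _]eq_fun do rewrite scaler0 addr0.
by rewrite scaler0 add0r scaleN1r addNr.
Qed.

Lemma conn_scale (f : M -> R) X sigma q : smooth_fun U f -> smooth_field U X ->
  smooth_section phi U sigma -> U q ->
  D X (fun r => f r *: sigma r) q = dfun f q (X q) *: sigma q + f q *: D X sigma q.
Proof.
move=> sf sX ss Uq; have s0 := smooth_section0 phi_smooth oU.
have := conn_leib sf sX ss s0 Uq; rewrite conn_section0// addr0.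
by under [fun r => _ + _]eq_fun do rewrite addr0.
Qed.

Lemma connD X sigma rho q : smooth_field U X ->
  smooth_section phi U sigma -> smooth_section phi U rho -> U q ->
  D X (fun r => sigma r + rho r) q = D X sigma q + D X rho q.
Proof.
move=> sX ss sr Uq.
have := conn_leib (smooth_fun_cst (1 : R)) sX ss sr Uq.
under [fun r => _ + _]eq_fun do rewrite scale1r.
by rewrite dfun_cst scale0r add0r scale1r.
Qed.

Lemma connN X sigma q : smooth_field U X -> smooth_section phi U sigma -> U q ->
  D X (fun r => - sigma r) q = - D X sigma q.
Proof.
move=> sX ss Uq.
have := conn_scale (smooth_fun_cst (-1 : R)) sX ss Uq.
under [fun r => _ *: _]eq_fun do rewrite scaleN1r.
by rewrite dfun_cst scale0r add0r scaleN1r.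
Qed.

Lemma connB X sigma rho q : smooth_field U X ->
  smooth_section phi U sigma -> smooth_section phi U rho -> U q ->
  D X (fun r => sigma r - rho r) q = D X sigma q - D X rho q.
Proof.
move=> sX ss sr Uq; rewrite (connD sX ss (smooth_sectionN phi_smooth oU sr) Uq).
by rewrite (connN sX sr Uq).
Qed.

Lemma conn_sum (I : Type) (r : seq I) (s : I -> M -> 'rV[R]_n) X q :
  smooth_field U X -> (forall i, smooth_section phi U (s i)) -> U q ->
  D X (fun x => \sum_(i <- r) s i x) q = \sum_(i <- r) D X (s i) q.
Proof.
move=> sX ss Uq; elim: r => [|i r IH].
  by under eq_fun do rewrite big_nil; rewrite big_nil conn_section0.
under eq_fun do rewrite big_cons; rewrite big_cons -IH.
exact: (connD sX (ss i) (smooth_section_sum phi_smooth r oU ss) Uq).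
Qed.

Lemma conn_lincomb (I : Type) (r : seq I) (a : I -> M -> R)
    (s : I -> M -> 'rV[R]_n) X q :
  smooth_field U X -> (forall i, smooth_fun U (a i)) ->
  (forall i, smooth_section phi U (s i)) -> U q ->
  D X (fun x => \sum_(i <- r) a i x *: s i x) q =
  \sum_(i <- r) (dfun (a i) q (X q) *: s i q + a i q *: D X (s i) q).
Proof.
move=> sX sa ss Uq.
rewrite (conn_sum _ sX (fun i => smooth_section_scale phi_smooth oU (sa i) (ss i)) Uq).
by apply: eq_bigr => i _; exact: (conn_scale (sa i) sX (ss i) Uq).
Qed.

Lemma smooth_conn X sigma : smooth_field U X -> smooth_section phi U sigma ->
  smooth_section phi U (D X sigma).
Proof. exact: (conn_smooth hD oU). Qed.

End Connections.

(** Locality and C^oo-linearity in the direction are the first and third axioms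
    of a connection. *)
Lemma conn_tensorial {R : realType} {m n : nat} {M : manifold R m} {N : manifold R n}
    (phi : M -> N) D (U : set M) sigma :
  connection phi D -> open U -> smooth_section phi U sigma ->
  tensorial U (fun X => D X sigma).
Proof.
move=> hD oU ss U' oU' UU; have ss' := smooth_section_sub UU ss.
split=> [X X' sX sX' E q Uq|f X Y sf sX sY q Uq].
  exact: (conn_eq hD oU' sX ss' Uq E).
by apply: (conn_linear hD oU' sf sX sY ss'); exact: mem_set.
Qed.

Opaque dfun tcoord.

(*BEGIN*)

(** * Scalar products *)

Section Inner.
Context {R : realType} {n : nat} {M : manifold R n}.
Variable g : M -> 'M[R]_n.
Implicit Types (q : M) (u v w : 'rV[R]_n).

Lemma inner_linearl q a u v w :
  inner g q (a *: u + v) w = a * inner g q u w + inner g q v w.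
Proof. by rewrite /inner !mulmxDl -!scalemxAl !mxE. Qed.

Lemma innerDl q u v w : inner g q (u + v) w = inner g q u w + inner g q v w.
Proof. by have := inner_linearl q 1 u v w; rewrite scale1r mul1r. Qed.

Lemma inner0l q w : inner g q 0 w = 0.
Proof. by rewrite /inner !mul0mx mxE. Qed.

Lemma innerZl q a u w : inner g q (a *: u) w = a * inner g q u w.
Proof. by have := inner_linearl q a u 0 w; rewrite addr0 inner0l addr0. Qed.

Lemma innerNl q u w : inner g q (- u) w = - inner g q u w.
Proof. by rewrite -scaleN1r innerZl mulN1r. Qed.

Lemma innerBl q u v w : inner g q (u - v) w = inner g q u w - inner g q v w.
Proof. by rewrite innerDl innerNl. Qed.

Lemma inner_suml (I : Type) (r : seq I) (u : I -> 'rV[R]_n) q w :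
  inner g q (\sum_(i <- r) u i) w = \sum_(i <- r) inner g q (u i) w.
Proof.
elim: r => [|i r IH]; first by rewrite !big_nil inner0l.
by rewrite !big_cons innerDl IH.
Qed.

Hypothesis gs : forall q u v, inner g q u v = inner g q v u.

Lemma inner_linearr q a u v w :
  inner g q w (a *: u + v) = a * inner g q w u + inner g q w v.
Proof. by rewrite gs inner_linearl !(gs _ w). Qed.

Lemma innerDr q u v w : inner g q w (u + v) = inner g q w u + inner g q w v.
Proof. by rewrite gs innerDl !(gs _ w). Qed.

Lemma innerBr q u v w : inner g q w (u - v) = inner g q w u - inner g q w v.
Proof. by rewrite gs innerBl !(gs _ w). Qed.

Lemma innerNr q u w : inner g q w (- u) = - inner g q w u.
Proof. by rewrite gs innerNl !(gs _ w). Qed.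

Lemma innerZr q a u w : inner g q w (a *: u) = a * inner g q w u.
Proof. by rewrite gs innerZl (gs _ w). Qed.

Lemma inner_sumr (I : Type) (r : seq I) (u : I -> 'rV[R]_n) q w :
  inner g q w (\sum_(i <- r) u i) = \sum_(i <- r) inner g q w (u i).
Proof. by rewrite gs inner_suml; apply: eq_bigr => i _; rewrite gs. Qed.

End Inner.
Opaque inner.

(** * The differential of a map *)

Section Push.
Context {R : realType} {m n : nat} {M : manifold R m} {N : manifold R n}.
Variable phi : M -> N.
Hypothesis phi_smooth : smooth_map phi.

Lemma dmap_linear q a u v :
  dmap phi q (a *: u + v) = a *: dmap phi q u + dmap phi q v.
Proof.
have dq : (phi @^-1` cdom (chart_at (phi q))) q by exact: chart_at_dom.
exact: (dfun_linear a u v dq (@smooth_chart_map _ _ _ _ _ _ phi_smooth _)).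
Qed.

Lemma pushf_tensorial U : tensorial U (pushf phi).
Proof.
move=> U' oU' UU; split=> [X X' _ _ E q Uq|f X Y _ _ _ q Uq].
  by rewrite /pushf E.
exact: dmap_linear.
Qed.

Lemma smooth_pushf (U : set M) X : open U -> smooth_field U X ->
  smooth_section phi U (pushf phi X).
Proof.
move=> oU sX; apply/smooth_sectionP => d.
have oU' : open (U `&` phi @^-1` cdom d) by exact: openI_preimage.
have sphi := @smooth_chart_map _ _ _ _ _ _ phi_smooth d.
apply: (smooth_fun_eq (f := fun q => dfun (cmap d \o phi) q (X q)) oU').
  by move=> q [_ dq]; rewrite /pushf tcoord_dmap.
apply: (smooth_dfun oU').
  by apply: smooth_fun_sub sphi => r [].
by apply: smooth_section_sub sX => r [].
Qed.

Lemma pushf_frame (d : chart N) X q : cdom d (phi q) ->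
  pushf phi X q = \sum_j dfun (fun r => cmap d (phi r) ord0 j) q (X q) *:
    (coord_field d (delta_mx ord0 j) \o phi) q.
Proof.
move=> dq; rewrite {1}(section_frame (pushf phi X q) dq); apply: eq_bigr => j _.
rewrite /pushf (tcoord_dmap phi_smooth _ dq).
have sphi := @smooth_chart_map _ _ _ _ _ _ phi_smooth d.
have pq : (phi @^-1` cdom d) q := dq.
by rewrite -(dfun_coord _ _ _ pq sphi).
Qed.

Lemma smooth_chart_comp (d : chart N) (U : set M) j : open U ->
  U `<=` phi @^-1` cdom d -> smooth_fun U (fun r => cmap d (phi r) ord0 j).
Proof.
move=> oU Ud; apply: (smooth_fun_coord (f := cmap d \o phi) ord0 j oU).
apply: smooth_fun_sub Ud _; exact: smooth_chart_map.
Qed.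

End Push.

(** The bracket annihilates every coordinate function, as the derivatives of
    coordinate functions along coordinate fields are constant. *)
Lemma lie_coord_field {R : realType} {n} {N : manifold R n} (d : chart N) a b q :
  cdom d q -> lie (coord_field d a) (coord_field d b) q = 0.
Proof.
move=> dq; set l := lie _ _ _.
have od := cdom_open d.
have sE u : smooth_field (cdom d) (coord_field d u) by exact: smooth_coord_field.
have sx k : smooth_fun (cdom d) (fun r => cmap d r ord0 k).
  by apply: smooth_fun_coord => //; exact: smooth_cmap.
have cst k u r : cdom d r ->
    dfun (fun r => cmap d r ord0 k) r (coord_field d u r) = u ord0 k.
  move=> dr; rewrite (dfun_coord _ _ _ dr (@smooth_cmap _ _ _ d)).
  by rewrite -[in RHS](coord_fieldK u dr).
have lk k : tcoord d q l ord0 k = 0.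
  have E := dfun_coord ord0 k l dq (@smooth_cmap _ _ _ d).
  rewrite -[LHS]E (dfun_lie od dq (sx k) (sE a) (sE b)).
  have z u v : dfun (fun r => dfun (fun r => cmap d r ord0 k) r
      (coord_field d u r)) q v = 0.
    have H := dfun_eq v od dq (cst k u).
    have H2 := @dfun_cst _ _ _ _ (u ord0 k : R) q v.
    by rewrite H H2.
  exact: etrans (congr2 (fun x y => x - y) (z b _) (z a _)) (subrr 0).
have l0 : tcoord d q l = 0 by apply/rowP => k; rewrite lk mxE.
by rewrite -(tcoordK l dq) l0; exact: derive0.
Qed.

(** * Torsion and metric of the pull-back connection *)

Section Pullback.
Context {R : realType} {m n : nat} {M : manifold R m} {N : manifold R n}.
Variables (h : N -> 'M[R]_n) (phi : M -> N).
Variable DN : (N -> 'rV[R]_n) -> (N -> 'rV[R]_n) -> N -> 'rV[R]_n.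
Variable D : (M -> 'rV[R]_m) -> (M -> 'rV[R]_n) -> M -> 'rV[R]_n.
Hypotheses (phi_smooth : smooth_map phi) (hh : riemannian h)
  (hDN : levi_civita h DN) (hD : pullback_connection phi DN D).

Let cN : connection (@idfun N) DN := lc_connection hDN.
Let cD : connection phi D := pb_connection hD.
Let hs := Defs.metric_sym hh.

Notation eN d j := (coord_field d (delta_mx ord0 j)).

Lemma smooth_coord_field_dom (d : chart N) a : smooth_field (cdom d) (coord_field d a).
Proof. by apply: (smooth_coord_field _ (cdom_open d)). Qed.

Arguments smooth_coord_field_dom : clear implicits.

Lemma conn_coord_field_sym (d : chart N) a b q : cdom d q ->
  DN (coord_field d a) (coord_field d b) q = DN (coord_field d b) (coord_field d a) q.
Proof.
move=> dq; apply/eqP; rewrite -subr_eq0; apply/eqP.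
have sE := smooth_coord_field_dom d.
by rewrite (lc_torsion_free hDN (cdom_open d) (sE a) (sE b))
  ?lie_coord_field//; exact: mem_set.
Qed.

(** Sections of the form Z o phi generate the pull-back bundle locally; on them
    the pull-back connection is the connection of N along the coordinate fields, with
    the derivatives of the components of phi as coefficients. *)
Lemma pullback_conn U X (Z : N -> 'rV[R]_n) (V : set N) (d : chart N) q :
  open U -> smooth_field U X -> open V -> V `<=` cdom d -> smooth_field V Z ->
  U q -> V (phi q) ->
  D X (Z \o phi) q = \sum_j dfun (fun r => cmap d (phi r) ord0 j) q (X q) *:
    (DN (eN d j) Z \o phi) q.
Proof.
move=> oU sX oV Vd sZ Uq Vq.
rewrite (pb_pullback hD oU oV sX sZ); last by apply: mem_set.
set c := chart_at (phi q).
have oV' : open (V `&` cdom c) by apply: openI => //; exact: cdom_open.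
have Vq' : (V `&` cdom c) (phi q) by split=> //; exact: chart_at_dom.
have VV : V `&` cdom c `<=` V by exact: subIsetl.
apply: (tensorial_sum (conn_tensorial cN oV sZ) oV' VV Vq').
- by apply: (smooth_coord_field _ oV'); exact: subIsetr.
- by move=> j; apply: (smooth_coord_field _ oV') => r [/Vd].
- by rewrite coord_field_at (pushf_frame phi_smooth X (Vd _ Vq)).
Qed.

Section InChart.
Variables (d : chart N) (U : set M).
Hypotheses (oU : open U) (Ud : U `<=` phi @^-1` cdom d).

Let ph j := fun r : M => cmap d (phi r) ord0 j.

Lemma smooth_chart_component j : smooth_fun U (ph j).
Proof. exact: smooth_chart_comp. Qed.

Lemma smooth_frame_pull j : smooth_section phi U (eN d j \o phi).
Proof. exact: (smooth_coord_field_pull phi_smooth _ oU Ud). Qed.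

(** In the double sum, the connection of N on coordinate fields is
    symmetric in j and k, and so are the coefficients once X and Y are
    interchanged. *)
Lemma conn_pushf_chart X Y q : smooth_field U X -> smooth_field U Y -> U q ->
  D X (pushf phi Y) q =
  \sum_k dfun (fun r => dfun (ph k) r (Y r)) q (X q) *: (eN d k \o phi) q +
  \sum_k \sum_j (dfun (ph k) q (Y q) * dfun (ph j) q (X q)) *:
    DN (eN d j) (eN d k) (phi q).
Proof.
move=> sX sY Uq.
have sYk k : smooth_fun U (fun r => dfun (ph k) r (Y r)).
  exact: (smooth_dfun oU (smooth_chart_component k) sY).
rewrite (conn_eqS cD oU sX (smooth_pushf phi_smooth oU sY) Uq
  (fun r Ur => pushf_frame phi_smooth Y (Ud Ur))).
rewrite (conn_lincomb phi_smooth cD oU _ sX sYk smooth_frame_pull Uq).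
rewrite big_split/=; congr (_ + _); apply: eq_bigr => k _.
rewrite (pullback_conn oU sX (cdom_open d) (@subset_refl _ _)
  (smooth_coord_field_dom d _) Uq (Ud Uq)).
by rewrite scaler_sumr; apply: eq_bigr => j _; rewrite scalerA.
Qed.

End InChart.

(** The Christoffel terms of [conn_pushf_chart] cancel because the
    connection of N has no torsion; the others form the commutator of X and Y on
    the components of phi. *)
Lemma pushf_torsion_free U X Y q : open U -> smooth_field U X ->
  smooth_field U Y -> U q ->
  D X (pushf phi Y) q - D Y (pushf phi X) q = pushf phi (lie X Y) q.
Proof.
move=> oU sX sY Uq; pose d := chart_at (phi q).
have dq : cdom d (phi q) by exact: chart_at_dom.
have oU' : open (U `&` phi @^-1` cdom d) by exact: openI_preimage.
have Ud : U `&` phi @^-1` cdom d `<=` phi @^-1` cdom d by exact: subIsetr.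
have Uq' : (U `&` phi @^-1` cdom d) q by [].
have UU : U `&` phi @^-1` cdom d `<=` U by exact: subIsetl.
have sX' := smooth_section_sub UU sX; have sY' := smooth_section_sub UU sY.
rewrite (conn_pushf_chart oU' Ud sX' sY' Uq') (conn_pushf_chart oU' Ud sY' sX' Uq').
rewrite opprD addrACA [X in _ + X](_ : _ = 0); last first.
  apply/eqP; rewrite subr_eq0; apply/eqP; rewrite [RHS]exchange_big/=.
  apply: eq_bigr => k _; apply: eq_bigr => j _.
  by rewrite mulrC (conn_coord_field_sym _ _ dq).
rewrite addr0 (pushf_frame phi_smooth _ dq) -sumrB; apply: eq_bigr => k _.
by rewrite -scalerBl (dfun_lie oU' Uq' (smooth_chart_component oU' Ud k) sX' sY').
Qed.

Lemma smooth_inner_frame (d : chart N) j k :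
  smooth_fun (cdom d) (fun r => inner h r (eN d j r) (eN d k r)).
Proof.
by apply: (metric_smooth hh (cdom_open d)); exact: smooth_coord_field_dom.
Qed.

(** In the coordinate frame the coefficients of the metric along phi are
    coefficients of h composed with phi. *)
Lemma smooth_inner U s t : open U -> smooth_section phi U s ->
  smooth_section phi U t -> smooth_fun U (fun q => inner h (phi q) (s q) (t q)).
Proof.
move=> oU ss st; apply: smooth_fun_local => q Uq; pose d := chart_at (phi q).
pose U' := U `&` phi @^-1` cdom d.
have oU' : open U' by exact: openI_preimage.
have Ud : U' `<=` phi @^-1` cdom d by exact: subIsetr.
have UU : U' `<=` U by exact: subIsetl.
exists U'; split; first by split=> //; exact: chart_at_dom.
have sc u : smooth_section phi U u -> forall j,
    smooth_fun U' (fun q => tcoord d (phi q) (u q) ord0 j).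
  move=> su j; apply: (smooth_fun_coord _ _ oU').
  exact: (smooth_section_coord (smooth_section_sub UU su) Ud).
apply: (smooth_fun_eq (f := fun q => \sum_j tcoord d (phi q) (s q) ord0 j *:
  (\sum_k tcoord d (phi q) (t q) ord0 k *:
    ((fun r => inner h r (eN d j r) (eN d k r)) \o phi) q : R^o)) oU').
  move=> r [Ur dr]; rewrite [in RHS](section_frame (s r) dr) inner_suml.
  apply: eq_bigr => j _; rewrite innerZl; congr (_ * _).
  rewrite [in RHS](section_frame (t r) dr) (inner_sumr hs).
  by apply: eq_bigr => k _; rewrite (innerZr hs).
apply: (smooth_fun_sum _ oU') => j; apply: (smooth_fun_scale oU' (sc s ss j)).
apply: (smooth_fun_sum _ oU') => k; apply: (smooth_fun_scale oU' (sc t st k)).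
apply: smooth_fun_sub Ud _.
exact: (smooth_fun_pull phi_smooth (cdom_open d) (@smooth_inner_frame d j k)).
Qed.

(** Compatibility for one pair of sections, a condition that is
    stable under combinations with smooth coefficients: it is enough to have it for
    the coordinate frame. *)
Definition metric_compatible U X (s t : M -> 'rV[R]_n) : Prop := forall q, U q ->
  dfun (fun r => inner h (phi r) (s r) (t r)) q (X q) =
  inner h (phi q) (D X s q) (t q) + inner h (phi q) (s q) (D X t q).

Lemma metric_compatible_sym U X s t :
  metric_compatible U X s t -> metric_compatible U X t s.
Proof.
move=> C q Uq; have := C q Uq.
rewrite (_ : (fun r => inner h (phi r) (s r) (t r)) =
             (fun r => inner h (phi r) (t r) (s r))); last first.
  by apply/funext => r; exact: hs.
by move=> ->; rewrite addrC (hs (phi q) (D X s q)) (hs (phi q) (s q)).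
Qed.

Lemma metric_compatible_eq U X s s' t : open U -> smooth_field U X ->
  smooth_section phi U s -> (forall q, U q -> s q = s' q) ->
  metric_compatible U X s t -> metric_compatible U X s' t.
Proof.
move=> oU sX ss E C q Uq; rewrite -(conn_eqS cD oU sX ss Uq E) -E//.
rewrite -C//; apply/esym; apply: (dfun_eq _ oU Uq) => r Ur.
by rewrite E.
Qed.

Lemma metric_compatible_sum U X (I : finType) (a : I -> M -> R)
    (s : I -> M -> 'rV[R]_n) t : open U -> smooth_field U X ->
  (forall i, smooth_fun U (a i)) -> (forall i, smooth_section phi U (s i)) ->
  smooth_section phi U t -> (forall i, metric_compatible U X (s i) t) ->
  metric_compatible U X (fun r => \sum_i a i r *: s i r) t.
Proof.
move=> oU sX sa ss st C q Uq.
rewrite (_ : (fun r => inner h (phi r) _ _) =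
  (fun r => \sum_i a i r *: (inner h (phi r) (s i r) (t r) : R^o))); last first.
  by apply/funext => r; rewrite inner_suml; apply: eq_bigr => i _; rewrite innerZl.
have sst i := smooth_inner oU (ss i) st.
rewrite (dfun_sum _ _ oU Uq); last by move=> i; exact: smooth_fun_scale.
rewrite (conn_lincomb phi_smooth cD oU _ sX sa ss Uq) !inner_suml -big_split/=.
apply: eq_bigr => i _; rewrite (dfun_scale _ Uq (sa i) (sst i)) (C i q Uq).
by rewrite innerDl !innerZl scalerDr addrA.
Qed.

Lemma metric_compatible_frame (d : chart N) U X j k : open U ->
  U `<=` phi @^-1` cdom d -> smooth_field U X ->
  metric_compatible U X (eN d j \o phi) (eN d k \o phi).
Proof.
move=> oU Ud sX q Uq; set c := chart_at (phi q).
have dq := Ud _ Uq.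
have od := cdom_open d.
have sE u := smooth_coord_field_dom d u.
have Uq' : q \in U `&` phi @^-1` cdom d by apply: mem_set.
have pb u := pb_pullback hD oU od sX (sE u) Uq'.
rewrite (pb (delta_mx ord0 j)) (pb (delta_mx ord0 k)).
have oV : open (cdom d `&` cdom c) by apply: openI => //; exact: cdom_open.
have Vq : (cdom d `&` cdom c) (phi q) by split=> //; exact: chart_at_dom.
have Vd : cdom d `&` cdom c `<=` cdom d by exact: subIsetl.
have sZ : smooth_field (cdom d `&` cdom c) (coord_field c (pushf phi X q)).
  by apply: (smooth_coord_field _ oV); exact: subIsetr.
have sEV u : smooth_field (cdom d `&` cdom c) (coord_field d u).
  exact: smooth_section_sub Vd (sE u).
rewrite -[LHS]/(dfun ((fun r => inner h r (eN d j r) (eN d k r)) \o phi) q (X q)).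
rewrite (dfun_comp phi_smooth _ od dq (@smooth_inner_frame d j k)).
rewrite -[dmap phi q (X q)](coord_field_at (phi q)).
by apply: (lc_metric hDN oV sZ (sEV _) (sEV _)); exact: mem_set.
Qed.

(** Expand one argument in the coordinate frame, then the other. *)
Lemma pullback_metric U X s t q : open U -> smooth_field U X ->
  smooth_section phi U s -> smooth_section phi U t -> U q ->
  dfun (fun r => inner h (phi r) (s r) (t r)) q (X q) =
  inner h (phi q) (D X s q) (t q) + inner h (phi q) (s q) (D X t q).
Proof.
move=> oU sX ss st Uq; pose d := chart_at (phi q).
pose U' := U `&` phi @^-1` cdom d.
have oU' : open U' by exact: openI_preimage.
have Ud : U' `<=` phi @^-1` cdom d by exact: subIsetr.
have UU : U' `<=` U by exact: subIsetl.
have Uq' : U' q by split=> //; exact: chart_at_dom.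
have sX' := smooth_section_sub UU sX.
have sEp j : smooth_section phi U' (eN d j \o phi) by exact: smooth_frame_pull.
have sc u : smooth_section phi U u -> forall j,
    smooth_fun U' (fun q => tcoord d (phi q) (u q) ord0 j).
  move=> su j; apply: (smooth_fun_coord _ _ oU').
  exact: (smooth_section_coord (smooth_section_sub UU su) Ud).
have step u v : smooth_section phi U u -> smooth_section phi U' v ->
    (forall j, metric_compatible U' X (eN d j \o phi) v) ->
    metric_compatible U' X u v.
  move=> su sv C.
  have sS : smooth_section phi U' (fun r => \sum_j tcoord d (phi r) (u r) ord0 j *:
      (eN d j \o phi) r).
    apply: (smooth_section_sum phi_smooth _ oU') => j.
    exact: (smooth_section_scale phi_smooth oU' (sc u su j) (sEp j)).
  apply: (metric_compatible_eq oU' sX' sS).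
    by move=> r [_ dr]; rewrite -(section_frame (u r) dr).
  exact: (metric_compatible_sum oU' sX' (sc u su) sEp sv C).
have stt := smooth_section_sub UU st.
apply: (step s t ss stt _ q Uq') => j; apply: metric_compatible_sym.
apply: (step t _ st (sEp j)) => k.
exact: metric_compatible_frame.
Qed.

End Pullback.

(*BEGIN*)

Lemma row_linear_sum {R : realType} {n} {V : lmodType R} (f : 'rV[R]_n -> V) u :
  (forall a v w, f (a *: v + w) = a *: f v + f w) ->
  f u = \sum_j u ord0 j *: f (delta_mx ord0 j).
Proof.
move=> lf; have f0 : f 0 = 0.
  by have := lf (-1) 0 0; rewrite scaler0 addr0 scaleN1r addNr.
have fs (I : Type) (r : seq I) (a : I -> R) v :
    f (\sum_(i <- r) a i *: v i) = \sum_(i <- r) a i *: f (v i).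
  elim: r => [|i r IH]; first by rewrite !big_nil.
  by rewrite !big_cons lf IH.
by rewrite {1}(row_sum_delta u) fs.
Qed.

Lemma linear_comb_sub {R : realType} (W : lmodType R) a (A B C D : W) :
  (a *: A + B) - (a *: C + D) = a *: (A - C) + (B - D).
Proof. by rewrite scalerBr opprD addrACA. Qed.

(** * Curvature on sections *)

Section Lie.
Context {R : realType} {m : nat} {M : manifold R m}.
Variables (g : M -> 'M[R]_m) (DM : (M -> 'rV[R]_m) -> (M -> 'rV[R]_m) -> M -> 'rV[R]_m).
Hypothesis hDM : levi_civita g DM.
Variable U : set M.
Hypothesis oU : open U.
Implicit Types X Y : M -> 'rV[R]_m.

Lemma lie_conn X Y q : smooth_field U X -> smooth_field U Y -> U q ->
  lie X Y q = DM X Y q - DM Y X q.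
Proof.
move=> sX sY Uq; rewrite (lc_torsion_free hDM oU sX sY)//; exact: mem_set.
Qed.

Lemma smooth_lie X Y : smooth_field U X -> smooth_field U Y ->
  smooth_field U (lie X Y).
Proof.
move=> sX sY; apply: (smooth_section_eq smooth_idfun oU
  (fun q Uq => esym (lie_conn sX sY Uq))).
have cM := lc_connection hDM.
exact: (smooth_sectionB smooth_idfun oU (smooth_conn cM oU sX sY) (smooth_conn cM oU sY sX)).
Qed.

End Lie.

Section CurvatureSection.
Context {R : realType} {m n : nat} {M : manifold R m} {N : manifold R n}.
Variables (g : M -> 'M[R]_m) (DM : (M -> 'rV[R]_m) -> (M -> 'rV[R]_m) -> M -> 'rV[R]_m).
Variables (phi : M -> N) (D : (M -> 'rV[R]_m) -> (M -> 'rV[R]_n) -> M -> 'rV[R]_n).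
Hypotheses (hDM : levi_civita g DM) (phi_smooth : smooth_map phi) (cD : connection phi D).
Variable U : set M.
Hypothesis oU : open U.
Implicit Types (X Y : M -> 'rV[R]_m) (s : M -> 'rV[R]_n).

Lemma smooth_curvature X Y s : smooth_field U X -> smooth_field U Y ->
  smooth_section phi U s -> smooth_section phi U (curvature D X Y s).
Proof.
move=> sX sY ss; have sc := smooth_conn cD oU.
apply: (smooth_sectionB phi_smooth oU _ (sc _ _ (smooth_lie hDM oU sX sY) ss)).
exact: (smooth_sectionB phi_smooth oU (sc _ _ sX (sc _ _ sY ss)) (sc _ _ sY (sc _ _ sX ss))).
Qed.

Lemma curvature_eqS X Y s s' q : smooth_field U X -> smooth_field U Y ->
  smooth_section phi U s -> U q -> (forall r, U r -> s r = s' r) ->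
  curvature D X Y s q = curvature D X Y s' q.
Proof.
move=> sX sY ss Uq E; have sc := smooth_conn cD oU.
have Ec Z r : smooth_field U Z -> U r -> D Z s r = D Z s' r.
  by move=> sZ Ur; exact: (conn_eqS cD oU sZ ss Ur E).
rewrite /curvature (Ec _ _ (smooth_lie hDM oU sX sY) Uq).
rewrite (conn_eqS cD oU sX (sc _ _ sY ss) Uq (fun r => Ec Y r sY)).
by rewrite (conn_eqS cD oU sY (sc _ _ sX ss) Uq (fun r => Ec X r sX)).
Qed.

Lemma conn2_lincomb (I : finType) (a : I -> M -> R) (s : I -> M -> 'rV[R]_n) X Y q :
  smooth_field U X -> smooth_field U Y -> (forall i, smooth_fun U (a i)) ->
  (forall i, smooth_section phi U (s i)) -> U q ->
  D X (D Y (fun x => \sum_i a i x *: s i x)) q =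
  \sum_i (dfun (fun r => dfun (a i) r (Y r)) q (X q) *: s i q +
          dfun (a i) q (Y q) *: D X (s i) q +
          (dfun (a i) q (X q) *: D Y (s i) q + a i q *: D X (D Y (s i)) q)).
Proof.
move=> sX sY sa ss Uq; have sc := smooth_conn cD oU.
have sas i := smooth_section_scale phi_smooth oU (sa i) (ss i).
have sda i := smooth_dfun oU (sa i) sY.
have sDs i := sc _ _ sY (ss i).
have s1 i := smooth_section_scale phi_smooth oU (sda i) (ss i).
have s2 i := smooth_section_scale phi_smooth oU (sa i) (sDs i).
have s12 i := smooth_sectionD phi_smooth oU (s1 i) (s2 i).
rewrite (conn_eqS cD oU sX (sc _ _ sY (smooth_section_sum phi_smooth _ oU sas)) Uq
  (fun r Ur => conn_lincomb phi_smooth cD oU _ sY sa ss Ur)).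
rewrite (conn_sum phi_smooth cD oU _ sX s12 Uq); apply: eq_bigr => i _.
rewrite (connD cD oU sX (s1 i) (s2 i) Uq).
rewrite (conn_scale phi_smooth cD oU (sda i) sX (ss i) Uq).
by rewrite (conn_scale phi_smooth cD oU (sa i) sX (sDs i) Uq).
Qed.

(** The terms with first derivatives of the coefficients cancel in the
    commutator, and those with second derivatives against the bracket. *)
Lemma curvature_lincomb (I : finType) (a : I -> M -> R) (s : I -> M -> 'rV[R]_n) X Y q :
  smooth_field U X -> smooth_field U Y -> (forall i, smooth_fun U (a i)) ->
  (forall i, smooth_section phi U (s i)) -> U q ->
  curvature D X Y (fun x => \sum_i a i x *: s i x) q =
  \sum_i a i q *: curvature D X Y (s i) q.
Proof.
move=> sX sY sa ss Uq; rewrite /curvature.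
rewrite (conn2_lincomb sX sY sa ss Uq) (conn2_lincomb sY sX sa ss Uq).
rewrite (conn_lincomb phi_smooth cD oU _ (smooth_lie hDM oU sX sY) sa ss Uq).
rewrite -!sumrB; apply: eq_bigr => i _.
rewrite (dfun_lie oU Uq (sa i) sX sY).
move: (dfun _ q (X q)) (dfun _ q (Y q)) (dfun _ q (X q)) (dfun _ q (Y q)) => x1 y1 x2 y2.
move: (D X _ q) (D Y _ q) (D X _ q) (D Y _ q) (D (lie X Y) _ q) => u1 u2 u3 u4 u5.
by apply/rowP => k; rewrite !mxE; ring.
Qed.

End CurvatureSection.

(** * Symmetries of the curvature tensor *)

Section CurvatureTensor.
Context {R : realType} {n : nat} {N : manifold R n}.
Variables (h : N -> 'M[R]_n) (DN : (N -> 'rV[R]_n) -> (N -> 'rV[R]_n) -> N -> 'rV[R]_n).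
Hypotheses (hh : riemannian h) (hDN : levi_civita h DN).
Variable y : N.
Implicit Types (u v w z : 'rV[R]_n).

Let cN : connection (@idfun N) DN := lc_connection hDN.
Let hs := Defs.metric_sym hh.
Let d := chart_at y.
Let V := cdom d.
Let oV : open V := cdom_open d.
Let Vy : V y := chart_at_dom y.
Let sE u : smooth_field V (coord_field d u) := smooth_coord_field u oV (@subset_refl _ _).

(** The curvature tensor is the part of this iterated derivative that is
    antisymmetric in u and v, because coordinate fields commute. *)
Definition coord_conn2 u v w : 'rV[R]_n :=
  DN (coord_field d u) (DN (coord_field d v) (coord_field d w)) y.

Lemma smooth_conn_coord u v : smooth_field V (DN (coord_field d u) (coord_field d v)).
Proof. exact: (smooth_conn cN oV (sE u) (sE v)). Qed.

Let sEE := smooth_conn_coord.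

Lemma curvature_tensorE u v w :
  curvature_tensor DN y u v w = coord_conn2 u v w - coord_conn2 v u w.
Proof.
rewrite /curvature_tensor /curvature.
rewrite (tensorial0 (conn_tensorial cN oV (sE w)) oV (@subset_refl _ _) Vy
  (smooth_lie hDN oV (sE u) (sE v)) (lie_coord_field _ _ Vy)).
by rewrite subr0.
Qed.

Lemma coord_field_lin a u v r : V r ->
  coord_field d (a *: u + v) r = a *: coord_field d u r + coord_field d v r.
Proof. exact: coord_field_linear. Qed.

Lemma conn_const a X s t q : smooth_field V X -> smooth_field V s ->
  smooth_field V t -> V q ->
  DN X (fun r => a *: s r + t r) q = a *: DN X s q + DN X t q.
Proof.
move=> sX ss st Vq.
rewrite (conn_leib cN oV (smooth_fun_cst a) sX ss st Vq).
by rewrite dfun_cst scale0r add0r.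
Qed.

Lemma coord_conn2_linear1 v w a u u' :
  coord_conn2 (a *: u + u') v w =
  a *: coord_conn2 u v w + coord_conn2 u' v w.
Proof.
apply: (tensorial_lin (conn_tensorial cN oV (sEE v w)) oV (@subset_refl _ _) Vy
  (sE _) (sE _) (sE _)).
exact: coord_field_lin.
Qed.

Lemma coord_conn2_linear2 u w a v v' :
  coord_conn2 u (a *: v + v') w =
  a *: coord_conn2 u v w + coord_conn2 u v' w.
Proof.
have E r : V r -> DN (coord_field d (a *: v + v')) (coord_field d w) r =
    a *: DN (coord_field d v) (coord_field d w) r +
    DN (coord_field d v') (coord_field d w) r.
  move=> Vr; apply: (tensorial_lin (conn_tensorial cN oV (sE w)) oV (@subset_refl _ _) Vr
    (sE _) (sE _) (sE _)).
  exact: coord_field_lin.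
apply: etrans (conn_eqS cN oV (sE u) (sEE _ w) Vy E) _.
exact: (conn_const _ (sE u) (sEE v w) (sEE v' w) Vy).
Qed.

Lemma coord_conn2_linear3 u v a w w' :
  coord_conn2 u v (a *: w + w') =
  a *: coord_conn2 u v w + coord_conn2 u v w'.
Proof.
have E r : V r -> DN (coord_field d v) (coord_field d (a *: w + w')) r =
    a *: DN (coord_field d v) (coord_field d w) r +
    DN (coord_field d v) (coord_field d w') r.
  move=> Vr; apply: etrans (conn_eqS cN oV (sE v) (sE _) Vr
    (fun r Vr => coord_field_lin a w w' Vr)) _.
  exact: (conn_const _ (sE v) (sE w) (sE w') Vr).
apply: etrans (conn_eqS cN oV (sE u) (sEE v _) Vy E) _.
exact: (conn_const _ (sE u) (sEE v w) (sEE v w') Vy).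
Qed.

Lemma coord_conn2_expand u v w : coord_conn2 u v w =
  \sum_k w ord0 k *: (\sum_j \sum_i (v ord0 j * u ord0 i) *:
    coord_conn2 (delta_mx ord0 i) (delta_mx ord0 j) (delta_mx ord0 k)).
Proof.
rewrite (row_linear_sum w (coord_conn2_linear3 u v)); apply: eq_bigr => k _.
rewrite (row_linear_sum v (coord_conn2_linear2 u _)); congr (_ *: _).
apply: eq_bigr => j _.
rewrite (row_linear_sum u (coord_conn2_linear1 _ _)) scaler_sumr.
by apply: eq_bigr => i _; rewrite scalerA.
Qed.

Lemma coord_conn2_sym u v w : coord_conn2 u v w = coord_conn2 u w v.
Proof.
apply: (conn_eqS cN oV (sE u) (sEE v w) Vy) => r Vr.
exact: (conn_coord_field_sym hDN _ _ Vr).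
Qed.

Local Notation K := (curvature_tensor DN y).

Lemma curvature_tensorC u v w : K u v w = - K v u w.
Proof. by rewrite !curvature_tensorE opprB. Qed.

Lemma curvature_tensor_linear2 u w a v v' : K u (a *: v + v') w = a *: K u v w + K u v' w.
Proof.
rewrite !curvature_tensorE coord_conn2_linear1 coord_conn2_linear2.
exact: linear_comb_sub.
Qed.

Lemma curvature_tensor_linear1 v w a u u' : K (a *: u + u') v w = a *: K u v w + K u' v w.
Proof.
rewrite !curvature_tensorE coord_conn2_linear1 coord_conn2_linear2.
exact: linear_comb_sub.
Qed.

Lemma curvature_tensor_linear3 u v a w w' : K u v (a *: w + w') = a *: K u v w + K u v w'.
Proof.
rewrite !curvature_tensorE !coord_conn2_linear3.
exact: linear_comb_sub.
Qed.

(** Without torsion, the iterated derivative of coordinate fields is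
    symmetric in its last two arguments. *)
Lemma curvature_tensor_bianchi u v w : K u v w + K v w u + K w u v = 0.
Proof.
rewrite !curvature_tensorE (coord_conn2_sym v u) (coord_conn2_sym w v).
rewrite (coord_conn2_sym u w).
move: (coord_conn2 _ _ _) (coord_conn2 _ _ _) (coord_conn2 _ _ _) => A B C.
by apply/rowP => k; rewrite !mxE; ring.
Qed.

Lemma dfun2_inner_coord u v w z :
  dfun (fun r => dfun (fun s => inner h s (coord_field d w s) (coord_field d z s)) r
    (coord_field d v r)) y (coord_field d u y) =
  inner h y (coord_conn2 u v w) z + inner h y w (coord_conn2 u v z) +
  (inner h y (DN (coord_field d v) (coord_field d w) y)
             (DN (coord_field d u) (coord_field d z) y) +
   inner h y (DN (coord_field d u) (coord_field d w) y)
             (DN (coord_field d v) (coord_field d z) y)).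
Proof.
have lcm X s t r : smooth_field V X -> smooth_field V s -> smooth_field V t -> V r ->
    dfun (fun r => inner h r (s r) (t r)) r (X r) =
    inner h r (DN X s r) (t r) + inner h r (s r) (DN X t r).
  by move=> sX ss st Vr; apply: (lc_metric hDN oV sX ss st); exact: mem_set.
have sm s t : smooth_field V s -> smooth_field V t ->
    smooth_fun V (fun r => inner h r (s r) (t r)).
  by move=> ss st; apply: (metric_smooth hh).
have H1 := dfun_eq (coord_field d u y) oV Vy
  (fun r Vr => lcm _ _ _ r (sE v) (sE w) (sE z) Vr).
apply: (etrans H1).
rewrite (dfunD _ Vy (sm _ _ (sEE v w) (sE z)) (sm _ _ (sE w) (sEE v z))).
rewrite (lcm _ _ _ y (sE u) (sEE v w) (sE z) Vy).
rewrite (lcm _ _ _ y (sE u) (sE w) (sEE v z) Vy).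
rewrite !coord_field_at /coord_conn2.
move: (coord_field d) (inner h y) => c ip; ring.
Qed.

(** Coordinate fields commute, hence so do their derivatives of
    <w, z>. *)
Lemma curvature_tensor_skew u v w z : inner h y (K u v w) z = - inner h y w (K u v z).
Proof.
have sm : smooth_fun V (fun s => inner h s (coord_field d w s) (coord_field d z s)).
  by apply: (metric_smooth hh).
have Q := dfun_lie oV Vy sm (sE u) (sE v).
have Q0 : dfun (fun s => inner h s (coord_field d w s) (coord_field d z s)) y
    (lie (coord_field d u) (coord_field d v) y) = 0.
  by rewrite (lie_coord_field u v Vy); exact: derive0.
have := etrans (esym Q0) (etrans Q (congr2 (fun a b => a - b)
  (dfun2_inner_coord u v w z) (dfun2_inner_coord v u w z))).
rewrite !curvature_tensorE innerBl (innerBr hs) {Q Q0 sm}.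
move: (coord_conn2 u v w) (coord_conn2 v u w) (coord_conn2 u v z)
  (coord_conn2 v u z) => A B C D.
move: (coord_field d) (inner h y) => c ip; lra.
Qed.

(** The usual combination of four instances of the first Bianchi
    identity. *)
Lemma curvature_tensor_pair u v w z : inner h y (K u v w) z = inner h y (K w z u) v.
Proof.
pose k a b c e := inner h y (K a b c) e.
have A1 a b c e : k a b c e = - k b a c e.
  exact: etrans (congr1 (fun x => inner h y x e) (curvature_tensorC a b c)) (innerNl _ _ _ _).
have A2 a b c e : k a b c e = - k a b e c.
  exact: etrans (curvature_tensor_skew a b c e) (congr1 -%R (hs y c _)).
have B a b c e : k a b c e + k b c a e + k c a b e = 0.
  by rewrite /k -!innerDl curvature_tensor_bianchi inner0l.
rewrite -[LHS]/(k u v w z) -[RHS]/(k w z u v).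
have B1 := B u v w z; have B2 := B v w z u; have B3 := B w z u v.
have B4 := B z u v w.
have E1 := A1 w u v z; have E2 := A2 v w z u; have E3 := A2 w z v u.
have E4 := A1 z v w u; have E5 := A2 v z w u; have E6 := A1 z u w v.
have E7 := A2 u z w v; have E8 := A2 u w z v; have E9 := A1 z u v w.
have E10 := A2 u v z w.
move: (k) B1 B2 B3 B4 E1 E2 E3 E4 E5 E6 E7 E8 E9 E10 => {}k {A1 A2 B} *.
lra.
Qed.

End CurvatureTensor.

(** * Curvature of the pull-back connection *)

Section PullbackCurvature.
Context {R : realType} {m n : nat} {M : manifold R m} {N : manifold R n}.
Variables (g : M -> 'M[R]_m) (h : N -> 'M[R]_n) (phi : M -> N).
Variable DM : (M -> 'rV[R]_m) -> (M -> 'rV[R]_m) -> M -> 'rV[R]_m.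
Variable DN : (N -> 'rV[R]_n) -> (N -> 'rV[R]_n) -> N -> 'rV[R]_n.
Variable D : (M -> 'rV[R]_m) -> (M -> 'rV[R]_n) -> M -> 'rV[R]_n.
Hypotheses (phi_smooth : smooth_map phi)
  (hDM : levi_civita g DM) (hDN : levi_civita h DN)
  (hD : pullback_connection phi DN D).
Implicit Types (X Y : M -> 'rV[R]_m) (U : set M).

Let cN : connection (@idfun N) DN := lc_connection hDN.
Let cD : connection phi D := pb_connection hD.
Notation eN d j := (coord_field d (delta_mx ord0 j)).
Notation ph d j := (fun r : M => cmap d (phi r) ord0 j).

(** In the chart selected at phi(q) the components of a vector are its
    coordinates. *)
Lemma pushf_coord X q i : let d := chart_at (phi q) in
  pushf phi X q ord0 i = dfun (ph d i) q (X q).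
Proof.
move=> d; have dq : cdom d (phi q) by exact: chart_at_dom.
have pq : (phi @^-1` cdom d) q := dq.
have sp := @smooth_chart_map _ _ _ _ _ _ phi_smooth d.
apply: etrans (esym (dfun_coord ord0 i (X q) pq sp)).
by rewrite -(tcoord_dmap phi_smooth (X q) dq) tcoord_at.
Qed.

Section InChart.
Variables (d : chart N) (U : set M).
Hypotheses (oU : open U) (Ud : U `<=` phi @^-1` cdom d).

Let od : open (cdom d) := cdom_open d.
Let sE j : smooth_field (cdom d) (eN d j) :=
  smooth_coord_field (delta_mx ord0 j) od (@subset_refl _ _).
Let sEE j k : smooth_field (cdom d) (DN (eN d j) (eN d k)) :=
  smooth_conn cN od (sE j) (sE k).
Let sph j : smooth_fun U (ph d j) := smooth_chart_comp phi_smooth j oU Ud.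

Lemma smooth_pull_field (Z : N -> 'rV[R]_n) : smooth_field (cdom d) Z ->
  smooth_section phi U (Z \o phi).
Proof.
move=> sZ; apply: (smooth_section_chart phi_smooth oU Ud).
have sZc : smooth_fun (cdom d) (fun r => tcoord d r (Z r)).
  have := smooth_field_coord (c := d) sZ; rewrite setIid; exact.
by apply: smooth_fun_sub Ud _; exact: (smooth_fun_pull phi_smooth od sZc).
Qed.

(** Applying [pullback_conn] twice. *)
Lemma conn2_frame X Y k q : smooth_field U X -> smooth_field U Y -> U q ->
  D X (D Y (eN d k \o phi)) q =
  \sum_j (dfun (fun r => dfun (ph d j) r (Y r)) q (X q) *:
             DN (eN d j) (eN d k) (phi q) +
          dfun (ph d j) q (Y q) *: \sum_i dfun (ph d i) q (X q) *:
             DN (eN d i) (DN (eN d j) (eN d k)) (phi q)).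
Proof.
move=> sX sY Uq.
have sc := smooth_conn cD oU sY (smooth_pull_field (sE k)).
have sda j := smooth_dfun oU (sph j) sY.
have E r : U r -> D Y (eN d k \o phi) r = \sum_j dfun (ph d j) r (Y r) *:
    (DN (eN d j) (eN d k) \o phi) r.
  move=> Ur.
  exact: (pullback_conn phi_smooth hDN hD oU sY od (@subset_refl _ _) (sE k) Ur (Ud Ur)).
apply: etrans (conn_eqS cD oU sX sc Uq E) _.
apply: etrans (conn_lincomb phi_smooth cD oU _ sX sda
  (fun j => smooth_pull_field (sEE j k)) Uq) _.
apply: eq_bigr => j _; congr (_ + _ *: _).
exact: (pullback_conn phi_smooth hDN hD oU sX od (@subset_refl _ _) (sEE j k) Uq (Ud Uq)).
Qed.

(** The second derivatives of the components of phi cancel against the bracket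
    of X and Y. *)
Lemma curvature_frame X Y k q : smooth_field U X -> smooth_field U Y -> U q ->
  curvature D X Y (eN d k \o phi) q =
  \sum_j \sum_i (dfun (ph d j) q (Y q) * dfun (ph d i) q (X q)) *:
             DN (eN d i) (DN (eN d j) (eN d k)) (phi q) -
  \sum_j \sum_i (dfun (ph d j) q (X q) * dfun (ph d i) q (Y q)) *:
             DN (eN d i) (DN (eN d j) (eN d k)) (phi q).
Proof.
move=> sX sY Uq; rewrite /curvature (conn2_frame k sX sY Uq) (conn2_frame k sY sX Uq).
rewrite (pullback_conn phi_smooth hDN hD oU (smooth_lie hDM oU sX sY) od
  (@subset_refl _ _) (sE k) Uq (Ud Uq)).
rewrite -!sumrB; apply: eq_bigr => j _.
rewrite (dfun_lie oU Uq (sph j) sX sY).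
under [in RHS]eq_bigr do rewrite -scalerA.
under [X in _ = _ - X]eq_bigr do rewrite -scalerA.
rewrite -!scaler_sumr.
move: (\sum_i _) (\sum_i _) => S1 S2.
move: (dfun _ q (X q)) (dfun _ q (Y q)) (dfun _ q (X q)) (dfun _ q (Y q)) => x1 y1 x2 y2.
rewrite /=; move: (DN _ _ (phi q)) => G.
by apply/rowP => l; rewrite !mxE; ring.
Qed.

End InChart.

(** Both sides are linear in s over smooth functions, and agree on the
    coordinate frame of N. *)
Lemma pullback_curvature U X Y s q : open U -> smooth_field U X ->
  smooth_field U Y -> smooth_section phi U s -> U q ->
  curvature D X Y s q =
  curvature_tensor DN (phi q) (pushf phi X q) (pushf phi Y q) (s q).
Proof.
move=> oU0 sX0 sY0 ss0 Uq0; pose d := chart_at (phi q).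
pose U' := U `&` phi @^-1` cdom d.
have oU : open U' by exact: openI_preimage.
have Ud : U' `<=` phi @^-1` cdom d by exact: subIsetr.
have UU : U' `<=` U by exact: subIsetl.
have Uq : U' q by split=> //; exact: chart_at_dom.
have sX := smooth_section_sub UU sX0; have sY := smooth_section_sub UU sY0.
have ss := smooth_section_sub UU ss0.
have sEp j : smooth_section phi U' (eN d j \o phi).
  exact: (smooth_coord_field_pull phi_smooth _ oU Ud).
have sc j : smooth_fun U' (fun q => tcoord d (phi q) (s q) ord0 j).
  by apply: (smooth_fun_coord _ _ oU); exact: (smooth_section_coord ss Ud).
have E r : U' r -> s r = \sum_j tcoord d (phi r) (s r) ord0 j *: (eN d j \o phi) r.
  by move=> Ur; exact: (section_frame (s r) (Ud r Ur)).
apply: etrans (curvature_eqS hDM cD oU sX sY ss Uq E) _.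
apply: etrans (curvature_lincomb hDM phi_smooth cD oU sX sY sc sEp Uq) _.
rewrite (curvature_tensorE hDN) !(coord_conn2_expand hDN) -sumrB.
apply: eq_bigr => k _; rewrite tcoord_at -scalerBr; congr (_ *: _).
apply: etrans (curvature_frame oU Ud k sX sY Uq) _.
by congr (_ - _); apply: eq_bigr => j _; apply: eq_bigr => i _; rewrite !pushf_coord.
Qed.

End PullbackCurvature.

(*BEGIN*)

Lemma tensorial_pointwise {R : realType} {n : nat} {M : manifold R n} {V : lmodType R}
    (U : set M) (A : (M -> 'rV[R]_n) -> M -> V) (L : M -> 'rV[R]_n -> V) :
  (forall U' X q, open U' -> U' `<=` U -> smooth_field U' X -> U' q ->
     A X q = L q (X q)) ->
  (forall q a u v, L q (a *: u + v) = a *: L q u + L q v) -> tensorial U A.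
Proof.
move=> AL lL U' oU' UU; split=> [X X' sX sX' E q Uq|f X Y sf sX sY q Uq].
  by rewrite (AL _ _ _ oU' UU sX Uq) (AL _ _ _ oU' UU sX' Uq) E.
have sXY := smooth_section_linear smooth_idfun oU' sf sX sY.
rewrite (AL _ _ _ oU' UU sXY Uq) (AL _ _ _ oU' UU sX Uq) (AL _ _ _ oU' UU sY Uq).
exact: lL.
Qed.

(** * Covariant derivatives of vector-valued 1-forms *)

Section CovForm.
Context {R : realType} {m n : nat} {M : manifold R m} {N : manifold R n}.
Variables (g : M -> 'M[R]_m) (phi : M -> N).
Variable DM : (M -> 'rV[R]_m) -> (M -> 'rV[R]_m) -> M -> 'rV[R]_m.
Variable D : (M -> 'rV[R]_m) -> (M -> 'rV[R]_n) -> M -> 'rV[R]_n.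
Hypotheses (phi_smooth : smooth_map phi) (cM : connection (@idfun M) DM)
  (cD : connection phi D).
Variable U : set M.
Implicit Types (X Y Z V : M -> 'rV[R]_m) (alpha : (M -> 'rV[R]_m) -> M -> 'rV[R]_n).

Definition smooth_form alpha : Prop :=
  forall U' X, open U' -> U' `<=` U -> smooth_field U' X ->
    smooth_section phi U' (alpha X).

(** The covariant derivative of the 1-form [alpha]: the second fundamental form for
    alpha = dphi, the Hessian of sigma for alpha = D sigma. *)
Definition cov_form alpha Z V q : 'rV[R]_n := D Z (alpha V) q - alpha (DM Z V) q.

(** The derivative of a coefficient f appears in both terms, and
    cancels. *)
Lemma cov_form_tensorialr alpha Z : open U -> smooth_field U Z ->
  tensorial U alpha -> smooth_form alpha -> tensorial U (cov_form alpha Z).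
Proof.
move=> oU sZU ta sa U' oU' UU; have sZ := smooth_section_sub UU sZU.
have [ea la] := ta _ oU' UU.
have sDZ X : smooth_field U' X -> smooth_field U' (DM Z X) by exact: (smooth_conn cM oU').
split=> [X X' sX sX' E q Uq|f X Y sf sX sY q Uq].
  rewrite /cov_form (conn_eqS cD oU' sZ (sa _ _ oU' UU sX) Uq (ea _ _ sX sX' E)).
  congr (_ - _); apply: ea Uq => [||r Ur]; [exact: sDZ|exact: sDZ|].
  exact: (conn_eqS cM oU' sZ sX Ur E).
have sXY := smooth_section_linear smooth_idfun oU' sf sX sY.
have saX := sa _ _ oU' UU sX; have saY := sa _ _ oU' UU sY.
rewrite /cov_form (conn_eqS cD oU' sZ (sa _ _ oU' UU sXY) Uq (la f X Y sf sX sY)).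
rewrite (conn_leib cD oU' sf sZ saX saY Uq).
have sW := smooth_section_linear smooth_idfun oU' sf (sDZ _ sX) (sDZ _ sY).
rewrite (tensorial_lin (A := alpha) ta (a := dfun f q (Z q)) oU' UU Uq sX sW (sDZ _ sXY)); last first.
  by rewrite (conn_leib cM oU' sf sZ sX sY Uq) addrA.
rewrite (la f _ _ sf (sDZ _ sX) (sDZ _ sY) q Uq).
move: (dfun f q _) (f q) => a b.
move: (alpha X q) (D Z _ q) (D Z _ q) (alpha _ q) (alpha _ q) => x1 x2 x3 x4 x5.
by apply/rowP => k; rewrite !mxE; ring.
Qed.

Lemma cov_form_tensoriall alpha V : open U -> smooth_field U V ->
  tensorial U alpha -> smooth_form alpha ->
  tensorial U (fun Z => cov_form alpha Z V).
Proof.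
move=> oU sV ta sa; apply: tensorialB.
  apply: (conn_tensorial cD oU); exact: sa (@subset_refl _ _) sV.
apply: (tensorial_comp (A := fun Z => DM Z V) (B := alpha) _ _ ta).
  move=> U' X oU' UU sX; apply: (smooth_conn cM oU' sX).
  exact: smooth_section_sub UU sV.
exact: (conn_tensorial cM oU sV).
Qed.

End CovForm.

(** * Covariant derivatives of bilinear forms *)

Section CovTensor.
Context {R : realType} {m : nat} {M : manifold R m}.
Variable DM : (M -> 'rV[R]_m) -> (M -> 'rV[R]_m) -> M -> 'rV[R]_m.
Hypothesis cM : connection (@idfun M) DM.
Implicit Types (U : set M) (X Y Z V W : M -> 'rV[R]_m)
  (S : (M -> 'rV[R]_m) -> (M -> 'rV[R]_m) -> M -> R).

Definition smooth_tensor2 U S : Prop :=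
  tensorial2 (V := R^o) U S /\
  forall U' X Y, open U' -> U' `<=` U -> smooth_field U' X -> smooth_field U' Y ->
    smooth_fun U' (S X Y).

Lemma smooth_tensor2_sub U U' S : U' `<=` U -> smooth_tensor2 U S -> smooth_tensor2 U' S.
Proof.
move=> UU [tS sS]; split; first exact: tensorial2_sub UU tS.
by move=> U1 X Y oU1 U1U; apply: sS => // q /U1U /UU.
Qed.

(** One argument at a time: as for 1-forms, the derivatives of
    coefficients cancel. *)
Lemma cov_tensor_tensorial_slot U (B : (M -> 'rV[R]_m) -> M -> R) Z : open U ->
  smooth_field U Z -> tensorial (V := R^o) U B ->
  (forall U' X, open U' -> U' `<=` U -> smooth_field U' X -> smooth_fun U' (B X)) ->
  tensorial (V := R^o) U (fun X q => dfun (B X) q (Z q) - B (DM Z X) q).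
Proof.
move=> oU sZU tB sB U' oU' UU; have sZ := smooth_section_sub UU sZU.
have [eB lB] := tB _ oU' UU.
have sDZ X : smooth_field U' X -> smooth_field U' (DM Z X) by exact: (smooth_conn cM oU').
split=> [X X' sX sX' E q Uq|f X Y sf sX sY q Uq].
  rewrite (dfun_eq (Z q) oU' Uq (eB _ _ sX sX' E)).
  congr (_ - _); apply: eB Uq => [||r Ur]; [exact: sDZ|exact: sDZ|].
  exact: (conn_eqS cM oU' sZ sX Ur E).
have sXY := smooth_section_linear smooth_idfun oU' sf sX sY.
have sBX := sB _ _ oU' UU sX; have sBY := sB _ _ oU' UU sY.
rewrite (dfun_eq (Z q) oU' Uq (lB f X Y sf sX sY)).
rewrite (dfunD _ Uq (smooth_fun_scale oU' sf sBX) sBY) (dfun_scale _ Uq sf sBX).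
have sW := smooth_section_linear smooth_idfun oU' sf (sDZ _ sX) (sDZ _ sY).
rewrite (tensorial_lin (A := B) tB (a := dfun f q (Z q)) oU' UU Uq sX sW (sDZ _ sXY)); last first.
  by rewrite (conn_leib cM oU' sf sZ sX sY Uq) addrA.
rewrite (lB f _ _ sf (sDZ _ sX) (sDZ _ sY) q Uq).
move: (dfun _ _ _) (f q) (dfun _ _ _) (dfun _ _ _) => a b x1 x2.
move: (B _ q) (B _ q) (B _ q) => x3 x4 x5.
rewrite /GRing.scale/=; ring.
Qed.

Lemma dfun_tensorial U (f : M -> R) : open U -> smooth_fun U f ->
  tensorial (V := R^o) U (fun Z q => dfun f q (Z q)).
Proof.
move=> oU sf U' oU' UU; split=> [X X' _ _ E q Uq|a X Y _ _ _ q Uq].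
  by rewrite E.
exact: dfun_linear (UU _ Uq) sf.
Qed.

Lemma cov_tensorE S Z X Y q : cov_tensor DM S Z X Y q =
  dfun (S X Y) q (Z q) - S (DM Z X) Y q - S X (DM Z Y) q.
Proof. by []. Qed.

Lemma cov_tensor_tensorial U S X Y : open U -> smooth_tensor2 U S ->
  smooth_field U X -> smooth_field U Y ->
  tensorial (V := R^o) U (fun Z => cov_tensor DM S Z X Y).
Proof.
move=> oU [tS sS] sX sY.
have UU := @subset_refl _ U.
have sD X0 : smooth_field U X0 -> forall U' Z, open U' -> U' `<=` U ->
    smooth_field U' Z -> smooth_field U' (DM Z X0).
  move=> sX0 U' Z oU' U'U sZ; apply: (smooth_conn cM oU' sZ).
  exact: smooth_section_sub U'U sX0.
apply: tensorialB; first apply: tensorialB.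
- exact: (dfun_tensorial oU (sS _ _ _ oU UU sX sY)).
- apply: (tensorial_comp (A := fun Z => DM Z X) (B := fun V => S V Y) (sD _ sX)).
    exact: (conn_tensorial cM oU sX).
  exact: (tS _ oU UU _ sY).2.
- apply: (tensorial_comp (A := fun Z => DM Z Y) (B := fun V => S X V) (sD _ sY)).
    exact: (conn_tensorial cM oU sY).
  exact: (tS _ oU UU _ sX).1.
Qed.

Lemma cov_tensor_smooth U S Z : open U -> smooth_field U Z ->
  smooth_tensor2 U S -> smooth_tensor2 U (cov_tensor DM S Z).
Proof.
move=> oU sZ [tS sS]; split; last first.
  move=> U' X Y oU' UU sX sY; have sZ' := smooth_section_sub UU sZ.
  have sD V : smooth_field U' V -> smooth_field U' (DM Z V).
    exact: (smooth_conn cM oU').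
  apply: (smooth_funB oU'); last exact: (sS _ _ _ oU' UU sX (sD _ sY)).
  apply: (smooth_funB oU'); last exact: (sS _ _ _ oU' UU (sD _ sX) sY).
  exact: (smooth_dfun oU' (sS _ _ _ oU' UU sX sY) sZ').
move=> U' oU' UU V sV; have sZ' := smooth_section_sub UU sZ.
have sDV : smooth_field U' (DM Z V) by exact: (smooth_conn cM oU' sZ' sV).
have [tSV1 tSV2] := tS _ oU' UU V sV.
have [tSD1 tSD2] := tS _ oU' UU _ sDV.
split.
  apply: (tensorial_ext (A := fun Y q => dfun (S V Y) q (Z q) - S V (DM Z Y) q -
      S (DM Z V) Y q)); first by move=> Y q; rewrite /cov_tensor addrAC.
  have sB U1 Y : open U1 -> U1 `<=` U' -> smooth_field U1 Y -> smooth_fun U1 (S V Y).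
    move=> oU1 U1U sY; apply: (sS _ _ _ oU1 _ _ sY).
      by move=> r /U1U /UU.
    exact: smooth_section_sub U1U sV.
  exact: (tensorialB (cov_tensor_tensorial_slot oU' sZ' tSV1 sB) tSD1).
have sB U1 Y : open U1 -> U1 `<=` U' -> smooth_field U1 Y -> smooth_fun U1 (S Y V).
  move=> oU1 U1U sY; apply: (sS _ _ _ oU1 _ sY).
    by move=> r /U1U /UU.
  exact: smooth_section_sub U1U sV.
exact: (tensorialB (cov_tensor_tensorial_slot (B := fun X => S X V) oU' sZ' tSV2 sB) tSD2).
Qed.

(** In the second direction Z, the combination is the covariant derivative of
    the form Z |-> (nabla_Z S)(X,Y), up to terms that are tensorial. *)
Lemma cov2_tensorial U S X Y : open U -> smooth_tensor2 U S ->
  smooth_field U X -> smooth_field U Y ->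
  tensorial2 (V := R^o) U (fun W Z r =>
    cov_tensor DM (cov_tensor DM S Z) W X Y r - cov_tensor DM S (DM W Z) X Y r).
Proof.
move=> oU sS0 sX0 sY0 U' oU' UU V sV.
have sS := smooth_tensor2_sub UU sS0.
have sX := smooth_section_sub UU sX0; have sY := smooth_section_sub UU sY0.
have UU' := @subset_refl _ U'.
have sDV X0 : smooth_field U' X0 -> smooth_field U' (DM V X0).
  exact: (smooth_conn cM oU').
split; last first.
  apply: tensorialB.
    exact: (cov_tensor_tensorial oU' (cov_tensor_smooth oU' sV sS) sX sY).
  apply: (tensorial_comp (A := fun W => DM W V) (B := fun W => cov_tensor DM S W X Y)).
  - move=> U1 W oU1 U1U sW; apply: (smooth_conn cM oU1 sW).
    exact: smooth_section_sub U1U sV.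
  - exact: (conn_tensorial cM oU' sV).
  - exact: (cov_tensor_tensorial oU' sS sX sY).
apply: (tensorial_ext (A := fun Z q =>
  dfun (cov_tensor DM S Z X Y) q (V q) - cov_tensor DM S (DM V Z) X Y q -
  cov_tensor DM S Z (DM V X) Y q - cov_tensor DM S Z X (DM V Y) q)).
  move=> Z q; rewrite (cov_tensorE (cov_tensor DM S Z) V).
  move: (cov_tensor DM S) => C; move: (dfun _ _ _) => d; ring.
apply: tensorialB; first apply: tensorialB.
- apply: (cov_tensor_tensorial_slot (B := fun Z => cov_tensor DM S Z X Y) oU' sV).
    exact: (cov_tensor_tensorial oU' sS sX sY).
  move=> U1 Z oU1 U1U sZ.
  have [_] := cov_tensor_smooth oU1 sZ (smooth_tensor2_sub U1U sS).
  apply; [exact: oU1|exact: subset_refl| |].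
    exact: smooth_section_sub U1U sX.
  exact: smooth_section_sub U1U sY.
- exact: (cov_tensor_tensorial oU' sS (sDV _ sX) sY).
- exact: (cov_tensor_tensorial oU' sS sX (sDV _ sY)).
Qed.

Lemma dfun_tensor S Z X Y q : dfun (S X Y) q (Z q) =
  cov_tensor DM S Z X Y q + S (DM Z X) Y q + S X (DM Z Y) q.
Proof. rewrite cov_tensorE; move: (dfun _ _ _) => d; ring. Qed.

(** All terms with a first derivative of X or Y are tensorial in that derivative,
    which vanishes at p. *)
Lemma cov2_at U S Z X Y p : open U -> U p -> smooth_tensor2 U S ->
  smooth_field U Z -> smooth_field U X -> smooth_field U Y ->
  DM Z X p = 0 -> DM Z Y p = 0 ->
  cov_tensor DM (cov_tensor DM S Z) Z X Y p =
  dfun (fun q => dfun (S X Y) q (Z q)) p (Z p) -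
  S (DM Z (DM Z X)) Y p - S X (DM Z (DM Z Y)) p.
Proof.
move=> oU Up sS sZ sX sY ZX ZY; have [tS sS'] := sS.
have UU := @subset_refl _ U.
have sD X0 : smooth_field U X0 -> smooth_field U (DM Z X0).
  exact: (smooth_conn cM oU).
have sC := cov_tensor_smooth oU sZ sS; have [tC _] := sC.
have z0 (S1 : (M -> 'rV[R]_m) -> (M -> 'rV[R]_m) -> M -> R) V Y0 :
    tensorial2 (V := R^o) U S1 -> smooth_field U V -> smooth_field U Y0 ->
    V p = 0 -> S1 V Y0 p = 0 /\ S1 Y0 V p = 0.
  move=> tS1 sV sY0 V0; split.
    exact: (tensorial0 (tS1 _ oU UU _ sY0).2 oU UU Up sV V0).
  exact: (tensorial0 (tS1 _ oU UU _ sY0).1 oU UU Up sV V0).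
have sSXY := sS' _ _ _ oU UU sX sY.
have s1 := sS' _ _ _ oU UU (sD _ sX) sY.
have s2 := sS' _ _ _ oU UU sX (sD _ sY).
have s0 := smooth_dfun oU sSXY sZ.
have E1 : dfun (S (DM Z X) Y) p (Z p) = S (DM Z (DM Z X)) Y p.
  apply: etrans (dfun_tensor S Z (DM Z X) Y p) _.
  rewrite (z0 _ _ _ tC (sD _ sX) sY ZX).1 (z0 _ _ _ tS (sD _ sY) (sD _ sX) ZY).2.
  by rewrite add0r addr0.
have E2 : dfun (S X (DM Z Y)) p (Z p) = S X (DM Z (DM Z Y)) p.
  apply: etrans (dfun_tensor S Z X (DM Z Y) p) _.
  rewrite (z0 _ _ _ tC (sD _ sY) sX ZY).2 (z0 _ _ _ tS (sD _ sX) (sD _ sY) ZX).1.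
  by rewrite !add0r.
rewrite (cov_tensorE (cov_tensor DM S Z) Z) (z0 _ _ _ tC (sD _ sX) sY ZX).1 (z0 _ _ _ tC (sD _ sY) sX ZY).2.
rewrite !subr0 -E1 -E2.
apply: etrans (dfunB (Z p) oU Up (smooth_funB oU s0 s1) s2) _.
by rewrite (dfunB (Z p) oU Up s0 s1).
Qed.

End CovTensor.

(** * Geodesic frames *)

Section Geodesic.
Context {R : realType} {m : nat} {M : manifold R m}.
Variables (g : M -> 'M[R]_m) (DM : (M -> 'rV[R]_m) -> (M -> 'rV[R]_m) -> M -> 'rV[R]_m).
Hypothesis hDM : levi_civita g DM.
Let cM : connection (@idfun M) DM := lc_connection hDM.

Lemma pushf_id X q : pushf (@idfun M) X q = X q.
Proof. exact: tcoord_at. Qed.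

(** The tangent bundle is the pull-back of itself by the identity, so
    that whatever holds for pull-back connections applies to it. *)
Lemma levi_civita_pullback : pullback_connection (@idfun M) DM DM.
Proof.
split=> // U V X Z oU oV sX sZ q /set_mem[Uq Vq].
set c := chart_at _.
pose U' := U `&` V `&` cdom c.
have oU' : open U' by apply: openI; [exact: openI|exact: cdom_open].
have UU : U' `<=` V by move=> r [[]].
apply: (tensorial_eq (conn_tensorial cM oV sZ) oU' UU).
- by split; [split|exact: chart_at_dom].
- by apply: smooth_section_sub sX => r [[]].
- by apply: (smooth_coord_field _ oU') => r [].
- by rewrite coord_field_at pushf_id.
Qed.

Lemma derive1_along_ray (V : normedModType R) (f : V -> 'rV[R]_m) v :
  differentiable f 0 -> derive1 (fun t : R => f (t *: v)) 0 = 'D_v f 0.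
Proof.
move=> df; rewrite derive1E.
have df0 : differentiable f (0 + (0 : R) *: v) by rewrite scale0r addr0.
pose l (s : R) : V := 0 + s *: v.
have [dl lE] : is_diff (0 : R) l (fun s : R => s *: v).
  rewrite -[X in is_diff _ _ X](add0r (fun s : R => s *: v)).
  exact: (is_diffD (is_diff_cst (0 : V) (0 : R)) (is_diff_scalel (0 : R) v)).
have E : (fun t : R => f (t *: v)) = f \o l by apply/funext => s; rewrite /l/= add0r.
rewrite E (derive_comp (1 : R^o) dl df0) (deriveE _ dl) lE scale1r.
by rewrite /l scale0r addr0.
Qed.

(** Along the geodesic with initial velocity F_i(p) the field F_j is
    parallel; at time 0 the covariant derivative along the curve, written in
    coordinates, is the value at p of the connection. *)
Lemma geodesic_frame_parallel p U F i j : geodesic_frame g DM p U F ->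
  DM (F i) (F j) p = 0.
Proof.
case=> [[oU Up] sF oF [W [E [L [[oW W0 _] [_ _ cE sE _] E0 HE]]]]].
set v : 'rV[R]_m := delta_mx ord0 i.
have [v0 cc] := HE v.
have vF : \sum_k v ord0 k *: F k p = F i p.
  rewrite (bigD1 i)//= mxE !eqxx scale1r big1 ?addr0// => k ki.
  by rewrite mxE (negbTE ki) andbF scale0r.
have W00 : W ((0 : R) *: v) by rewrite scale0r.
have [_ /(_ j)] := cc 0 W00.
rewrite {}vF in v0.
rewrite /cov_curve v0 /= scale0r E0 => par.
move: v0; rewrite /velocity /= scale0r E0; set c := chart_at p => v0.
rewrite -/c in par.
have cp : cdom c p by exact: chart_at_dom.
pose f q := tcoord c q (F j q).
pose U' := U `&` cdom c.
have oU' : open U' by apply: openI => //; exact: cdom_open.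
have Up' : U' p by [].
have UU : U' `<=` U by exact: subIsetl.
have sFj := smooth_section_sub UU (sF j); have sFi := smooth_section_sub UU (sF i).
have sf : smooth_fun U' f by exact: (smooth_field_coord (c := c) (sF j)).
have AW : (W `&` E @^-1` cdom c) 0 by split=> //; rewrite /preimage/= E0.
have dA : differentiable (cmap c \o E) 0 := smooth_on_diff (sE c) AW.
have Ap : (cmap c \o E) 0 = cmap c p by rewrite /= E0.
have df : differentiable (f \o cinv c) ((cmap c \o E) 0).
  by rewrite Ap; exact: (smooth_fun_diff sf Up' cp).
(* The exponential map is only known to be smooth through charts, hence the detour
   by the chart c on a neighbourhood of 0. *)
have near_fE : \forall x \near (0 : 'rV[R]_m),
    ((f \o cinv c) \o (cmap c \o E)) x = (f \o E) x.
  have nE : \forall x \near (0 : 'rV[R]_m), cdom c (E x).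
    apply: (cE 0 W0); rewrite E0; apply: open_nbhs_nbhs; split=> //.
    exact: cdom_open.
  by apply: filterS nE => x cx; rewrite /= cmapK.
have [dfE _] := near_eq_diff near_fE (differentiable_comp dA df).
have vE : 'D_v (cmap c \o E) 0 = F i p by rewrite -(derive1_along_ray v dA).
have fE : derive1 (fun s : R => f (E (s *: v))) 0 = dfun f p (F i p).
  apply: etrans (derive1_along_ray v dfE) _.
  by rewrite -(near_eq_derive v near_fE) (derive_comp v dA df) vE Ap.
rewrite -[X in derive1 X]/(fun s : R => f (E (s *: v))) fE in par.
have sEk k : smooth_field U' (coord_field c k).
  by apply: (smooth_coord_field _ oU'); exact: subIsetr.
have sfk k : smooth_fun U' (fun q => f q ord0 k) := smooth_fun_coord ord0 k oU' sf.
have EF q : U' q -> F j q = \sum_k f q ord0 k *: coord_field c (delta_mx ord0 k) q.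
  by move=> [_ cq]; exact: (@section_frame _ _ _ _ _ (@idfun M) c q (F j q) cq).
have EC q : U' q -> coord_field c (F j p) q =
    \sum_k F j p ord0 k *: coord_field c (delta_mx ord0 k) q.
  by move=> [_ cq]; rewrite {1}(row_sum_delta (F j p)) coord_field_suml.
have H1 := conn_eqS cM oU' sFi sFj Up' EF.
rewrite (conn_lincomb smooth_idfun cM oU' _ sFi sfk (fun k => sEk _) Up') in H1.
rewrite big_split/= in H1.
have H2 : DM (coord_field c (F i p)) (coord_field c (F j p)) p =
    DM (F i) (coord_field c (F j p)) p.
  apply: (tensorial_eq (conn_tensorial cM oU' (sEk _)) oU' (@subset_refl _ _) Up'
    (sEk _) sFi).
  exact: coord_field_at.
have H3 := conn_eqS cM oU' sFi (sEk (F j p)) Up' EC.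
rewrite (conn_lincomb smooth_idfun cM oU' _ sFi (fun k => smooth_fun_cst _)
  (fun k => sEk _) Up') in H3.
rewrite H1; apply: etrans par; rewrite H2 H3; congr (_ + _).
  rewrite -[RHS](coord_field_at p) {1}(row_sum_delta (dfun f p (F i p))).
  rewrite (coord_field_suml _ _ cp); apply: eq_bigr => k _.
  by rewrite (dfun_coord _ _ _ Up' sf).
apply: eq_bigr => k _; by rewrite dfun_cst scale0r add0r /f tcoord_at.
Qed.

End Geodesic.

(*BEGIN*)

(** * Ricci curvature *)

Section Ricci.
Context {R : realType} {m : nat} {M : manifold R m}.
Variables (g : M -> 'M[R]_m) (DM : (M -> 'rV[R]_m) -> (M -> 'rV[R]_m) -> M -> 'rV[R]_m).
Hypotheses (hg : riemannian g) (hDM : levi_civita g DM).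
Variables (U : set M) (F : 'I_m -> M -> 'rV[R]_m).
Hypotheses (oU : open U) (sF : forall i, smooth_field U (F i)).
Hypothesis oF : forall q, U q -> forall i j, inner g q (F i q) (F j q) = (i == j)%:R.
Let cM : connection (@idfun M) DM := lc_connection hDM.

(** The case phi = id of [pullback_curvature]. *)
Lemma curvature_pointwise U' X Y Z q : open U' -> smooth_field U' X ->
  smooth_field U' Y -> smooth_field U' Z -> U' q ->
  curvature DM X Y Z q = curvature_tensor DM q (X q) (Y q) (Z q).
Proof.
move=> oU' sX sY sZ Uq.
rewrite (pullback_curvature smooth_idfun hDM hDM (levi_civita_pullback hDM) oU' sX sY sZ Uq).
by rewrite !pushf_id.
Qed.

Lemma curvature_tensorial2 X : smooth_field U X ->
  tensorial2 U (fun Y Z => curvature DM X Y Z).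
Proof.
move=> sX U' oU' UU Z sZ; split.
  apply: (tensorial_pointwise (L := fun q u => curvature_tensor DM q (X q) (Z q) u)).
    move=> U1 Y q oU1 U1U sY Uq; apply: (curvature_pointwise oU1 _ _ sY Uq).
      by apply: smooth_section_sub sX => r /U1U /UU.
    exact: smooth_section_sub U1U sZ.
  by move=> q a u v; exact: (curvature_tensor_linear3 hDM).
apply: (tensorial_pointwise (L := fun q u => curvature_tensor DM q (X q) u (Z q))).
  move=> U1 Y q oU1 U1U sY Uq; apply: (curvature_pointwise oU1 _ sY _ Uq).
    by apply: smooth_section_sub sX => r /U1U /UU.
  exact: smooth_section_sub U1U sZ.
by move=> q a u v; exact: (curvature_tensor_linear2 hDM).
Qed.

Lemma ricci_frame X q : smooth_field U X -> U q ->
  ricci g DM X q = \sum_k curvature DM X (F k) (F k) q.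
Proof. by move=> sX Uq; exact: (mtrace_frame sF oU oF (curvature_tensorial2 sX) Uq). Qed.

Lemma smooth_ricci X : smooth_field U X -> smooth_field U (ricci g DM X).
Proof.
move=> sX; apply: (smooth_section_eq smooth_idfun oU
  (fun q Uq => esym (ricci_frame sX Uq))).
apply: (smooth_section_sum smooth_idfun _ oU) => k.
exact: (smooth_curvature hDM smooth_idfun cM oU sX (sF k) (sF k)).
Qed.

Lemma ricci_sym X Y q : smooth_field U X -> smooth_field U Y -> U q ->
  inner g q (ricci g DM X q) (Y q) = inner g q (ricci g DM Y q) (X q).
Proof.
move=> sX sY Uq.
have half V W : smooth_field U V -> inner g q (ricci g DM V q) W =
    \sum_k inner g q (curvature_tensor DM q (V q) (F k q) (F k q)) W.
  move=> sV; rewrite (ricci_frame sV Uq) inner_suml; apply: eq_bigr => k _.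
  by rewrite (curvature_pointwise oU sV (sF k) (sF k) Uq).
apply: etrans (half X _ sX) (etrans _ (esym (half Y _ sY))).
apply: eq_bigr => k _.
apply: etrans (curvature_tensor_pair hg hDM q _ _ _ _) _.
apply: etrans (congr1 (fun x => inner g q x _) (curvature_tensorC hDM q _ _ _)) _.
rewrite innerNl; apply: etrans (congr1 -%R (curvature_tensor_skew hg hDM q _ _ _ _)) _.
by rewrite opprK; exact: (Defs.metric_sym hg).
Qed.

End Ricci.

(** * A Weitzenbock formula *)

Section Weitzenbock.
Context {R : realType} {m n : nat} {M : manifold R m} {N : manifold R n}.
Variables (g : M -> 'M[R]_m) (phi : M -> N).
Variable DM : (M -> 'rV[R]_m) -> (M -> 'rV[R]_m) -> M -> 'rV[R]_m.
Variable D : (M -> 'rV[R]_m) -> (M -> 'rV[R]_n) -> M -> 'rV[R]_n.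
Hypotheses (phi_smooth : smooth_map phi) (hDM : levi_civita g DM)
  (cD : connection phi D).
Variables (p : M) (U : set M) (F : 'I_m -> M -> 'rV[R]_m).
Hypotheses (oU : open U) (Up : U p) (sF : forall i, smooth_field U (F i)).
Hypothesis oF : forall q, U q -> forall i j, inner g q (F i q) (F j q) = (i == j)%:R.
Hypothesis parF : forall i j, DM (F i) (F j) p = 0.
Let cM : connection (@idfun M) DM := lc_connection hDM.
Let UU : U `<=` U := @subset_refl _ U.
Implicit Types (X Y Z V : M -> 'rV[R]_m).

Lemma frame_parallel Z j : smooth_field U Z -> DM Z (F j) p = 0.
Proof.
move=> sZ; rewrite (tensorial_sum (conn_tensorial cM oU (sF j)) oU UU Up sZ sF
  (frame_expansion oF (Z p) Up)).
by rewrite big1// => k _; rewrite parF scaler0.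
Qed.

Let sDM X Y : smooth_field U X -> smooth_field U Y -> smooth_field U (DM X Y).
Proof. exact: (smooth_conn cM oU). Qed.

Lemma lie_at X Y : smooth_field U X -> smooth_field U Y ->
  DM X Y p = 0 -> DM Y X p = 0 -> lie X Y p = 0.
Proof. by move=> sX sY E1 E2; rewrite (lie_conn hDM oU sX sY Up) E1 E2 subr0. Qed.

Variable alpha : (M -> 'rV[R]_m) -> M -> 'rV[R]_n.
Hypotheses (ta : tensorial U alpha) (sa : smooth_form phi U alpha).

Let saU X : smooth_field U X -> smooth_section phi U (alpha X).
Proof. exact: sa. Qed.

Lemma conn_form_at Z V : smooth_field U Z -> smooth_field U V -> V p = 0 ->
  D Z (alpha V) p = alpha (DM Z V) p.
Proof.
move=> sZ sV V0; apply/eqP; rewrite -subr_eq0; apply/eqP.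
exact: (tensorial0 (cov_form_tensorialr cM cD oU sZ ta sa) oU UU Up sV V0).
Qed.

Variable X : M -> 'rV[R]_m.
Hypotheses (sX : smooth_field U X) (parX : forall Z, smooth_field U Z -> DM Z X p = 0).

(** At p the fields X and F_k commute, so the bracket term of the curvature
    vanishes. *)
Lemma form_ricci : alpha (ricci g DM X) p =
  \sum_k (alpha (DM X (DM (F k) (F k))) p - alpha (DM (F k) (DM X (F k))) p).
Proof.
have sR k : smooth_field U (curvature DM X (F k) (F k)).
  exact: (smooth_curvature hDM smooth_idfun cM oU sX (sF k) (sF k)).
have E : ricci g DM X p = \sum_k (1 : R) *: curvature DM X (F k) (F k) p.
  rewrite (ricci_frame hDM oU sF oF sX Up).
  by apply: eq_bigr => k _; rewrite scale1r.
rewrite (tensorial_sum ta oU UU Up (smooth_ricci hDM oU sF oF sX) sR E).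
apply: eq_bigr => k _; rewrite scale1r.
apply: (tensorialB_field ta oU UU Up _ _ (sR k)).
- exact: (sDM sX (sDM (sF k) (sF k))).
- exact: (sDM (sF k) (sDM sX (sF k))).
rewrite /curvature [X in _ - X](_ : _ = 0) ?subr0//.
apply: (tensorial0 (conn_tensorial cM oU (sF k)) oU UU Up (smooth_lie hDM oU sX (sF k))).
exact: (lie_at sX (sF k) (frame_parallel k sX) (parX (sF k))).
Qed.

(** The exterior derivative of [alpha], evaluated on F_k and X. *)
Definition form_ext k q : 'rV[R]_n :=
  D (F k) (alpha X) q - D X (alpha (F k)) q - alpha (lie (F k) X) q.

(** The trace of the covariant derivative of [alpha]: tau for dphi, minus the
    Laplacian for D tau. *)
Definition form_div q : 'rV[R]_n :=
  \sum_k (D (F k) (alpha (F k)) q - alpha (DM (F k) (F k)) q).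

(** Replace D_k alpha(X) by D_X alpha(F_k) + alpha([F_k,X]) and the exterior
    derivative, then commute D_k with D_X.  At p the derivatives of alpha of a field
    vanishing there reduce to alpha of the derivative of the field
    ([conn_form_at]); what is left of them is alpha(Ric X). *)
Lemma weitzenbock :
  \sum_k (D (F k) (D (F k) (alpha X)) p - alpha (DM (F k) (DM (F k) X)) p) =
  D X form_div p + \sum_k curvature D (F k) X (alpha (F k)) p +
  alpha (ricci g DM X) p + \sum_k D (F k) (form_ext k) p.
Proof.
have sc Y s : smooth_field U Y -> smooth_section phi U s -> smooth_section phi U (D Y s).
  exact: (smooth_conn cD oU).
have slie k := smooth_lie hDM oU (sF k) sX.
have lie0 k : lie (F k) X p = 0.
  exact: (lie_at (sF k) sX (parX (sF k)) (frame_parallel k sX)).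
have sB := smooth_sectionB phi_smooth oU.
have E1 k : D (F k) (form_ext k) p =
    D (F k) (D (F k) (alpha X)) p - D (F k) (D X (alpha (F k))) p -
    (alpha (DM (F k) (DM (F k) X)) p - alpha (DM (F k) (DM X (F k))) p).
  have s1 := sc _ _ (sF k) (saU sX); have s2 := sc _ _ sX (saU (sF k)).
  rewrite (connB phi_smooth cD oU (sF k) (sB _ _ s1 s2) (saU (slie k)) Up).
  rewrite (connB phi_smooth cD oU (sF k) s1 s2 Up); congr (_ - _).
  rewrite (conn_form_at (sF k) (slie k) (lie0 k)).
  apply: (tensorialB_field ta oU UU Up _ _ (sDM (sF k) (slie k))).
  - exact: (sDM (sF k) (sDM (sF k) sX)).
  - exact: (sDM (sF k) (sDM sX (sF k))).
  rewrite (conn_eqS cM oU (sF k) (slie k) Up (fun r Ur => lie_conn hDM oU (sF k) sX Ur)).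
  exact: (connB smooth_idfun cM oU (sF k) (sDM (sF k) sX) (sDM sX (sF k)) Up).
have E2 : D X form_div p = \sum_k (D X (D (F k) (alpha (F k))) p -
    alpha (DM X (DM (F k) (F k))) p).
  have s1 k := sc _ _ (sF k) (saU (sF k)).
  have s2 k := saU (sDM (sF k) (sF k)).
  rewrite (conn_sum phi_smooth cD oU _ sX (fun k => sB _ _ (s1 k) (s2 k)) Up).
  apply: eq_bigr => k _; rewrite (connB phi_smooth cD oU sX (s1 k) (s2 k) Up).
  by rewrite (conn_form_at sX (sDM (sF k) (sF k)) (parF k k)).
have E3 k : curvature D (F k) X (alpha (F k)) p =
    D (F k) (D X (alpha (F k))) p - D X (D (F k) (alpha (F k))) p.
  rewrite /curvature [X in _ - X](_ : _ = 0) ?subr0//.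
  exact: (tensorial0 (conn_tensorial cD oU (saU (sF k))) oU UU Up (slie k) (lie0 k)).
rewrite E2 form_ricci -!big_split/=; apply: eq_bigr => k _; rewrite E1 E3.
move: (D _ _ p) (D X _ p) (D (F k) _ p) => a b c.
move: (alpha _ p) (alpha _ p) (alpha _ p) => a' b' c'.
by apply/rowP => l; rewrite !mxE; ring.
Qed.

End Weitzenbock.

(*BEGIN*)

(** * Second derivatives at the centre of the frame *)

Section MetricSecond.
Context {R : realType} {m n : nat} {M : manifold R m} {N : manifold R n}.
Variables (h : N -> 'M[R]_n) (phi : M -> N).
Variable DN : (N -> 'rV[R]_n) -> (N -> 'rV[R]_n) -> N -> 'rV[R]_n.
Variable D : (M -> 'rV[R]_m) -> (M -> 'rV[R]_n) -> M -> 'rV[R]_n.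
Hypotheses (phi_smooth : smooth_map phi) (hh : riemannian h)
  (hDN : levi_civita h DN) (hD : pullback_connection phi DN D).
Let cD : connection phi D := pb_connection hD.

(** The metric property applied twice along the same field. *)
Lemma pullback_metric2 U Z s t q : open U -> smooth_field U Z ->
  smooth_section phi U s -> smooth_section phi U t -> U q ->
  dfun (fun r => dfun (fun x => inner h (phi x) (s x) (t x)) r (Z r)) q (Z q) =
  inner h (phi q) (D Z (D Z s) q) (t q) +
  2 * inner h (phi q) (D Z s q) (D Z t q) +
  inner h (phi q) (s q) (D Z (D Z t) q).
Proof.
move=> oU sZ ss st Uq.
have sDs := smooth_conn cD oU sZ ss; have sDt := smooth_conn cD oU sZ st.
have met := pullback_metric phi_smooth hh hDN hD oU sZ.
have smi := smooth_inner phi_smooth hh oU.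
apply: etrans (dfun_eq (Z q) oU Uq (fun r Ur => met s t r ss st Ur)) _.
apply: etrans (dfunD (Z q) Uq (smi _ _ sDs st) (smi _ _ ss sDt)) _.
apply: etrans (congr2 +%R (met _ _ q sDs st Uq) (met _ _ q ss sDt Uq)) _.
move: (inner h (phi q)) => ip; ring.
Qed.

End MetricSecond.

Section CovForm2.
Context {R : realType} {m n : nat} {M : manifold R m} {N : manifold R n}.
Variables (phi : M -> N).
Variable DM : (M -> 'rV[R]_m) -> (M -> 'rV[R]_m) -> M -> 'rV[R]_m.
Variable D : (M -> 'rV[R]_m) -> (M -> 'rV[R]_n) -> M -> 'rV[R]_n.
Hypotheses (phi_smooth : smooth_map phi) (cM : connection (@idfun M) DM)
  (cD : connection phi D).

Lemma cov_form_tensorial2 U alpha : tensorial U alpha -> smooth_form phi U alpha ->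
  tensorial2 U (cov_form DM D alpha).
Proof.
move=> ta sa U' oU' UU Z sZ.
have ta' := tensorial_sub ta UU.
have sa' : smooth_form phi U' alpha by move=> U1 X oU1 U1U; apply: sa => // r /U1U /UU.
split; first exact: (cov_form_tensorialr cM cD oU' sZ ta' sa').
exact: (cov_form_tensoriall cM cD oU' sZ ta' sa').
Qed.

Lemma pushf_smooth_form U : smooth_form phi U (pushf phi).
Proof. by move=> U' X oU' _ sX; exact: smooth_pushf. Qed.

Lemma conn_smooth_form U sigma : smooth_section phi U sigma ->
  smooth_form phi U (fun X => D X sigma).
Proof.
move=> ss U' X oU' UU sX; apply: (smooth_conn cD oU' sX).
exact: smooth_section_sub UU ss.
Qed.

End CovForm2.

Section InnerAlgebra.
Context {R : realType} {n : nat} {N : manifold R n}.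
Variables (h : N -> 'M[R]_n).
Hypothesis hs : forall q u v, inner h q u v = inner h q v u.

Lemma inner_second_sub y (A A' B B' c1 c2 s t : 'rV[R]_n) :
  inner h y A t + 2 * inner h y c1 c2 + inner h y s B - inner h y A' t - inner h y s B' =
  inner h y (A - A') t + 2 * inner h y c1 c2 + inner h y s (B - B').
Proof. rewrite innerBl (innerBr hs); move: (inner h y) => ip; ring. Qed.

Lemma inner_weitzenbock (I : finType) y (a1 a3 b1 b3 s t : 'rV[R]_n) (A2 B2 B4 : I -> 'rV[R]_n) (x : R) :
  inner h y (a1 + \sum_k A2 k + a3) t + x +
  inner h y s (- b1 + \sum_k B2 k + b3 + \sum_k B4 k) =
  inner h y a1 t + \sum_k inner h y (A2 k) t + inner h y a3 t + x - inner h y s b1 +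
  \sum_k inner h y s (B2 k) + inner h y s b3 + \sum_k inner h y s (B4 k).
Proof.
rewrite !innerDl !(innerDr hs) (innerNr hs) inner_suml !(inner_sumr hs).
move: (\sum_k _) (\sum_k _) (\sum_k _) => s1 s2 s3; ring.
Qed.

End InnerAlgebra.

Lemma sum_antisym {R : realType} {m} (a : 'I_m -> 'I_m -> R) : (forall i j, a i j = - a j i) ->
  \sum_i \sum_j a i j = 0.
Proof.
move=> aN; have : \sum_i \sum_j a i j = - \sum_i \sum_j a i j.
  rewrite {1}exchange_big/= -sumrN; apply: eq_bigr => i _.
  by rewrite -sumrN; apply: eq_bigr => j _.
move: (\sum_i _) => S; lra.
Qed.

Section SecondDerivative.
Context {R : realType} {n : nat} {M : manifold R n}.
Variables (U : set M) (Z : M -> 'rV[R]_n) (q : M).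
Hypotheses (oU : open U) (sZ : smooth_field U Z) (Uq : U q).
Implicit Types f : M -> R.

Definition dfun2 (f : M -> R) : R := dfun (fun r => dfun f r (Z r)) q (Z q).

Lemma dfun2_eq (f1 f2 : M -> R) : (forall r, U r -> f1 r = f2 r) -> dfun2 f1 = dfun2 f2.
Proof.
move=> E; apply: (dfun_eq _ oU Uq) => r Ur; exact: (dfun_eq _ oU Ur E).
Qed.

Lemma dfun2D (f1 f2 : M -> R) : smooth_fun U f1 -> smooth_fun U f2 ->
  dfun2 (fun r => f1 r + f2 r) = dfun2 f1 + dfun2 f2.
Proof.
move=> s1 s2; apply: etrans (dfun_eq (Z q) oU Uq
  (fun r Ur => dfunD (Z r) Ur s1 s2)) _.
exact: (dfunD (Z q) Uq (smooth_dfun oU s1 sZ) (smooth_dfun oU s2 sZ)).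
Qed.

Lemma dfun2Z (a : R) (f1 : M -> R) : smooth_fun U f1 ->
  dfun2 (fun r => a * f1 r) = a * dfun2 f1.
Proof.
have Zs (f : M -> R) r v : U r -> smooth_fun U f ->
    dfun (fun x => a *: f x) r v = a *: dfun f r v.
  move=> Ur sf; rewrite (dfun_scale v Ur (smooth_fun_cst a) sf).
  by rewrite dfun_cst scale0r add0r.
move=> s1; apply: etrans (dfun_eq (Z q) oU Uq
  (fun r Ur => Zs _ _ (Z r) Ur s1)) _.
exact: (Zs _ _ (Z q) Uq (smooth_dfun oU s1 sZ)).
Qed.

Lemma dfun2B (f1 f2 : M -> R) : smooth_fun U f1 -> smooth_fun U f2 ->
  dfun2 (fun r => f1 r - f2 r) = dfun2 f1 - dfun2 f2.
Proof.
move=> s1 s2; apply: etrans (dfun_eq (Z q) oU Uq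
  (fun r Ur => dfunB (Z r) oU Ur s1 s2)) _.
exact: (dfunB (Z q) oU Uq (smooth_dfun oU s1 sZ) (smooth_dfun oU s2 sZ)).
Qed.

Lemma dfun2_sum (I : Type) (r : seq I) (f : I -> M -> R) :
  (forall i, smooth_fun U (f i)) ->
  dfun2 (fun x => \sum_(i <- r) f i x) = \sum_(i <- r) dfun2 (f i).
Proof.
move=> s; apply: etrans (dfun_eq (Z q) oU Uq
  (fun x Ux => dfun_sum r (Z x) oU Ux s)) _.
exact: (dfun_sum r (Z q) oU Uq (fun i => smooth_dfun oU (s i) sZ)).
Qed.

End SecondDerivative.

(** * The stress-bienergy tensor *)

Section Bienergy.
Context {R : realType} {m n : nat} {M : manifold R m} {N : manifold R n}.
Variables (g : M -> 'M[R]_m) (h : N -> 'M[R]_n) (phi : M -> N).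
Hypotheses (hg : riemannian g) (hh : riemannian h).
Variable DM : (M -> 'rV[R]_m) -> (M -> 'rV[R]_m) -> M -> 'rV[R]_m.
Variable DN : (N -> 'rV[R]_n) -> (N -> 'rV[R]_n) -> N -> 'rV[R]_n.
Variable D : (M -> 'rV[R]_m) -> (M -> 'rV[R]_n) -> M -> 'rV[R]_n.
Hypotheses (hDM : levi_civita g DM) (hDN : levi_civita h DN)
  (hD : pullback_connection phi DN D) (phi_smooth : smooth_map phi).
Variables (p : M) (U : set M) (F : 'I_m -> M -> 'rV[R]_m).
Hypotheses (oU : open U) (Up : U p) (sF : forall i, smooth_field U (F i)).
Hypothesis oF : forall q, U q -> forall i j, inner g q (F i q) (F j q) = (i == j)%:R.
Hypothesis parF : forall i j, DM (F i) (F j) p = 0.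
Let cM : connection (@idfun M) DM := lc_connection hDM.
Let cD : connection phi D := pb_connection hD.
Let UU : U `<=` U := @subset_refl _ U.
Let hs := Defs.metric_sym hh.
Implicit Types (X Y Z V : M -> 'rV[R]_m).

Let tau := tension g phi DM D.
Let lap_tau := laplacian g DM D tau.
Let d := pushf phi.
Let beta := fun X => D X tau.
Let Ric := ricci g DM.
Let S2 := stress_bienergy g h phi DM D.

Lemma d_tensorial : tensorial U d.
Proof. exact: pushf_tensorial. Qed.

Lemma d_smooth : smooth_form phi U d.
Proof. exact: pushf_smooth_form. Qed.

(** The tension field is the divergence of dphi. *)
Lemma tension_frame q : U q -> tau q = form_div DM D F d q.
Proof.
move=> Uq; apply: (mtrace_frame sF oU oF _ Uq).
exact: (cov_form_tensorial2 cM cD d_tensorial d_smooth).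
Qed.

Lemma smooth_form_div (alpha : (M -> 'rV[R]_m) -> M -> 'rV[R]_n) :
  smooth_form phi U alpha -> smooth_section phi U (form_div DM D F alpha).
Proof.
move=> sa; apply: (smooth_section_sum phi_smooth _ oU) => k.
apply: (smooth_sectionB phi_smooth oU).
  exact: (smooth_conn cD oU (sF k) (sa _ _ oU UU (sF k))).
exact: (sa _ _ oU UU (smooth_conn cM oU (sF k) (sF k))).
Qed.

Lemma smooth_tension : smooth_section phi U tau.
Proof.
exact: (smooth_section_eq phi_smooth oU (fun q Uq => esym (tension_frame Uq))
  (smooth_form_div d_smooth)).
Qed.

Lemma beta_tensorial : tensorial U beta.
Proof. exact: (conn_tensorial cD oU smooth_tension). Qed.

Lemma beta_smooth : smooth_form phi U beta.
Proof. exact: (conn_smooth_form cD smooth_tension). Qed.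

(** The Laplacian is minus the divergence of the 1-form D tau. *)
Lemma laplacian_frame q : U q -> lap_tau q = - form_div DM D F beta q.
Proof.
move=> Uq; rewrite /lap_tau /laplacian; congr (- _).
apply: (mtrace_frame sF oU oF _ Uq).
exact: (cov_form_tensorial2 cM cD beta_tensorial beta_smooth).
Qed.

Lemma smooth_laplacian : smooth_section phi U lap_tau.
Proof.
exact: (smooth_section_eq phi_smooth oU (fun q Uq => esym (laplacian_frame Uq))
  (smooth_sectionN phi_smooth oU (smooth_form_div beta_smooth))).
Qed.

Definition parallel_at X : Prop := forall Z, smooth_field U Z -> DM Z X p = 0.

Lemma frame_parallel_at j : parallel_at (F j).
Proof. by move=> Z sZ; exact: (frame_parallel hDM oU Up sF oF parF j sZ). Qed.

(** The exterior derivative of dphi is zero by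
    [pushf_torsion_free]. *)
Lemma weitzenbock_d X : smooth_field U X -> parallel_at X ->
  \sum_k (D (F k) (D (F k) (d X)) p - d (DM (F k) (DM (F k) X)) p) =
  D X tau p + \sum_k curvature D (F k) X (d (F k)) p + d (Ric X) p.
Proof.
move=> sX pX; apply: etrans (weitzenbock phi_smooth hDM cD oU Up sF oF parF
  d_tensorial d_smooth sX pX) _.
(* The exterior derivative vanishes on U, not only at p: it is differentiated. *)
have E0 k : D (F k) (form_ext D F d X k) p = 0.
  have sl := smooth_lie hDM oU (sF k) sX.
  have E q : U q -> form_ext D F d X k q = 0.
    move=> Uq; apply/eqP; rewrite subr_eq0; apply/eqP.
    exact: (pushf_torsion_free phi_smooth hDN hD oU (sF k) sX Uq).
  have s0 := smooth_section0 phi_smooth oU.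
  apply: etrans (esym (conn_eqS cD oU (sF k) s0 Up (fun q Uq => esym (E q Uq)))) _.
  exact: (conn_section0 phi_smooth cD oU (sF k) Up).
rewrite [X in _ + X]big1 ?addr0//; congr (_ + _ + _).
by apply: (conn_eqS cD oU sX (smooth_form_div d_smooth) Up) => q Uq; rewrite tension_frame.
Qed.

(** The exterior derivative of D tau is the curvature acting on tau. *)
Lemma weitzenbock_beta X : smooth_field U X -> parallel_at X ->
  \sum_k (D (F k) (D (F k) (D X tau)) p - D (DM (F k) (DM (F k) X)) tau p) =
  - D X lap_tau p + \sum_k curvature D (F k) X (D (F k) tau) p + D (Ric X) tau p +
  \sum_k D (F k) (curvature D (F k) X tau) p.
Proof.
move=> sX pX; apply: etrans (weitzenbock phi_smooth hDM cD oU Up sF oF parF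
  beta_tensorial beta_smooth sX pX) _.
congr (_ + _ + _ + _).
rewrite -(connN phi_smooth cD oU sX smooth_laplacian Up).
apply: (conn_eqS cD oU sX (smooth_form_div beta_smooth) Up) => q Uq.
by rewrite (laplacian_frame Uq) opprK.
Qed.

Let T X Y q := inner h (phi q) (d X q) (D Y tau q).

(** The trace at p of the second covariant derivative of
    T(X,Y) = <dphi(X), D_Y tau>, for X and Y parallel at p. *)
Definition trace_nabla2 X Y : R :=
  \sum_k (dfun (fun q => dfun (T X Y) q (F k q)) p (F k p) -
    T (DM (F k) (DM (F k) X)) Y p - T X (DM (F k) (DM (F k) Y)) p).

Local Notation dot s t := (inner h (phi p) (s p) (t p)).

Lemma cov_form_parallel (alpha : (M -> 'rV[R]_m) -> M -> 'rV[R]_n) Z X :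
  tensorial U alpha -> smooth_field U Z -> smooth_field U X -> parallel_at X ->
  cov_form DM D alpha Z X p = D Z (alpha X) p.
Proof.
move=> ta sZ sX pX; rewrite /cov_form [X in _ - X](_ : _ = 0) ?subr0//.
exact: (tensorial0 ta oU UU Up (smooth_conn cM oU sZ sX) (pX _ sZ)).
Qed.

(** Leibniz rule, then the Weitzenbock formula in each factor. *)
Lemma trace_nabla2E X Y : smooth_field U X -> smooth_field U Y ->
  parallel_at X -> parallel_at Y ->
  trace_nabla2 X Y =
  dot (D X tau) (D Y tau)
  + \sum_k dot (curvature D (F k) X (d (F k))) (D Y tau)
  + dot (d (Ric X)) (D Y tau)
  + 2 * \sum_k dot (second_fundamental_form phi DM D (F k) X) (hessian DM D tau (F k) Y)
  - dot (d X) (D Y lap_tau)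
  + \sum_k dot (d X) (curvature D (F k) Y (D (F k) tau))
  + dot (d X) (D (Ric Y) tau)
  + \sum_k dot (d X) (D (F k) (curvature D (F k) Y tau)).
Proof.
move=> sX sY pX pY.
have sdX := d_smooth oU UU sX; have sbY := beta_smooth oU UU sY.
have E k : dfun (fun q => dfun (T X Y) q (F k q)) p (F k p) -
    T (DM (F k) (DM (F k) X)) Y p - T X (DM (F k) (DM (F k) Y)) p =
    inner h (phi p) (D (F k) (D (F k) (d X)) p - d (DM (F k) (DM (F k) X)) p) (D Y tau p) +
    2 * dot (second_fundamental_form phi DM D (F k) X) (hessian DM D tau (F k) Y) +
    inner h (phi p) (d X p) (D (F k) (D (F k) (D Y tau)) p - D (DM (F k) (DM (F k) Y)) tau p).
  rewrite -(inner_second_sub hs).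
  have c1 := cov_form_parallel d_tensorial (sF k) sX pX.
  have c2 := cov_form_parallel beta_tensorial (sF k) sY pY.
  rewrite (pullback_metric2 phi_smooth hh hDN hD oU (sF k) sdX sbY Up) -c1 -c2.
  by [].
apply: etrans (eq_bigr _ (fun k _ => E k)) _.
rewrite !big_split/= -mulr_sumr -inner_suml -(inner_sumr hs).
rewrite (weitzenbock_d sX pX) (weitzenbock_beta sY pY).
exact: (inner_weitzenbock hs).
Qed.

(** The second derivative of a constant scalar product, at a point where first
    derivatives vanish. *)
Lemma double_cov_skew X Y c k : smooth_field U X -> smooth_field U Y ->
  parallel_at X -> parallel_at Y ->
  (forall q, U q -> inner g q (X q) (Y q) = c) ->
  inner g p (DM (F k) (DM (F k) X) p) (Y p) +
  inner g p (X p) (DM (F k) (DM (F k) Y) p) = 0.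
Proof.
move=> sX sY pX pY gc.
have H := pullback_metric2 smooth_idfun hg hDM (levi_civita_pullback hDM) oU (sF k) sX sY Up.
have d1 r : U r -> dfun (fun x => inner g x (X x) (Y x)) r (F k r) = 0.
  by move=> Ur; rewrite (dfun_eq (F k r) oU Ur gc) dfun_cst.
have d2 : dfun (fun r => dfun (fun x => inner g x (X x) (Y x)) r (F k r)) p (F k p) = 0.
  by rewrite (dfun_eq (F k p) oU Up d1) dfun_cst.
have := etrans (esym H) d2; rewrite (pX _ (sF k)) inner0l mulr0 addr0.
exact.
Qed.

Lemma T_tensorial2 : tensorial2 (V := R^o) U T.
Proof.
move=> U' oU' U'U Z sZ; split.
  apply: (tensorial_map (V' := R^o) (L := fun q u => inner h (phi q) (d Z q) u)).
    by move=> q a u u'; exact: (inner_linearr hs).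
  exact: (tensorial_sub beta_tensorial U'U).
apply: (tensorial_map (V' := R^o) (L := fun q u => inner h (phi q) u (D Z tau q))).
  by move=> q a u u'; exact: inner_linearl.
exact: (tensorial_sub d_tensorial U'U).
Qed.

Lemma smooth_T U' X Y : open U' -> U' `<=` U -> smooth_field U' X ->
  smooth_field U' Y -> smooth_fun U' (T X Y).
Proof.
move=> oU' U'U sX sY; apply: (smooth_inner phi_smooth hh oU').
  exact: (d_smooth oU' U'U sX).
exact: (beta_smooth oU' U'U sY).
Qed.

Definition bienergy_density q : R :=
  inner h (phi q) (tau q) (tau q) / 2 + mtrace g (V := R^o) T q.

Lemma stress_bienergyE X Y q : S2 X Y q =
  bienergy_density q * inner g q (X q) (Y q) - T X Y q - T Y X q.
Proof. by []. Qed.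

Lemma bienergy_density_frame q : U q -> bienergy_density q =
  2^-1 * inner h (phi q) (tau q) (tau q) + \sum_j T (F j) (F j) q.
Proof.
move=> Uq; rewrite /bienergy_density mulrC; congr (_ + _).
exact: (mtrace_frame sF oU oF T_tensorial2 Uq).
Qed.

Let smooth_tension_energy : smooth_fun U (fun q => 2^-1 * inner h (phi q) (tau q) (tau q)).
Proof.
apply: (smooth_fun_scale (f := fun q => inner h (phi q) (tau q) (tau q) : R^o) oU).
  exact: smooth_fun_cst.
exact: (smooth_inner phi_smooth hh oU smooth_tension smooth_tension).
Qed.

Lemma smooth_bienergy_density : smooth_fun U bienergy_density.
Proof.
apply: (smooth_fun_eq oU (fun q Uq => esym (bienergy_density_frame Uq))).
apply: (smooth_funD oU smooth_tension_energy); apply: (smooth_fun_sum _ oU) => j.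
exact: (smooth_T oU UU (sF j) (sF j)).
Qed.

Lemma stress_bienergy_tensor : smooth_tensor2 U S2.
Proof.
split=> [U' oU' U'U Z sZ|U' X Y oU' U'U sX sY].
  have [t1 t2] := T_tensorial2 oU' U'U sZ; split.
    apply: (tensorialB _ t2); apply: (tensorialB _ t1).
    apply: (tensorial_pointwise (V := R^o)
      (L := fun q u => bienergy_density q * inner g q (Z q) u)) => //.
    move=> q a u v; rewrite (inner_linearr (Defs.metric_sym hg)).
    by move: (inner g q) => gg; rewrite /GRing.scale/=; ring.
  apply: (tensorialB _ t1); apply: (tensorialB _ t2).
  apply: (tensorial_pointwise (V := R^o)
    (L := fun q u => bienergy_density q * inner g q u (Z q))) => //.
  move=> q a u v; rewrite inner_linearl.
  by move: (inner g q) => gg; rewrite /GRing.scale/=; ring.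
apply: (smooth_funB oU'); last exact: smooth_T.
apply: (smooth_funB oU'); last exact: smooth_T.
apply: (smooth_fun_scale (f := fun q => inner g q (X q) (Y q) : R^o) oU').
  exact: (smooth_fun_sub U'U smooth_bienergy_density).
exact: (metric_smooth hg oU' sX sY).
Qed.

Lemma rough_laplacian_at S X Y : smooth_tensor2 U S ->
  smooth_field U X -> smooth_field U Y -> parallel_at X -> parallel_at Y ->
  rough_laplacian g DM S X Y p = - \sum_k (dfun2 (F k) p (S X Y) -
    S (DM (F k) (DM (F k) X)) Y p - S X (DM (F k) (DM (F k) Y)) p).
Proof.
move=> sS sX sY pX pY; rewrite /rough_laplacian; congr (- _).
apply: etrans (mtrace_frame sF oU oF (cov2_tensorial cM oU sS sX sY) Up) _.
apply: eq_bigr => k _.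
rewrite (tensorial0 (cov_tensor_tensorial cM oU sS sX sY) oU UU Up
  (smooth_conn cM oU (sF k) (sF k)) (parF k k)) subr0.
exact: (cov2_at cM oU Up sS (sF k) sX sY (pX _ (sF k)) (pY _ (sF k))).
Qed.

(** The metric being parallel, the terms with second derivatives of X and
    Y in f g cancel, and f g contributes through f only. *)
Lemma rough_laplacian_stress X Y c : smooth_field U X -> smooth_field U Y ->
  parallel_at X -> parallel_at Y ->
  (forall q, U q -> inner g q (X q) (Y q) = c) ->
  rough_laplacian g DM S2 X Y p =
  - (\sum_k dfun2 (F k) p bienergy_density) * c +
  trace_nabla2 X Y + trace_nabla2 Y X.
Proof.
move=> sX sY pX pY gc.
rewrite (rough_laplacian_at stress_bienergy_tensor sX sY pX pY).
rewrite mulNr mulr_suml -!sumrN -!big_split/=; apply: eq_bigr => k _.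
have E : dfun2 (F k) p (S2 X Y) =
    c * dfun2 (F k) p bienergy_density - dfun2 (F k) p (T X Y) - dfun2 (F k) p (T Y X).
  have sXY := smooth_T oU UU sX sY; have sYX := smooth_T oU UU sY sX.
  have se := smooth_bienergy_density.
  have sce := smooth_fun_scale oU (smooth_fun_cst c) se.
  have H q : U q -> S2 X Y q = c * bienergy_density q - T X Y q - T Y X q.
    by move=> Uq; rewrite stress_bienergyE (gc q Uq) [c * _]mulrC.
  apply: etrans (dfun2_eq (F k) oU Up H) _.
  apply: etrans (dfun2B oU (sF k) Up (smooth_funB oU sce sXY) sYX) _.
  congr (_ - _); apply: etrans (dfun2B oU (sF k) Up sce sXY) _.
  by congr (_ - _); exact: (dfun2Z oU (sF k) Up c se).
rewrite E !stress_bienergyE.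
have sk := double_cov_skew k sX sY pX pY gc.
rewrite -/(dfun2 (F k) p (T X Y)) -/(dfun2 (F k) p (T Y X)).
move: sk; move: (inner g p) => gg.
move: (dfun2 _ _ _) (dfun2 _ _ _) (dfun2 _ _ _) => x1 x2 x3.
move: (T) (bienergy_density p) => tt e sk.
have -> : gg (DM (F k) (DM (F k) X) p) (Y p) = - gg (X p) (DM (F k) (DM (F k) Y) p).
  by apply/eqP; rewrite -addr_eq0 sk.
ring.
Qed.

(** The second covariant derivatives of the frame have skew coefficients in
    the frame, by [double_cov_skew], and B is contracted symmetrically. *)
Lemma tensor_trace_skew (B : (M -> 'rV[R]_m) -> (M -> 'rV[R]_m) -> M -> R) k :
  tensorial2 (V := R^o) U B ->
  \sum_j (B (DM (F k) (DM (F k) (F j))) (F j) p +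
          B (F j) (DM (F k) (DM (F k) (F j))) p) = 0.
Proof.
move=> tB; pose w j := DM (F k) (DM (F k) (F j)).
have sw j : smooth_field U (w j).
  exact: (smooth_conn cM oU (sF k) (smooth_conn cM oU (sF k) (sF j))).
pose c j l := inner g p (w j p) (F l p).
have cs j l : c j l = - c l j.
  apply/eqP; rewrite -addr_eq0 /c (Defs.metric_sym hg _ (w l p)).
  by rewrite (double_cov_skew k (sF j) (sF l) (frame_parallel_at j) (frame_parallel_at l)
    (fun q Uq => oF Uq j l)).
have E1 j : B (w j) (F j) p = \sum_l c j l * B (F l) (F j) p.
  exact: (tensorial_sum (tB _ oU UU _ (sF j)).2 oU UU Up (sw j) sF
    (frame_expansion oF (w j p) Up)).
have E2 j : B (F j) (w j) p = \sum_l c j l * B (F j) (F l) p.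
  exact: (tensorial_sum (tB _ oU UU _ (sF j)).1 oU UU Up (sw j) sF
    (frame_expansion oF (w j p) Up)).
under eq_bigr do rewrite (E1) (E2).
rewrite big_split/= [X in _ + X]exchange_big/= -big_split/= big1// => j _.
rewrite -big_split/= big1// => l _.
by rewrite (cs l j); move: (c j l) (B _ _ p) => x y; ring.
Qed.

Lemma laplacian_at : \sum_k D (F k) (D (F k) tau) p = - lap_tau p.
Proof.
rewrite (laplacian_frame Up) opprK; apply: eq_bigr => k _.
rewrite [X in _ = _ - X](_ : _ = 0) ?subr0//.
exact: (tensorial0 beta_tensorial oU UU Up (smooth_conn cM oU (sF k) (sF k)) (parF k k)).
Qed.

(** The trace of T is differentiated in the frame; the correction terms
    that make up [trace_nabla2] add up to zero by [tensor_trace_skew]. *)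
Lemma bienergy_density_laplacian :
  \sum_k dfun2 (F k) p bienergy_density =
  - dot lap_tau tau + \sum_k dot (D (F k) tau) (D (F k) tau) +
  \sum_j trace_nabla2 (F j) (F j).
Proof.
have E k : dfun2 (F k) p bienergy_density =
    dot (D (F k) (D (F k) tau)) tau + dot (D (F k) tau) (D (F k) tau) +
    \sum_j dfun2 (F k) p (T (F j) (F j)).
  apply: etrans (dfun2_eq (F k) oU Up bienergy_density_frame) _.
  have sT j := smooth_T oU UU (sF j) (sF j).
  have stt := smooth_inner phi_smooth hh oU smooth_tension smooth_tension.
  apply: etrans (dfun2D oU (sF k) Up smooth_tension_energy (smooth_fun_sum _ oU sT)) _.
  congr (_ + _); last exact: (dfun2_sum oU (sF k) Up _ sT).
  apply: etrans (dfun2Z oU (sF k) Up _ stt) _.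
  apply: etrans (congr1 ( *%R 2^-1) (pullback_metric2 phi_smooth hh hDN hD oU (sF k)
    smooth_tension smooth_tension Up)) _.
  by rewrite (hs (phi p) (tau p)); move: (inner h (phi p)) => ipp; field.
apply: etrans (eq_bigr _ (fun k _ => E k)) _.
rewrite !big_split/= -inner_suml laplacian_at innerNl; congr (_ + _ + _).
rewrite exchange_big/= /trace_nabla2.
apply/eqP; rewrite -subr_eq0 -sumrB; under eq_bigr do rewrite -sumrB.
rewrite exchange_big/= big1// => k _.
apply: etrans (tensor_trace_skew k T_tensorial2).
apply: eq_bigr => j _; rewrite /dfun2.
move: (dfun _ p _) => x; move: (T) => tt; ring.
Qed.

Lemma tension_at : \sum_k D (F k) (d (F k)) p = tau p.
Proof.
rewrite (tension_frame Up); apply: eq_bigr => k _.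
rewrite [X in _ = _ - X](_ : _ = 0) ?subr0//.
exact: (tensorial0 d_tensorial oU UU Up (smooth_conn cM oU (sF k) (sF k)) (parF k k)).
Qed.

Lemma pullback_curvatureF X Y s q : smooth_field U X -> smooth_field U Y ->
  smooth_section phi U s -> U q ->
  curvature D X Y s q = curvature_tensor DN (phi q) (d X q) (d Y q) (s q).
Proof.
by move=> sX sY ss Uq; exact: (pullback_curvature phi_smooth hDM hDN hD oU sX sY ss Uq).
Qed.

Lemma pullback_curvature_skew X Y s t q : smooth_field U X -> smooth_field U Y ->
  smooth_section phi U s -> smooth_section phi U t -> U q ->
  inner h (phi q) (s q) (curvature D X Y t q) =
  inner h (phi q) (curvature D Y X s q) (t q).
Proof.
move=> sX sY ss st Uq.
rewrite (pullback_curvatureF sX sY st Uq) (pullback_curvatureF sY sX ss Uq).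
apply: etrans (congr1 (inner h (phi q) (s q)) (curvature_tensorC hDN (phi q) _ _ _)) _.
by rewrite (innerNr hs) (curvature_tensor_skew hh hDN).
Qed.

Hypothesis hbi : forall q, bitension g phi DM DN D q = 0.

(** This is the equation of biharmonic maps, with its trace taken in the
    frame. *)
Lemma laplacian_curvature q : U q -> lap_tau q =
  - \sum_j curvature_tensor DN (phi q) (d (F j) q) (tau q) (d (F j) q).
Proof.
move=> Uq; rewrite /lap_tau /laplacian; congr (- _).
have := hbi q; rewrite /bitension => /eqP; rewrite subr_eq0 => /eqP H.
apply: etrans H _; apply: (mtrace_frame sF oU oF _ Uq).
move=> U' oU' U'U Z sZ; split.
  apply: (tensorial_map (L := fun q u => curvature_tensor DN (phi q) (d Z q) (tau q) u)).
    by move=> r a u v; exact: (curvature_tensor_linear3 hDN).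
  exact: (tensorial_sub d_tensorial U'U).
apply: (tensorial_map (L := fun q u => curvature_tensor DN (phi q) u (tau q) (d Z q))).
  by move=> r a u v; exact: (curvature_tensor_linear1 hDN).
exact: (tensorial_sub d_tensorial U'U).
Qed.

(** The pair symmetry of R^N moves tau into the place that it has in the
    equation of biharmonic maps. *)
Lemma trace_curvature_tension i q : U q ->
  \sum_j inner h (phi q) (d (F j) q) (curvature D (F i) (F j) tau q) =
  - inner h (phi q) (lap_tau q) (d (F i) q).
Proof.
move=> Uq; rewrite (laplacian_curvature Uq) innerNl opprK inner_suml.
apply: eq_bigr => j _.
rewrite (pullback_curvatureF (sF i) (sF j) smooth_tension Uq) hs.
apply: etrans (curvature_tensor_pair hh hDN (phi q) _ _ _ _) _.
apply: etrans (congr1 (fun x => inner h (phi q) x _) (curvature_tensorC hDN (phi q) _ _ _)) _.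
rewrite innerNl; apply: etrans (congr1 -%R (curvature_tensor_skew hh hDN (phi q) _ _ _ _)) _.
by rewrite opprK; exact: hs.
Qed.

Lemma frame_second_form_sym i j : D (F i) (d (F j)) p = D (F j) (d (F i)) p.
Proof.
apply/eqP; rewrite -subr_eq0.
rewrite (pushf_torsion_free phi_smooth hDN hD oU (sF i) (sF j) Up).
apply/eqP; apply: (tensorial0 d_tensorial oU UU Up (smooth_lie hDM oU (sF i) (sF j))).
exact: (lie_at hDM oU Up (sF i) (sF j) (parF i j) (parF j i)).
Qed.

(** Differentiate [trace_curvature_tension] along F_k and sum.  The terms
    <D_k dphi(F_j), R(F_k,F_j) tau> add up to zero, as the second fundamental form is
    symmetric and R is not. *)
Lemma divergence_curvature_tension :
  \sum_k \sum_j dot (d (F j)) (D (F k) (curvature D (F k) (F j) tau)) =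
  - \sum_k dot (d (F k)) (D (F k) lap_tau) - dot lap_tau tau.
Proof.
have sd j : smooth_section phi U (d (F j)) := d_smooth oU UU (sF j).
have sR k j := smooth_curvature hDM phi_smooth cD oU (sF k) (sF j) smooth_tension.
have met := pullback_metric phi_smooth hh hDN hD oU.
have E k : \sum_j dot (D (F k) (d (F j))) (curvature D (F k) (F j) tau) +
    \sum_j dot (d (F j)) (D (F k) (curvature D (F k) (F j) tau)) =
    - dot (d (F k)) (D (F k) lap_tau) - dot lap_tau (D (F k) (d (F k))).
  rewrite -big_split/=.
  have sj j := smooth_inner phi_smooth hh oU (sd j) (sR k j).
  have H1 := dfun_eq (F k p) oU Up (fun q Uq => trace_curvature_tension k Uq).
  have H2 := dfun_sum (index_enum 'I_m) (F k p) oU Up sj.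
  have sl := smooth_inner phi_smooth hh oU smooth_laplacian (sd k).
  have H3 : dfun (fun q => - inner h (phi q) (lap_tau q) (d (F k) q)) p (F k p) =
      - (dot (D (F k) lap_tau) (d (F k)) + dot lap_tau (D (F k) (d (F k)))).
    rewrite -(met _ _ _ _ (sF k) smooth_laplacian (sd k) Up).
    have s0 := smooth_fun_cst (U := U) (0 : R).
    rewrite (dfun_eq (g := fun q => 0 - inner h (phi q) (lap_tau q) (d (F k) q)) _ oU Up); last first.
      by move=> q _; rewrite sub0r.
    by rewrite (dfunB (F k p) oU Up s0 sl) dfun_cst sub0r.
  apply: etrans (etrans _ (etrans (esym H2) (etrans H1 H3))) _.
    by apply: eq_bigr => j _; rewrite (met _ _ _ _ (sF k) (sd j) (sR k j) Up).
  by rewrite opprD (hs (phi p) (D (F k) lap_tau p)).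
have Z : \sum_k \sum_j dot (D (F k) (d (F j))) (curvature D (F k) (F j) tau) = 0.
  apply: sum_antisym => i j; rewrite frame_second_form_sym -(innerNr hs).
  rewrite (pullback_curvatureF (sF i) (sF j) smooth_tension Up).
  rewrite (pullback_curvatureF (sF j) (sF i) smooth_tension Up).
  by congr (inner h (phi p) _ _); exact: (curvature_tensorC hDN).
have S := eq_bigr _ (fun k (_ : true) => E k).
have := S 0 +%R (index_enum 'I_m); rewrite !big_split/= Z add0r => ->.
by rewrite !sumrN -(inner_sumr hs) tension_at.
Qed.

(** Both sides contract the symmetric matrix of Ricci in the frame with
    <dphi(F_j), D_l tau>. *)
Lemma ricci_trace :
  \sum_j dot (d (F j)) (D (Ric (F j)) tau) = \sum_j dot (d (Ric (F j))) (D (F j) tau).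
Proof.
have sR j : smooth_field U (Ric (F j)) := smooth_ricci hDM oU sF oF (sF j).
pose c j l := inner g p (Ric (F j) p) (F l p).
have cs j l : c j l = c l j := ricci_sym hg hDM oU sF oF (sF j) (sF l) Up.
have E1 j : dot (d (F j)) (D (Ric (F j)) tau) = \sum_l c j l * dot (d (F j)) (D (F l) tau).
  have := tensorial_sum beta_tensorial oU UU Up (sR j) sF (frame_expansion oF (Ric (F j) p) Up).
  rewrite /beta => ->; rewrite (inner_sumr hs); apply: eq_bigr => l _.
  by rewrite (innerZr hs).
have E2 j : dot (d (Ric (F j))) (D (F j) tau) = \sum_l c j l * dot (d (F l)) (D (F j) tau).
  have -> := tensorial_sum d_tensorial oU UU Up (sR j) sF (frame_expansion oF (Ric (F j) p) Up).
  by rewrite inner_suml; apply: eq_bigr => l _; rewrite innerZl.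
under eq_bigr do rewrite E1; under [RHS]eq_bigr do rewrite E2.
rewrite exchange_big/=; apply: eq_bigr => j _; apply: eq_bigr => l _.
by rewrite (cs l j).
Qed.

(** The sums of [trace_nabla2E] for X = Y = F_j, of which the last three
    are turned into the others by skewness of R, symmetry of Ricci, and
    biharmonicity. *)
Lemma trace_trace_nabla2 :
  \sum_j trace_nabla2 (F j) (F j) =
  \sum_i dot (D (F i) tau) (D (F i) tau)
  + 2 * (\sum_i \sum_j dot (curvature D (F i) (F j) (d (F i))) (D (F j) tau))
  + 2 * (\sum_i dot (d (Ric (F i))) (D (F i) tau))
  + 2 * (\sum_i \sum_j dot (second_fundamental_form phi DM D (F i) (F j))
                            (hessian DM D tau (F i) (F j)))
  - 2 * (\sum_i dot (d (F i)) (D (F i) lap_tau)) - dot lap_tau tau.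
Proof.
have pF := frame_parallel_at.
apply: etrans (eq_bigr _ (fun j _ => trace_nabla2E (sF j) (sF j) (pF j) (pF j))) _.
have K1 : \sum_j \sum_k dot (d (F j)) (curvature D (F k) (F j) (D (F k) tau)) =
    \sum_i \sum_j dot (curvature D (F i) (F j) (d (F i))) (D (F j) tau).
  apply: eq_bigr => j _; apply: eq_bigr => k _.
  exact: (pullback_curvature_skew (sF k) (sF j) (d_smooth oU UU (sF j))
    (beta_smooth oU UU (sF k)) Up).
have K3 := divergence_curvature_tension; rewrite exchange_big/= in K3.
have K0 : \sum_j \sum_k dot (curvature D (F k) (F j) (d (F k))) (D (F j) tau) =
    \sum_i \sum_j dot (curvature D (F i) (F j) (d (F i))) (D (F j) tau).
  exact: exchange_big.
have K4 : \sum_j \sum_k dot (second_fundamental_form phi DM D (F k) (F j))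
      (hessian DM D tau (F k) (F j)) =
    \sum_i \sum_j dot (second_fundamental_form phi DM D (F i) (F j))
      (hessian DM D tau (F i) (F j)).
  exact: exchange_big.
rewrite !big_split/= sumrN -mulr_sumr K0 K1 K3 K4 ricci_trace.
move: (\sum_i _) (\sum_i _) (\sum_i _) (\sum_i _) (\sum_i _).
move: (inner h (phi p) _ _) => l s1 s2 s3 s4 s5; ring.
Qed.

Lemma rough_laplacian_bienergy X Y c : smooth_field U X -> smooth_field U Y ->
  parallel_at X -> parallel_at Y ->
  (forall q, U q -> inner g q (X q) (Y q) = c) ->
  rough_laplacian g DM S2 X Y p =
    (2 * dot lap_tau tau
     - 2 * (\sum_i dot (D (F i) tau) (D (F i) tau))
     - 2 * (\sum_i \sum_j dot (curvature D (F i) (F j) (d (F i))) (D (F j) tau))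
     - 2 * (\sum_i dot (d (Ric (F i))) (D (F i) tau))
     - 2 * (\sum_i \sum_j dot (second_fundamental_form phi DM D (F i) (F j))
                               (hessian DM D tau (F i) (F j)))
     + 2 * (\sum_i dot (d (F i)) (D (F i) lap_tau))) * c
    + trace_nabla2 X Y + trace_nabla2 Y X.
Proof.
move=> sX sY pX pY gc; rewrite (rough_laplacian_stress sX sY pX pY gc).
rewrite bienergy_density_laplacian trace_trace_nabla2.
congr (_ * _ + _ + _).
move: (\sum_i _) (\sum_i _) (\sum_i _) (\sum_i _) (\sum_i _).
move: (inner h (phi p) _ _) => l s1 s2 s3 s4 s5; ring.
Qed.

Lemma smooth_frame_comb a : smooth_field U (frame_comb F a).
Proof.
apply: (smooth_section_sum smooth_idfun _ oU) => i.
exact: (smooth_section_scale smooth_idfun oU (smooth_fun_cst (a i)) (sF i)).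
Qed.

Lemma frame_comb_parallel a : parallel_at (frame_comb F a).
Proof.
move=> Z sZ.
apply: etrans (conn_lincomb smooth_idfun cM oU _ sZ (fun i => smooth_fun_cst (a i)) sF Up) _.
by rewrite big1// => i _; rewrite dfun_cst scale0r add0r frame_parallel_at ?scaler0.
Qed.

Lemma inner_frame_comb a b q : U q ->
  inner g q (frame_comb F a q) (frame_comb F b q) = \sum_i a i * b i.
Proof.
move=> Uq; rewrite /frame_comb inner_suml; apply: eq_bigr => i _.
rewrite innerZl (inner_sumr (Defs.metric_sym hg)) (bigD1 i)//=.
rewrite (innerZr (Defs.metric_sym hg)) oF// eqxx mulr1 big1 ?addr0// => j ji.
by rewrite (innerZr (Defs.metric_sym hg)) oF// eq_sym (negbTE ji) mulr0.
Qed.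

End Bienergy.

(** * The rough Laplacian of the stress-bienergy tensor *)

Lemma stress_bienergyC {R : realType} {m n} {M : manifold R m} {N : manifold R n}
    (g : M -> 'M[R]_m) (h : N -> 'M[R]_n) (phi : M -> N) DM D X Y :
  (forall q u v, inner g q u v = inner g q v u) ->
  stress_bienergy g h phi DM D X Y = stress_bienergy g h phi DM D Y X.
Proof.
move=> gs; apply/funext => q; rewrite /stress_bienergy (gs q (X q)).
by rewrite -!addrA; congr (_ + _); rewrite addrC.
Qed.

Lemma cov_tensorC {R : realType} {m} {M : manifold R m}
    (DM : (M -> 'rV[R]_m) -> (M -> 'rV[R]_m) -> M -> 'rV[R]_m) S Z X Y :
  (forall V W, S V W = S W V) -> cov_tensor DM S Z X Y = cov_tensor DM S Z Y X.
Proof.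
move=> SC; apply/funext => q; rewrite /cov_tensor (SC X Y) (SC (DM Z X)).
by rewrite (SC X) addrAC.
Qed.

Lemma rough_laplacianC {R : realType} {m} {M : manifold R m} g
    (DM : (M -> 'rV[R]_m) -> (M -> 'rV[R]_m) -> M -> 'rV[R]_m) S X Y :
  (forall V W, S V W = S W V) ->
  rough_laplacian g DM S X Y = rough_laplacian g DM S Y X.
Proof.
move=> SC; apply/funext => q; rewrite /rough_laplacian; congr (- _).
apply: eq_bigr => i _; apply: eq_bigr => j _; congr (_ *: (_ - _)).
  have C := @cov_tensorC _ _ _ DM (cov_tensor DM S _) _ X Y.
  by rewrite C// => V W; exact: (@cov_tensorC _ _ _ DM S _ V W SC).
by rewrite (@cov_tensorC _ _ _ DM S _ X Y SC).
Qed.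

Unset Implicit Arguments.

Theorem proposition1 (R : realType) (m n : nat)
    (M : manifold R m) (N : manifold R n)
    (g : M -> 'M[R]_m) (h : N -> 'M[R]_n)
    (hg : riemannian g) (hh : riemannian h)
    (DM : (M -> 'rV[R]_m) -> (M -> 'rV[R]_m) -> M -> 'rV[R]_m)
    (DN : (N -> 'rV[R]_n) -> (N -> 'rV[R]_n) -> N -> 'rV[R]_n)
    (hDM : levi_civita g DM) (hDN : levi_civita h DN)
    (phi : M -> N)
    (D : (M -> 'rV[R]_m) -> (M -> 'rV[R]_n) -> M -> 'rV[R]_n)
    (hD : pullback_connection phi DN D)
    (hphi : biharmonic g phi DM DN D)
    (p : M) (U : set M) (F : 'I_m -> M -> 'rV[R]_m)
    (hF : geodesic_frame g DM p U F)
    (a b : 'I_m -> R) :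
  let X := frame_comb F a in
  let Y := frame_comb F b in
  let tau := tension g phi DM D in
  let lap_tau := laplacian g DM D tau in
  let d := pushf phi in
  let Ric := ricci g DM in
  let sff := second_fundamental_form phi DM D in
  let hess_tau := hessian DM D tau in
  let Rphi := curvature D in
  let dot := fun s t : M -> 'rV[R]_n => inner h (phi p) (s p) (t p) in
  let S2 := stress_bienergy g h phi DM D in
  let LapS2 := rough_laplacian g DM S2 in
  LapS2 X Y p =
    (2 * dot lap_tau tau
     - 2 * (\sum_i dot (D (F i) tau) (D (F i) tau))
     - 2 * (\sum_i \sum_j dot (Rphi (F i) (F j) (d (F i))) (D (F j) tau))
     - 2 * (\sum_i dot (d (Ric (F i))) (D (F i) tau))
     - 2 * (\sum_i \sum_j dot (sff (F i) (F j)) (hess_tau (F i) (F j)))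
     + 2 * (\sum_i dot (d (F i)) (D (F i) lap_tau))) * inner g p (X p) (Y p)
    + 2 * dot (D X tau) (D Y tau)
    + (\sum_i dot (Rphi (F i) X (d (F i))) (D Y tau))
    + (\sum_i dot (Rphi (F i) Y (d (F i))) (D X tau))
    + dot (d (Ric X)) (D Y tau)
    + dot (d (Ric Y)) (D X tau)
    + 2 * (\sum_i dot (sff (F i) X) (hess_tau (F i) Y))
    + 2 * (\sum_i dot (sff (F i) Y) (hess_tau (F i) X))
    - dot (d X) (D Y lap_tau)
    - dot (d Y) (D X lap_tau)
    + (\sum_i dot (d X) (Rphi (F i) Y (D (F i) tau)))
    + (\sum_i dot (d Y) (Rphi (F i) X (D (F i) tau)))
    + (\sum_i dot (d X) (D (F i) (Rphi (F i) Y tau)))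
    + (\sum_i dot (d Y) (D (F i) (Rphi (F i) X tau)))
    + dot (d X) (D (Ric Y) tau)
    + dot (d Y) (D (Ric X) tau)
  /\ LapS2 X Y p = LapS2 Y X p.
Proof.
move=> X Y tau lap_tau d Ric sff hess_tau Rphi dot S2 LapS2.
split; last first.
  apply: (congr1 (fun f => f p)); apply: rough_laplacianC => V W.
  by apply: stress_bienergyC; exact: (Defs.metric_sym hg).
have [phi_smooth hbi] := hphi.
have [[oU Up] sF oF0 _] := hF.
have oF q : U q -> forall i j, inner g q (F i q) (F j q) = (i == j)%:R.
  by move=> Uq; apply: oF0; exact: mem_set.
have parF i j : DM (F i) (F j) p = 0 by exact: (geodesic_frame_parallel hDM i j hF).
have sX : smooth_field U X by exact: smooth_frame_comb.
have sY : smooth_field U Y by exact: smooth_frame_comb.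
have pX : parallel_at DM p U X by exact: (frame_comb_parallel hDM oU Up sF oF parF).
have pY : parallel_at DM p U Y by exact: (frame_comb_parallel hDM oU Up sF oF parF).
have gc q : U q -> inner g q (X q) (Y q) = inner g p (X p) (Y p).
  by move=> Uq; rewrite (inner_frame_comb hg oF a b Uq) (inner_frame_comb hg oF a b Up).
have H := rough_laplacian_bienergy hg hh hDM hDN hD phi_smooth oU Up sF oF parF hbi
  sX sY pX pY gc.
have EXY := trace_nabla2E hh hDM hDN hD phi_smooth oU Up sF oF parF sX sY pX pY.
have EYX := trace_nabla2E hh hDM hDN hD phi_smooth oU Up sF oF parF sY sX pY pX.
have tC : dot (D Y tau) (D X tau) = dot (D X tau) (D Y tau) by exact: (Defs.metric_sym hh).
have assemble (C t t' r1 r2 q1 q2 s1 s2 l1 l2 w1 w2 z1 z2 v1 v2 : R) : t' = t ->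
    C + (t + r1 + q1 + 2 * s1 - l1 + w1 + v1 + z1) +
        (t' + r2 + q2 + 2 * s2 - l2 + w2 + v2 + z2) =
    C + 2 * t + r1 + r2 + q1 + q2 + 2 * s1 + 2 * s2 - l1 - l2 + w1 + w2 + z1 + z2 + v1 + v2.
  by move=> ->; ring.
apply: etrans H _; apply: etrans (congr2 (fun u v => _ + u + v) EXY EYX) _.
exact: assemble tC.
Qed.
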